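(* Let $n\ge1$ be an integer, let $\ell>0$ be real with $\lfloor\ell\rfloor\ge n+1$, and let $R>0$. There exist two constants $C_A=C_A(R,\ell,n)$ and $C_B=C_B(R,\ell,n)$, depending only on $R,\ell,n$, such that for every $s\in(0,1]$ and every $C^\ell$ function $f$ on $B_\infty(0,2R)\times\mathbb T^n$ there exists an analytic function $\mathtt f_s$ on $\mathbb A^n_s$ satisfying $$\|f-\mathtt f_s\|_{C^p(B_\infty(0,R)\times\mathbb T^n)}\le C_A\, s^{\ell-p}\,|f|_{C^\ell(B_\infty(0,2R)\times\mathbb T^n)}\qquad\text{for every integer } 0\le p\le\lfloor\ell\rfloor,$$ and $$\|\mathtt f_s\|_{s,s}\le C_B\,|f|_{C^\ell(B_\infty(0,2R)\times\mathbb T^n)} .$$ Moreover, $\mathtt f_s$ is a trigonometric polynomial in the angular variables.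
   Context: Notation. $\mathbb T^n=\mathbb R^n/2\pi\mathbb Z^n$ and $\mathbb T^n_{\mathbb C}=\mathbb C^n/2\pi\mathbb Z^n$. $B_\infty(0,R)$ is the open ball of radius $R$ centered at $0$ in $\mathbb R^n$ for the sup-norm. For $s>0$, let $\mathbb R^n_s:=\{z\in\mathbb C^n: |\operatorname{Im}z|_2<s\}$ ($|\cdot|_2$ the Euclidean norm), $\mathbb T^n_s:=\{\theta\in\mathbb T^n_{\mathbb C}:\max_j|\operatorname{Im}\theta_j|<s\}$, and $\mathbb A^n_s:=\mathbb R^n_s\times\mathbb T^n_s$. Weighted Fourier norm. For an analytic function $g$ on $\mathbb A^n_s$ with Fourier expansion $g(I,\theta)=\sum_{k\in\mathbb Z^n}\hat g_k(I)e^{\mathrm i k\cdot\theta}$, set $$\|g\|_{s,s}:=\sup_{I\in\mathbb R^n_s}\ \sum_{k\in\mathbb Z^n}|\hat g_k(I)|\,e^{|k|_1 s},\qquad |k|_1=|k_1|+\dots+|k_n| .$$ ''Trigonometric polynomial in the angular variables'' means that only finitely many $\hat g_k$ are not identically zero. Hölder spaces. For an integer $q\ge0$ and an open set $D$, $\|f\|_{C^q(D)}:=\sup_{|\alpha|\le q}\sup_{x\in D}|\partial^\alpha f(x)|$. For non-integer $\ell>0$ write $q=\lfloor\ell\rfloor$, $\mu=\ell-q\in(0,1)$; a $C^\ell$ function on $D$ is a real-valued $C^q$ function with $$|f|_{C^\ell(D)}:=\|f\|_{C^q(D)}+\sup_{|\alpha|=q}\ \sup_{x,y\in D,\ 0<|x-y|<1}\frac{|\partial^\alpha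 f(x)-\partial^\alpha f(y)|}{|x-y|^\mu}<\infty .$$ For integer $\ell$, $|f|_{C^\ell(D)}:=\|f\|_{C^\ell(D)}$, required to be finite. Functions on $D\times\mathbb T^n$ are identified with functions on $D\times\mathbb R^n$ that are $2\pi\mathbb Z^n$-periodic in the last $n$ variables. *)

(* Defs.v *)
From HB Require Import structures.
From mathcomp Require Import all_boot all_order all_algebra.
From mathcomp Require Import all_classical all_reals all_analysis.
From mathcomp Require Import complex.

Set Implicit Arguments.
Unset Strict Implicit.
Unset Printing Implicit Defensive.

Import Order.TTheory GRing.Theory Num.Theory.
Import numFieldNormedType.Exports.

Local Open Scope classical_set_scope.
Local Open Scope ring_scope.
Local Open Scope complex_scope.

(* Modulus of a complex number, as an element of R (the library's `|z| is an
   element of R[i]). *)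
Notation cabs := ComplexField.Normc.normc.

(* Conventions.  A point (I, theta) of R^n x R^n (or C^n x C^n) is the row
   vector row_mx I theta of length n + n.  Functions on D x T^n, or on
   R^n_s x T^n_s, are functions of such vectors that are 2 pi Z^n-periodic in
   the last n coordinates; they are total functions of which only the values on
   the indicated set matter. *)

(* Euclidean norm (the library's norm on 'rV[R]_m is the sup norm). *)
Definition enorm (R : realType) m (x : 'rV[R]_m) : R :=
  Num.sqrt (\sum_(j < m) x 0 j ^+ 2).

Definition vec_of_int (R : realType) n (k : 'rV[int]_n) : 'rV[R]_n :=
  map_mx intr k.

Definition cvec (R : realType) m (x : 'rV[R]_m) : 'rV[R[i]]_m :=
  map_mx (fun t : R => t%:C) x.

Section SmoothFunctions.
Variables (R : realType) (m : nat).
Implicit Types (D : set 'rV[R]_m) (f : 'rV[R]_m -> R) (h : 'rV[R]_m -> R[i]).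

Definition mindex := {ffun 'I_m -> nat}.

Definition mdeg (a : mindex) : nat := (\sum_(j < m) a j)%N.

Definition partial (j : 'I_m) f : 'rV[R]_m -> R :=
  fun x => 'D_(delta_mx 0 j) f x.

Definition pderiv (a : mindex) f : 'rV[R]_m -> R :=
  foldr (fun j g => iter (a j) (partial j) g) f (enum 'I_m).

Definition cpderiv (a : mindex) h : 'rV[R]_m -> R[i] :=
  fun x => pderiv a (fun y => complex.Re (h y)) x
           +i* pderiv a (fun y => complex.Im (h y)) x.

(* f is of class C^q on the open set D: f and all its iterated partial
   derivatives of order at most q exist and are continuous on D. *)
Fixpoint of_class_C (q : nat) D f : Prop :=
  (forall x, D x -> {for x, continuous f}) /\
  (if q is q'.+1 then
     forall j : 'I_m,
       (forall x, D x -> derivable f x (delta_mx 0 j)) /\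
       of_class_C q' D (partial j f)
   else True).

Definition norm_C (q : nat) D f : \bar R :=
  ereal_sup [set r | exists (a : mindex) (x : 'rV[R]_m),
    [/\ (mdeg a <= q)%N, D x & r = `|pderiv a f x|%:E]].

Definition cnorm_C (q : nat) D h : \bar R :=
  ereal_sup [set r | exists (a : mindex) (x : 'rV[R]_m),
    [/\ (mdeg a <= q)%N, D x & r = (cabs (cpderiv a h x))%:E]].

(* For l >= 0, Num.truncn l is the floor of l as a natural number. *)
Definition holder_seminorm (l : R) D f : \bar R :=
  let q := Num.truncn l in
  ereal_sup [set r | exists (a : mindex) (x y : 'rV[R]_m),
    [/\ mdeg a = q, D x, D y, 0 < enorm (x - y) < 1 &
        r = (`|pderiv a f x - pderiv a f y|
              / enorm (x - y) `^ (l - q%:R))%:E]].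

Definition holder_norm (l : R) D f : \bar R :=
  let q := Num.truncn l in
  if l == q%:R then norm_C q D f
  else (norm_C q D f + holder_seminorm l D f)%E.

Definition holder_class (l : R) D f : Prop :=
  of_class_C (Num.truncn l) D f /\ (holder_norm l D f < +oo)%E.

End SmoothFunctions.

Section Domains.
Variables (R : realType) (n : nat).

(* B_oo(0, r) x T^n *)
Definition ball_torus (r : R) : set 'rV[R]_(n + n) :=
  [set x | forall j : 'I_n, `|lsubmx x 0 j| < r].

(* R^n_s *)
Definition cstrip (s : R) : set 'rV[R[i]]_n :=
  [set z | enorm (map_mx (@complex.Im R) z) < s].

(* A^n_s = R^n_s x T^n_s *)
Definition cdomain (s : R) : set 'rV[R[i]]_(n + n) :=
  [set z | cstrip s (lsubmx z) /\
           forall j : 'I_n, `|complex.Im (rsubmx z 0 j)| < s].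

Definition periodic_on (D : set 'rV[R]_(n + n)) (f : 'rV[R]_(n + n) -> R) :=
  forall x (k : 'rV[int]_n), D x ->
    f (x + row_mx 0 ((2 * pi) *: vec_of_int R k)) = f x.

Definition cperiodic_on (D : set 'rV[R[i]]_(n + n))
    (g : 'rV[R[i]]_(n + n) -> R[i]) :=
  forall z (k : 'rV[int]_n), D z ->
    g (z + cvec (row_mx 0 ((2 * pi) *: vec_of_int R k))) = g z.

End Domains.

Arguments ball_torus {R} n r.
Arguments cdomain {R} n s.

Section Analytic.
Variables (R : realType) (m : nat).

Definition monom (a : mindex m) (h : 'rV[R[i]]_m) : R[i] :=
  \prod_(j < m) h 0 j ^+ a j.

(* Partial sum over the multi-indices all of whose entries are less than N. *)
Definition box_sum (c : mindex m -> R[i]) (h : 'rV[R[i]]_m) (N : nat) : R[i] :=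
  \sum_(b : {ffun 'I_m -> 'I_N})
    let a : mindex m := [ffun j => b j : nat] in c a * monom a h.

(* Around each point of U, g is the sum of an absolutely convergent power
   series in m complex variables. *)
Definition analytic_on (U : set 'rV[R[i]]_m) (g : 'rV[R[i]]_m -> R[i]) : Prop :=
  forall z, U z -> exists (r : R) (c : mindex m -> R[i]), 0 < r /\
    forall h : 'rV[R[i]]_m, (forall j, cabs (h 0 j) < r) ->
      (\esum_(a in [set: mindex m]) (cabs (c a * monom a h))%:E < +oo)%E /\
      (fun N => cabs (box_sum c h N - g (z + h))) @ \oo --> (0 : R).

End Analytic.

Section Fourier.
Variable R : realType.

Definition expi (t : R) : R[i] := cos t +i* sin t.

Definition cint_period (F : R -> R[i]) : R[i] :=
  (\int[lebesgue_measure]_(t in `[0, 2 * pi]) complex.Re (F t))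
  +i* (\int[lebesgue_measure]_(t in `[0, 2 * pi]) complex.Im (F t)).

(* Integral over [0, 2 pi]^n, as an iterated integral. *)
Fixpoint torus_int (n : nat) : ('rV[R]_n -> R[i]) -> R[i] :=
  match n with
  | 0 => fun F => F 0
  | n'.+1 => fun F =>
      cint_period (fun t =>
        torus_int (fun th : 'rV[R]_n' =>
          F (row_mx (t%:M : 'rV[R]_1) th : 'rV[R]_(1 + n'))))
  end.

Variable n : nat.
Implicit Types (g : 'rV[R[i]]_(n + n) -> R[i]) (k : 'rV[int]_n).

Definition fourier_coef g k (I : 'rV[R[i]]_n) : R[i] :=
  ((2 * pi) ^- n)%:C *
  torus_int (fun th : 'rV[R]_n =>
    g (row_mx I (cvec th)) * expi (- \sum_(j < n) (k 0 j)%:~R * th 0 j)).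

Definition norm1 k : nat := (\sum_(j < n) `|k ord0 j|)%N.

Definition fourier_norm (s : R) g : \bar R :=
  ereal_sup [set r | exists2 I : 'rV[R[i]]_n, cstrip s I &
    r = \esum_(k in [set: 'rV[int]_n])
          (cabs (fourier_coef g k I) * expR ((norm1 k)%:R * s))%:E].

Definition trig_polynomial (s : R) g : Prop :=
  finite_set [set k : 'rV[int]_n |
    exists2 I : 'rV[R[i]]_n, cstrip s I & fourier_coef g k I <> 0].

End Fourier.

(* Main.v *)
Require Import Defs.
From mathcomp Require Import all_boot all_order all_algebra.
From mathcomp Require Import all_classical all_reals all_analysis.
From mathcomp Require Import complex.
From mathcomp Require Import ring lra zify.

Set Implicit Arguments.
Unset Strict Implicit.
Unset Printing Implicit Defensive.

Import Order.TTheory GRing.Theory Num.Theory.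
Import numFieldNormedType.Exports.

Local Open Scope classical_set_scope.
Local Open Scope ring_scope.
Local Open Scope complex_scope.

(** The approximation is a Fourier multiplier applied to a periodic extension of
    [f], and is therefore a finite sum of exponentials.

    Extension. Let [Phi] act on each action coordinate by a smooth function of
    period [4 * rho], with values in the interval of radius [2 * rho], which is
    the identity on [-rho, rho], and leave the angles unchanged. Then
    [g = f \o Phi] is defined everywhere, periodic in all the variables, equal to
    [f] on the small ball, and as regular as [f], with bounds multiplied by a
    constant ([periodic_extension]).

    Smoothing. Let A be the average of translates along one axis, with respect to
    de la Vallee-Poussin's kernel of degree [N], the integer part of [s ^- 2].
    The kernel is a probability density at scale [s], and A commutes with
    derivatives. Write [q] and [mu] for the integer and the fractional part of
    [l]. On a function with [r] derivatives, the first [r] factors of (1 - A)^(r+1)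
    gain [s] each by the mean value theorem, and the last one gains [s `^ mu]
    from the Hoelder bound ([norm_iter_rem]). The smoothing is
    T = 1 - (1 - A)^(q+1), applied along all the axes in turn. For a derivative
    of order [p] of [g], which has [q - p] derivatives left, the error is of
    order [s `^ (l - p)], and T commutes with derivatives, so that this is the
    required estimate ([smooth_axes_err], [dword_smooth_axes]).

    Analyticity. As the kernel is a trigonometric polynomial, [T g] is a finite sum
    of exponentials with real frequencies, whose coefficients are the Fourier
    coefficients of [g] multiplied by products of values of a multiplier
    ([smooth_axes_modes]). Such a sum is entire ([analytic_expsum]), and its
    Fourier coefficients in the angles are explicit
    ([fourier_norm_expsum_le]). On the strip of width [s] an exponential of
    frequency [k] grows up to [exp (`|k| * s)], up to the scales of the axes. The
    multiplier is at most [(q + 1) * exp (- k ^ 2 / (2 * N + 1))], and since [N]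
    is about [s ^- 2] the product of both is bounded independently of [k] and
    [s] ([multiplier_exp_le]).

    Summability. It remains to bound the sum of the moduli of the Fourier
    coefficients [c_k] of [g]. Bessel's inequality, for difference quotients of
    order [q] of [g] in each direction, bounds the sum of [k_j ^ (2 * q) * |c_k| ^ 2]
    ([decay_axis]). There are [2 * n] variables and [2 * q > 2 * n], so that the
    Cauchy-Schwarz inequality gives an absolutely convergent sum
    ([sum_modes_le]); this is where the hypothesis on the integer part of [l] is
    used. *)

(** * Restriction to lines *)

Section Lines.
Variables (R : realType) (m : nat).
Implicit Types (x : 'rV[R]_m) (g : 'rV[R]_m -> R) (D : set 'rV[R]_m).

(** The difference quotients of [g] at a point of a line and those of its
    restriction to the line are the same functions, so that directional
    derivatives reduce to derivatives in one variable. *)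
Lemma line_shiftE g x (v : 'rV[R]_m) (t : R) :
  (fun h : R => h^-1 *: (((fun u : R => g (x + u *: v)) \o shift t) (h *: 1)
      - g (x + t *: v)))
  = (fun h : R => h^-1 *: ((g \o shift (x + t *: v)) (h *: v)
      - g (x + t *: v))).
Proof.
apply/funext => h /=; congr (_ *: (g _ - _)).
by rewrite (_ : h *: 1 = h) ?scalerDl ?[h *: _ + _]addrC ?addrA// /GRing.scale /= mulr1.
Qed.

Lemma derivable_lineE g x v (t : R) :
  derivable (fun u : R => g (x + u *: v)) t 1 = derivable g (x + t *: v) v.
Proof. by rewrite /derivable line_shiftE. Qed.

Lemma derive_lineE g x v (t : R) :
  'D_1 (fun u : R => g (x + u *: v)) t = 'D_v g (x + t *: v).
Proof. by rewrite /derive line_shiftE. Qed.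

Lemma is_derive_line g x v (t : R) :
  derivable g (x + t *: v) v ->
  is_derive t 1 (fun u : R => g (x + u *: v)) ('D_v g (x + t *: v)).
Proof.
rewrite -derivable_lineE => d; apply: DeriveDef; first exact: d.
exact: derive_lineE.
Qed.

(** Allowing [u] of either sign, with the intermediate point on the same side,
    makes one statement serve for increments in both directions along a line. *)
Lemma MVT0 (F dF : R -> R) (u : R) :
  (forall t, `|t| <= `|u| -> 0 <= t * u -> is_derive t 1 F (dF t)) ->
  exists t, [/\ `|t| <= `|u|, 0 <= t * u & F u - F 0 = u * dF t].
Proof.
move=> dFt.
have [u0|u0] := leP 0 u.
  have H t : t \in `[0, u] -> is_derive t 1 F (dF t).
    rewrite in_itv /= => /andP[t0 tu]; apply: dFt; last exact: mulr_ge0.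
    by rewrite !ger0_norm.
  have [t tI ->] := @MVT_segment _ F dF 0 u u0
      (fun t tI => H t (subset_itv_oo_cc tI))
      (derivable_within_continuous (fun t tI => @ex_derive _ _ _ _ _ _ _ (H t tI))).
  exists t; move: tI; rewrite in_itv /= => /andP[t0 tu]; split.
  - by rewrite !ger0_norm.
  - exact: mulr_ge0.
  - by rewrite subr0 mulrC.
have H t : t \in `[u, 0] -> is_derive t 1 F (dF t).
  rewrite in_itv /= => /andP[ut t0]; apply: dFt.
    by rewrite !ler0_norm ?lerN2// ltW.
  by rewrite -mulrNN mulr_ge0// oppr_ge0// ltW.
have [t tI E] := @MVT_segment _ F dF u 0 (ltW u0)
      (fun t tI => H t (subset_itv_oo_cc tI))
      (derivable_within_continuous (fun t tI => @ex_derive _ _ _ _ _ _ _ (H t tI))).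
exists t; move: tI; rewrite in_itv /= => /andP[ut t0]; split.
- by rewrite !ler0_norm ?lerN2// ltW.
- by rewrite -mulrNN mulr_ge0// oppr_ge0// ltW.
- by rewrite -opprB E sub0r mulrN opprK mulrC.
Qed.

Lemma MVT_line g x v (u : R) :
  (forall t : R, `|t| <= `|u| -> 0 <= t * u -> derivable g (x + t *: v) v) ->
  exists t : R, [/\ `|t| <= `|u|, 0 <= t * u
    & g (x + u *: v) - g x = u * 'D_v g (x + t *: v)].
Proof.
move=> dg.
have [t [tu tu0 E]] := @MVT0 (fun t => g (x + t *: v))
  (fun t => 'D_v g (x + t *: v)) u
  (fun t tu tu0 => is_derive_line (dg t tu tu0)).
by exists t; split => //; rewrite -E scale0r addr0.
Qed.

Lemma eq_on_near D g h x : open D -> D x -> (forall y, D y -> g y = h y) ->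
  {near x, g =1 h}.
Proof.
move=> oD Dx gh; near=> y; apply: gh.
by near: y; exact: open_nbhs_nbhs.
Unshelve. all: by end_near. Qed.

Lemma partial_eq_on D g h j x : open D -> D x ->
  (forall y, D y -> g y = h y) -> partial j g x = partial j h x.
Proof.
by move=> oD Dx gh; rewrite /partial (near_eq_derive _ (eq_on_near oD Dx gh)).
Qed.

End Lines.

(** * Symmetry of second derivatives *)

Section Schwarz.
Variables (R : realType) (m : nat).
Implicit Types (x y : 'rV[R]_m) (f g : 'rV[R]_m -> R) (D : set 'rV[R]_m).

Local Notation e_ j := (delta_mx 0 j : 'rV[R]_m).

Lemma rV_nbhsP x (A : set 'rV[R]_m) : nbhs x A <->
  exists2 d : R, 0 < d & forall y, (forall j, `|x 0 j - y 0 j| < d) -> A y.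
Proof.
split=> [/nbhs_ballP[d /= d0 dA]|[d d0 dA]].
  exists d => // y xy; apply: dA; split => // i j.
  by rewrite !(ord1 i); exact: xy.
apply/nbhs_ballP; exists d => //= y [_ xy]; apply: dA => j.
exact: (xy 0 j).
Qed.

Lemma axis_coord x (i k : 'I_m) (s : R) :
  (x + s *: e_ i) 0 k = x 0 k + s * (k == i)%:R.
Proof. by rewrite !mxE eqxx. Qed.

Lemma axis2_dist x (i j : 'I_m) (d s t : R) : i != j -> `|s| < d -> `|t| < d ->
  forall k, `|x 0 k - (x + s *: e_ i + t *: e_ j) 0 k| < d.
Proof.
move=> ij sd td k; rewrite !axis_coord distrC.
have -> : x 0 k + s * (k == i)%:R + t * (k == j)%:R - x 0 k
  = s * (k == i)%:R + t * (k == j)%:R by ring.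
have d0 : 0 < d by exact: le_lt_trans sd.
have [->|ki] := eqVneq k i.
  by rewrite (negbTE ij) mulr1 mulr0 addr0.
by case: eqVneq => _; rewrite mulr0 add0r ?mulr1 ?mulr0 ?normr0.
Qed.

(** The mean value theorem in direction [i], applied to the increment of [f] in
    direction [j], and then in direction [j], applied to [partial i f]. *)
Lemma second_difference f x (i j : 'I_m) (s t : R) (A : set 'rV[R]_m) :
  (forall s' t' : R, `|s'| <= `|s| -> `|t'| <= `|t| ->
     A (x + s' *: e_ i + t' *: e_ j)) ->
  (forall y, A y -> derivable f y (e_ i)) ->
  (forall y, A y -> derivable (partial i f) y (e_ j)) ->
  exists s' t' : R, [/\ `|s'| <= `|s|, `|t'| <= `|t| &
    f (x + s *: e_ i + t *: e_ j) - f (x + s *: e_ i)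
      - (f (x + t *: e_ j) - f x)
    = s * t * partial j (partial i f) (x + s' *: e_ i + t' *: e_ j)].
Proof.
move=> Ast df ddf.
pose G (u : R) := f (x + t *: e_ j + u *: e_ i) - f (x + u *: e_ i).
pose dG (u : R) := partial i f (x + t *: e_ j + u *: e_ i)
  - partial i f (x + u *: e_ i).
have A1 (u : R) : `|u| <= `|s| -> A (x + t *: e_ j + u *: e_ i).
  by move=> us; rewrite addrAC; exact: Ast.
have A2 (u : R) : `|u| <= `|s| -> A (x + u *: e_ i).
  move=> us; rewrite -[x + _]addr0 -(scale0r (e_ j)); apply: Ast => //.
  by rewrite normr0.
have dGP (u : R) : `|u| <= `|s| -> 0 <= u * s -> is_derive u 1 G (dG u).
  move=> us _; apply: is_deriveB.
    by apply: is_derive_line; exact/df/A1.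
  by apply: is_derive_line; exact/df/A2.
have [s' [s's _ E]] := MVT0 dGP.
have [t' [t't _ E']] := @MVT_line R m (partial i f) (x + s' *: e_ i) (e_ j) t
   (fun t' t't _ => ddf _ (Ast s' t' s's t't)).
exists s', t'; split => //.
rewrite -mulrA -[partial j _ _]/('D_(e_ j) (partial i f) _) -E'.
rewrite [x + s' *: _ + _]addrAC -[X in s * X]/(dG s') -E /G.
by rewrite !scale0r !addr0 [x + t *: _ + s *: _]addrAC; ring.
Qed.

Lemma half_dist_absurd (a b p q : R) : p = q -> `|a - q| < `|a - b| / 2 ->
  `|b - p| < `|a - b| / 2 -> False.
Proof.
move=> -> aq bq; have := ler_distD q a b; rewrite [`|q - b|]distrC.
by move=> ab; lra.
Qed.

(** Symmetry of second derivatives: both mixed derivatives, taken at points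
    close to x, equal the same second difference quotient. *)
Lemma partialC f D x (i j : 'I_m) : open D -> D x -> of_class_C 2 D f ->
  partial i (partial j f) x = partial j (partial i f) x.
Proof.
move=> oD Dx [_ C1]; have [->//|ij] := eqVneq i j.
have [di /= [_ C2i]] := C1 i; have [dj /= [_ C2j]] := C1 j.
have [dij [cij _]] := C2i j; have [dji [cji _]] := C2j i.
apply/eqP; rewrite -subr_eq0; apply: contraT; rewrite -normr_gt0.
set a := partial i (partial j f) x; set b := partial j (partial i f) x => ab0.
have e0 : 0 < `|a - b| / 2 by rewrite divr_gt0.
have na : \forall y \near x, `|a - partial i (partial j f) y| < `|a - b| / 2.
  by have /cvgrPdist_lt := cji x Dx; apply.
have nb : \forall y \near x, `|b - partial j (partial i f) y| < `|a - b| / 2.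
  by have /cvgrPdist_lt := cij x Dx; apply.
have nD : \forall y \near x, D y by exact: open_nbhs_nbhs.
have [d d0 dA] := (rV_nbhsP _ _).1 (filterI nD (filterI na nb)).
pose t := d / 2.
have t0 : 0 < t by rewrite divr_gt0.
have td : `|t| < d by rewrite gtr0_norm// /t; lra.
pose A : set 'rV[R]_m := [set y | [/\ D y, `|a - partial i (partial j f) y| < `|a - b| / 2
   & `|b - partial j (partial i f) y| < `|a - b| / 2]].
have AP (s' t' : R) : `|s'| <= `|t| -> `|t'| <= `|t| ->
    A (x + s' *: e_ i + t' *: e_ j).
  move=> s't t't.
  have [Dy [ya yb]] := dA _ (axis2_dist x ij (le_lt_trans s't td) (le_lt_trans t't td)).
  by split.
have AP' (s' t' : R) : `|s'| <= `|t| -> `|t'| <= `|t| ->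
    A (x + s' *: e_ j + t' *: e_ i).
  by move=> s't t't; rewrite addrAC; exact: AP.
have [s1 [t1 [s1t t1t E1]]] := @second_difference f x i j t t A AP
  (fun y Ay => di y (let: And3 Dy _ _ := Ay in Dy))
  (fun y Ay => dij y (let: And3 Dy _ _ := Ay in Dy)).
have [s2 [t2 [s2t t2t E2]]] := @second_difference f x j i t t A AP'
  (fun y Ay => dj y (let: And3 Dy _ _ := Ay in Dy))
  (fun y Ay => dji y (let: And3 Dy _ _ := Ay in Dy)).
have E : partial j (partial i f) (x + s1 *: e_ i + t1 *: e_ j)
    = partial i (partial j f) (x + s2 *: e_ j + t2 *: e_ i).
  have swap (a1 a2 a3 a4 : R) : a1 - a2 - (a3 - a4) = a1 - a3 - (a2 - a4) by ring.
  rewrite [x + t *: e_ j + _]addrAC swap in E2.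
  have tt0 : t * t != 0 by rewrite mulf_neq0// gt_eqF.
  exact: (mulfI tt0 (etrans (esym E1) E2)).
have [_ _ B1] := AP _ _ s1t t1t; have [_ B2 _] := AP' _ _ s2t t2t.
by case: (half_dist_absurd E B2 B1).
Qed.

End Schwarz.

(** * Iterated partial derivatives and bounds along the axes *)

Section Words.
Variables (R : realType) (m : nat).
Implicit Types (x y : 'rV[R]_m) (f g : 'rV[R]_m -> R) (D : set 'rV[R]_m).
Implicit Types (w : seq 'I_m).

(** Derivatives are indexed here by words of directions and not by
    multi-indices: a letter can be added at either end of a word, which is what
    inductions on the order of differentiation need. *)
Definition dword w f : 'rV[R]_m -> R := foldr (@partial R m) f w.

Definition word_of_mindex (a : mindex m) : seq 'I_m :=
  flatten [seq nseq (a j) j | j <- enum 'I_m].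

Lemma pderiv_dword (a : mindex m) f : pderiv a f = dword (word_of_mindex a) f.
Proof.
rewrite /pderiv /dword /word_of_mindex; elim: (enum 'I_m) => //= j s ->.
by rewrite foldr_cat; elim: (a j) => //= k ->.
Qed.

Lemma size_word_of_mindex (a : mindex m) : size (word_of_mindex a) = mdeg a.
Proof.
rewrite /word_of_mindex size_flatten /shape -map_comp sumnE big_map /mdeg.
by rewrite big_enum; apply: eq_bigr => j _ /=; rewrite size_nseq.
Qed.

Definition mindex_of_word w : mindex m := [ffun j => count_mem j w].

Lemma perm_word_of_mindex w : perm_eq w (word_of_mindex (mindex_of_word w)).
Proof.
apply/allP => j _ /=; rewrite /word_of_mindex count_flatten -map_comp sumnE big_map.
rewrite big_enum /= (bigD1 j) //= count_nseq /= eqxx mul1n ffunE big1 ?addn0 //.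
by move=> i ij; rewrite /= count_nseq /= (negbTE ij).
Qed.

Lemma mdeg_mindex_of_word w : mdeg (mindex_of_word w) = size w.
Proof.
by rewrite -size_word_of_mindex; apply/esym/perm_size/perm_word_of_mindex.
Qed.

Lemma of_class_CW D (q r : nat) f : (r <= q)%N ->
  of_class_C q D f -> of_class_C r D f.
Proof.
elim: r q f => [|r IH] [|q] f //= rq [cf H]; split => // j.
by have [df Cf] := H j; split => //; exact: IH Cf.
Qed.

Lemma of_class_C_dword D r w f : of_class_C (size w + r) D f ->
  of_class_C r D (dword w f).
Proof.
elim: w r => // j w IH r; rewrite [size _]/= addSnnS => /IH /=.
by move=> [_ /(_ j)[]].
Qed.

Lemma dword_eq_on D w f g : open D -> (forall x, D x -> f x = g x) ->
  forall x, D x -> dword w f x = dword w g x.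
Proof.
move=> oD fg; elim: w => //= j w IH x Dx.
exact: (partial_eq_on j oD Dx IH).
Qed.

(** Moving a letter to the front is a sequence of exchanges of neighbours, each
    of which is an instance of [partialC]. *)
Lemma dword_swap D w1 w2 i f : open D ->
  of_class_C (size w1 + (size w2).+1) D f ->
  forall x, D x -> dword (w1 ++ i :: w2) f x = dword (i :: w1 ++ w2) f x.
Proof.
move=> oD; elim: w1 => // j w1 IH Cf x Dx /=.
transitivity (dword (j :: i :: w1 ++ w2) f x).
  by apply: (partial_eq_on _ oD Dx) => y Dy; apply: IH => //; apply: of_class_CW Cf.
apply: (partialC _ _ oD Dx); apply: of_class_C_dword.
by apply: of_class_CW Cf; rewrite size_cat /=; lia.
Qed.

Lemma dword_perm D w w' f : open D -> of_class_C (size w) D f -> perm_eq w w' ->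
  forall x, D x -> dword w f x = dword w' f x.
Proof.
move=> oD; elim: w w' => [|i w IH] w' Cf pw x Dx.
  by move: pw; rewrite perm_sym => /perm_nilP ->.
have iw' : i \in w' by rewrite -(perm_mem pw) mem_head.
have [w1 [w2 Ew']] : exists w1 w2, w' = w1 ++ i :: w2.
  by case/splitPr: iw' => w1 w2; exists w1, w2.
move: (pw); rewrite Ew' perm_sym perm_catC /= perm_cons perm_catC perm_sym => pw'.
rewrite (dword_swap (D := D)) //; last first.
  by have := perm_size pw; rewrite Ew' size_cat /= => <-.
apply: (partial_eq_on _ oD Dx) => y Dy; apply: IH => //.
exact: of_class_CW Cf.
Qed.

End Words.

Section Good.
Variables (R : realType) (m : nat) (mu : R).
Implicit Types (x y : 'rV[R]_m) (f g h : 'rV[R]_m -> R) (D : set 'rV[R]_m).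
Implicit Types (w : seq 'I_m).

Local Notation e_ j := (delta_mx 0 j : 'rV[R]_m).

(** The regularity that the proof carries along: all derivatives of order at
    most [q] are bounded by [K] and [mu]-Hoelder continuous with constant [K] on
    [D]. Continuity and the Hoelder bound are asked along the coordinate axes
    only, because averages, difference quotients and Fourier modes act along one
    axis at a time. The Hoelder bound has no smallness condition on [u], and for
    [mu = 0] it says nothing new up to a factor 2, so that integer and
    non-integer regularity are treated together. *)
Fixpoint good (q : nat) D (K : R) g : Prop :=
  [/\ forall x j, D x -> {for 0, continuous (fun u : R => g (x + u *: e_ j))},
      forall x, D x -> `|g x| <= K,
      forall x j (u : R), D x -> D (x + u *: e_ j) ->
        `|g (x + u *: e_ j) - g x| <= K * `|u| `^ mu
    & if q is q'.+1 then forall j,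
        (forall x, D x -> derivable g x (e_ j)) /\ good q' D K (partial j g)
      else True].

Lemma goodW q r D K g : (r <= q)%N -> good q D K g -> good r D K g.
Proof.
elim: r q g => [|r IH] [|q] g //= rq [cg bg hg dg]; split => // j.
by have [? ?] := dg j; split => //; exact: (IH q).
Qed.

Lemma goodS q D K g : good q D K g ->
  (forall j, (forall x, D x -> derivable g x (e_ j)) /\ good q D K (partial j g)) ->
  good q.+1 D K g.
Proof. by move=> /(goodW (leq0n q))[cg bg hg _] dg; split. Qed.

Lemma good_le q D (K K' : R) g : K <= K' -> good q D K g -> good q D K' g.
Proof.
move=> KK'; elim: q g => [|q IH] g G.
  have [cg bg hg _] := G; split => // [x Dx|x j u Dx Du].
  - by apply: le_trans (bg x Dx) _.
  - by apply: le_trans (hg x j u Dx Du) _; rewrite ler_wpM2r ?powR_ge0.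
apply: goodS; first exact/IH/(goodW (leqnSn q) G).
by move=> j; have [_ _ _ /(_ j)[? ?]] := G; split => //; exact: IH.
Qed.

Lemma good_dword r D K w g : good (size w + r) D K g -> good r D K (dword w g).
Proof.
elim: w r => // j w IH r; rewrite [size _]/= addSnnS => /IH /=.
by move=> [_ _ _ /(_ j)[]].
Qed.

End Good.

Section HolderGood.
Variables (R : realType) (m : nat).
Implicit Types (x y : 'rV[R]_m) (f g h : 'rV[R]_m -> R) (D : set 'rV[R]_m).
Implicit Types (w : seq 'I_m).

Local Notation e_ j := (delta_mx 0 j : 'rV[R]_m).

Lemma continuous_line g x v : {for x, continuous g} ->
  {for 0, continuous (fun u : R => g (x + u *: v))}.
Proof.
move=> cg; apply: (@continuous_comp _ _ _ (fun u : R => x + u *: v) g).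
  by apply: cvgD; [exact: cvg_cst|apply: cvgZl; exact: cvg_id].
by rewrite scale0r addr0.
Qed.

Lemma enorm_axis j (u : R) : enorm (u *: e_ j) = `|u|.
Proof.
rewrite /enorm (bigD1 j) //= big1 => [|i ij].
  by rewrite !mxE !eqxx mulr1 addr0 sqrtr_sqr.
by rewrite !mxE eqxx (negbTE ij) mulr0 expr0n.
Qed.

Lemma le_powR_small (t mu : R) : 0 <= t <= 1 -> 0 <= mu <= 1 -> t <= t `^ mu.
Proof.
move=> /andP[t0 t1] /andP[mu0 mu1]; move: t0; rewrite le_eqVlt => /predU1P[<-|t0].
  exact: powR_ge0.
by apply: ger1_powR => //; rewrite t0.
Qed.

Lemma powR_ge1 (t mu : R) : 1 <= t -> 0 <= mu -> 1 <= t `^ mu.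
Proof. by move=> t1 mu0; have := ler_powR t1 mu0; rewrite powRr0. Qed.

(** This is what the mean value theorem along an axis needs of a domain. *)
Definition line_convex D := forall x j (u t : R), D x -> D (x + u *: e_ j) ->
  `|t| <= `|u| -> 0 <= t * u -> D (x + t *: e_ j).

(** Below the top order the Hoelder bound holds because of the mean value theorem
    for displacements smaller than 1, and because of the sup bound for the
    others. *)
Lemma good_of_words D q (mu H : R) f : line_convex D -> 0 <= mu <= 1 -> 0 <= H ->
  of_class_C q D f ->
  (forall w x, (size w <= q)%N -> D x -> `|dword w f x| <= H) ->
  (forall w x j (u : R), size w = q -> D x -> D (x + u *: e_ j) ->
     `|u| < 1 -> `|dword w f (x + u *: e_ j) - dword w f x| <= 2 * H * `|u| `^ mu) ->
  good mu q D (2 * H) f.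
Proof.
move=> cD mu01 H0; elim: q f => [|q IH] f Cf bf hf.
  have [cf _] := Cf; split => // [x j Dx|x Dx|x j u Dx Du].
  - exact/continuous_line/cf.
  - by apply: le_trans (bf [::] x isT Dx) _; lra.
  - have [u1|u1] := ltP `|u| 1; first exact: (hf [::]).
    have := powR_ge1 u1 (andP mu01).1; have := bf [::] _ isT Dx; have := bf [::] _ isT Du.
    rewrite /dword /= => b1 b2 p1.
    apply: le_trans (ler_normB _ _) _; apply: (@le_trans _ _ (2 * H * 1)); first lra.
    by rewrite ler_wpM2l// mulr_ge0.
have [cf df] := Cf; split => // [x j Dx|x Dx|x j u Dx Du|j].
- exact/continuous_line/cf.
- by apply: le_trans (bf [::] x isT Dx) _; lra.
- have [u1|u1] := ltP `|u| 1.
    have [t [tu tu0 ->]] := @MVT_line R m f x (e_ j) u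
      (fun t tu tu0 => (df j).1 _ (cD _ _ _ _ Dx Du tu tu0)).
    have := bf [:: j] _ isT (cD _ _ _ _ Dx Du tu tu0).
    rewrite /dword /= /partial => b1; rewrite normrM mulrC.
    apply: ler_pM => //; first by lra.
    by apply: le_powR_small => //; rewrite normr_ge0 ltW.
  have := powR_ge1 u1 (andP mu01).1; have := bf [::] _ isT Dx; have := bf [::] _ isT Du.
  rewrite /dword /= => b1 b2 p1.
  apply: le_trans (ler_normB _ _) _; apply: (@le_trans _ _ (2 * H * 1)); first lra.
  by rewrite ler_wpM2l// mulr_ge0.
- have [dj Cj] := df j; split => //; apply: IH => //.
    move=> w x wq Dx; have := bf (rcons w j) x; rewrite size_rcons => /(_ wq Dx).
    by rewrite /dword foldr_rcons.
  move=> w x i u wq Dx Du; have := hf (rcons w j) x i u; rewrite size_rcons wq.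
  by move=> /(_ erefl Dx Du); rewrite /dword foldr_rcons.
Qed.

Lemma norm_C_ge q D f a x : (mdeg a <= q)%N -> D x ->
  (`|pderiv a f x|%:E <= norm_C q D f)%E.
Proof. by move=> aq Dx; apply: ereal_sup_ubound; exists a, x. Qed.

Lemma norm_C_ge0 q D f x : D x -> (0 <= norm_C q D f)%E.
Proof.
move=> Dx; apply: le_trans (norm_C_ge (a := [ffun=> 0%N]) f _ Dx).
  by rewrite lee_fin.
by rewrite /mdeg big1// => j _; rewrite ffunE.
Qed.

End HolderGood.

(** * From the Hoelder norm to bounds along the axes *)

Section BallTorus.
Variables (R : realType) (n : nat).

Lemma ball_torusE (r : R) x :
  ball_torus n r x <-> forall j : 'I_n, `|x 0 (lshift n j)| < r.
Proof. by split=> H j; have := H j; rewrite /ball_torus /= mxE. Qed.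

Lemma open_ball_torus (r : R) : open (ball_torus n r).
Proof.
rewrite openE => x /ball_torusE xr; rewrite /interior /=.
have nb : nbhs x (fun y : 'rV[R]_(n + n) => forall j : 'I_n, `|y 0 (lshift n j)| < r).
  apply: (@filter_forall _ _ (fun j (y : 'rV[R]_(n + n)) =>
    `|y 0 (lshift n j)| < r) (nbhs x) _) => j; apply/rV_nbhsP.
  exists (r - `|x 0 (lshift n j)|); first by rewrite subr_gt0.
  move=> y /(_ (lshift n j)); rewrite ltrBrDl; apply: le_lt_trans.
  by have := ler_distD 0 (y 0 (lshift n j)) (x 0 (lshift n j)); rewrite !subr0 sub0r normrN;
    have := ler_normB (x 0 (lshift n j)) (x 0 (lshift n j) - y 0 (lshift n j));
    rewrite opprB addrCA subrr addr0.
by apply: filterS nb => y yr; apply/ball_torusE.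
Qed.

Lemma line_convex_ball_torus (r : R) : line_convex (ball_torus n r).
Proof.
move=> x j u t /ball_torusE Dx /ball_torusE Du tu tu0; apply/ball_torusE => k.
have := Dx k; have := Du k; rewrite !axis_coord.
case: eqP => _; rewrite ?mulr0 ?addr0// !mulr1 !ltr_norml => /andP[a1 a2] /andP[b1 b2].
move: tu; have [u0|u0] := leP 0 u.
  rewrite (ger0_norm u0) ler_norml => /andP[]; case: (leP 0 t) => t0 tu1 tu2; first by lra.
  move: tu0; rewrite le_eqVlt => /predU1P[/eqP|].
    by rewrite eq_sym mulf_eq0 => /orP[]/eqP ?; lra.
  by rewrite nmulr_rgt0// => ?; lra.
rewrite (ltr0_norm u0) ler_norml => /andP[]; case: (leP t 0) => t0 tu1 tu2; first by lra.
by move: tu0; rewrite pmulr_rge0// => ?; lra.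
Qed.

Lemma ball_torus0 (r : R) : 0 < r -> ball_torus n r 0.
Proof. by move=> r0; apply/ball_torusE => j; rewrite mxE normr0. Qed.

End BallTorus.

Section FromHolder.
Variables (R : realType) (m : nat).
Implicit Types (x y : 'rV[R]_m) (f g h : 'rV[R]_m -> R) (D : set 'rV[R]_m).

Lemma frac_part_itv (l : R) : 0 <= l -> 0 <= l - (Num.truncn l)%:R < 1.
Proof.
by move=> l0; have /andP[] := truncn_itv l0; rewrite -natr1 => *; apply/andP; split; lra.
Qed.

(** The norm speaks of multi-indices and [good] of words; on the open set [D] the
    two families of derivatives agree by [dword_perm]. The factor 2 comes from
    bounding an increment by twice the supremum. *)
Lemma good_of_holder D x0 (j0 : 'I_m) (l : R) f : open D -> line_convex D -> D x0 -> 0 < l ->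
  holder_class l D f ->
  exists H : R, [/\ 0 <= H, holder_norm l D f = H%:E
    & good (l - (Num.truncn l)%:R) (Num.truncn l) D (2 * H) f].
Proof.
move=> oD cD Dx0 l0 [Cf fin]; move: fin; set q := Num.truncn l; set mu := l - q%:R.
have /andP[mu0 mu1] : 0 <= mu < 1 by apply: frac_part_itv; exact: ltW.
move=> fin; have [d d0 dD] := (rV_nbhsP x0 D).1 (open_nbhs_nbhs (conj oD Dx0)).
(* The supremum defining the Hoelder seminorm is over a nonempty set of
   nonnegative numbers: two points of [D] at distance [u] witness it. Hence
   both terms of the norm are finite as soon as their sum is. *)
pose u := Num.min d 1 / 2.
have u0 : 0 < u by rewrite divr_gt0// lt_min d0 ltr01.
have ud : u < d.
  by rewrite /u; case: (leP d 1) => *; lra.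
have u1 : u < 1 by rewrite /u; case: (leP d 1) => *; lra.
have Du : D (x0 + u *: delta_mx 0 j0).
  apply: dD => k; rewrite axis_coord opprD addrA subrr add0r normrN.
  by case: eqP => _; rewrite ?mulr1 ?mulr0 ?normr0// gtr0_norm.
have N0 := norm_C_ge0 q f Dx0.
have S0 : (0 <= holder_seminorm l D f)%E.
  apply: (@le_trans _ _ (`|pderiv [ffun j => if j == j0 then q else 0%N] f
      (x0 + u *: delta_mx 0 j0) - pderiv [ffun j => if j == j0 then q else 0%N] f x0|
      / enorm (x0 + u *: delta_mx 0 j0 - x0) `^ mu)%:E).
    by rewrite lee_fin divr_ge0// powR_ge0.
  apply: ereal_sup_ubound.
  exists [ffun j => if j == j0 then q else 0%N], (x0 + u *: delta_mx 0 j0), x0.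
  split=> //.
    rewrite /mdeg (bigD1 j0) //= ffunE eqxx big1 ?addn0// => i.
    by rewrite ffunE => /negbTE ->.
  by rewrite addrAC subrr add0r enorm_axis gtr0_norm ?u0.
have [H [NH SH HE H0]] : exists H : R, [/\ (norm_C q D f <= H%:E)%E,
    l != q%:R -> (holder_seminorm l D f <= H%:E)%E,
    holder_norm l D f = H%:E & 0 <= H].
  move: fin.
  rewrite /holder_norm -/q; case: eqVneq => [lq|lq] fin.
    exists (fine (norm_C q D f)); rewrite fineK; last by rewrite ge0_fin_numE.
    by split=> //; rewrite fine_ge0.
  have fin' : (norm_C q D f + holder_seminorm l D f)%E \is a fin_num.
    by rewrite ge0_fin_numE// adde_ge0.
  exists (fine (norm_C q D f + holder_seminorm l D f)%E); rewrite fineK//.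
  by split=> //; rewrite ?leeDl ?leeDr// fine_ge0// adde_ge0.
exists H; split=> //; apply: good_of_words => //.
- by rewrite mu0 ltW.
- move=> w x wq Dx; rewrite -lee_fin; apply: le_trans NH.
  rewrite (dword_perm oD (of_class_CW wq Cf) (perm_word_of_mindex w) Dx).
  by rewrite -pderiv_dword; apply: norm_C_ge => //; rewrite mdeg_mindex_of_word.
- move=> w x j v wq Dx Dv v1.
  have Cw : of_class_C (size w) D f by rewrite wq.
  rewrite (dword_perm oD Cw (perm_word_of_mindex w) Dx).
  rewrite (dword_perm oD Cw (perm_word_of_mindex w) Dv) -!pderiv_dword.
  set a := mindex_of_word w.
  have aq : mdeg a = q by rewrite /a mdeg_mindex_of_word.
  have bd y : D y -> `|pderiv a f y| <= H.
    by move=> Dy; rewrite -lee_fin; apply: le_trans NH; apply: norm_C_ge; rewrite ?aq.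
  have [lq|lq] := eqVneq l q%:R.
    rewrite /mu lq subrr powRr0 mulr1; apply: le_trans (ler_normB _ _) _.
    by have := bd _ Dx; have := bd _ Dv; lra.
  have [->|v0] := eqVneq v 0.
    by rewrite scale0r addr0 subrr normr0 mulr_ge0 ?powR_ge0// mulr_ge0.
  apply: (@le_trans _ _ (H * `|v| `^ mu)); last first.
    by rewrite ler_wpM2r ?powR_ge0//; lra.
  rewrite -ler_pdivrMr ?powR_gt0 ?normr_gt0// -lee_fin.
  apply: le_trans (SH lq); apply: ereal_sup_ubound.
  exists a, (x + v *: delta_mx 0 j), x; split => //.
    by rewrite addrAC subrr add0r enorm_axis normr_gt0 v0.
  by rewrite addrAC subrr add0r enorm_axis.
Qed.

End FromHolder.

(** * Products and compositions *)

Section GoodAlgebra.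
Variables (R : realType) (m : nat) (mu : R).
Implicit Types (x y : 'rV[R]_m) (f g h : 'rV[R]_m -> R) (D : set 'rV[R]_m).

Local Notation goodT q K g := (good mu q setT K g).

Lemma good_ge0 q K g : goodT q K g -> 0 <= K.
Proof.
by case: q => [|q] [_ /(_ 0 I) b0 _ _]; apply: le_trans b0.
Qed.

Lemma goodD q K L g h : goodT q K g -> goodT q L h ->
  goodT q (K + L) (fun x => g x + h x).
Proof.
elim: q g h => [|q IH] g h G H.
  have [cg bg hg _] := G; have [ch bh hh _] := H; split => // [x j _|x _|x j u _ _].
  - by apply: continuousD; [exact: cg|exact: ch].
  - by apply: le_trans (ler_normD _ _) (lerD (bg _ I) (bh _ I)).
  - rewrite opprD addrACA mulrDl.
    by apply: le_trans (ler_normD _ _) (lerD (hg _ _ _ I I) (hh _ _ _ I I)).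
apply: goodS; first by apply: IH; [exact: goodW G|exact: goodW H].
move=> j; have [_ _ _ /(_ j)[dgj Gj]] := G; have [_ _ _ /(_ j)[dhj Hj]] := H; split.
  by move=> x _; apply: derivableD; [exact: dgj|exact: dhj].
have -> : partial j (fun x => g x + h x) = (fun x => partial j g x + partial j h x).
  by apply/funext => x; apply: deriveD; [exact: dgj|exact: dhj].
exact: IH.
Qed.

Lemma goodN q K g : goodT q K g -> goodT q K (fun x => - g x).
Proof.
elim: q g => [|q IH] g G.
  have [cg bg hg _] := G; split => [x j _|x _|x j u _ _|//].
  - by apply: continuousN; exact: cg.
  - by rewrite normrN; exact: bg.
  - by rewrite -opprD normrN; exact: hg.
apply: goodS; first by apply: IH; exact: goodW G.
move=> j; have [_ _ _ /(_ j)[dgj Gj]] := G; split.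
  by move=> x _; apply: derivableN; exact: dgj.
have -> : partial j (fun x => - g x) = (fun x => - partial j g x).
  by apply/funext => x; apply: deriveN; exact: dgj.
exact: IH.
Qed.

Lemma goodB q K L g h : goodT q K g -> goodT q L h ->
  goodT q (K + L) (fun x => g x - h x).
Proof. by move=> Gg Gh; apply: goodD => //; exact: goodN. Qed.

Lemma good_mul0 K L g h x (y : 'rV[R]_m) (p : R) : 0 <= K -> 0 <= L -> 0 <= p ->
  `|h x| <= L -> `|g y| <= K -> `|g y - g x| <= K * p -> `|h y - h x| <= L * p ->
  `|g y * h y - g x * h x| <= 2 * K * L * p.
Proof.
move=> K0 L0 p0 hx gy gxy hxy.
have -> : g y * h y - g x * h x = g y * (h y - h x) + (g y - g x) * h x by ring.
apply: le_trans (ler_normD _ _) _; rewrite !normrM.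
have A : `|g y| * `|h y - h x| <= K * (L * p) by apply: ler_pM.
have B : `|g y - g x| * `|h x| <= K * p * L by apply: ler_pM.
by apply: le_trans (lerD A B) _; rewrite le_eqVlt; apply/orP; left; apply/eqP; ring.
Qed.

Lemma good_mul q K L g h : goodT q K g -> goodT q L h ->
  goodT q (2 ^+ q.+1 * K * L) (fun x => g x * h x).
Proof.
move=> G H; have K0 := good_ge0 G; have L0 := good_ge0 H; move: G H.
elim: q g h => [|q IH] g h G H.
  have [cg bg hg _] := G; have [ch bh hh _] := H; split => // [x j _|x _|x j u _ _].
  - by apply: continuousM; [exact: cg|exact: ch].
  - rewrite normrM; apply: (@le_trans _ _ (K * L)).
      by apply: ler_pM => //; [exact: bg|exact: bh].
    by rewrite -mulrA ler_peMl ?mulr_ge0// expr1; lra.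
  - rewrite expr1; apply: good_mul0 => //; rewrite ?powR_ge0//.
    + exact: bh.
    + exact: bg.
    + exact: hg.
    + exact: hh.
have Gq := goodW (leqnSn q) G; have Hq := goodW (leqnSn q) H.
have E : 2 ^+ q.+2 * K * L = 2 ^+ q.+1 * K * L + 2 ^+ q.+1 * K * L.
  by rewrite [2 ^+ q.+2]exprS; ring.
apply: goodS.
  by apply: good_le (IH _ _ Gq Hq); rewrite E lerDl !mulr_ge0// exprn_ge0.
move=> j; have [_ _ _ /(_ j)[dgj Gj]] := G; have [_ _ _ /(_ j)[dhj Hj]] := H; split.
  by move=> x _; apply: derivableM; [exact: dgj|exact: dhj].
have -> : partial j (fun x => g x * h x) = (fun x => g x * partial j h x + partial j g x * h x).
  apply/funext => x; rewrite [RHS]addrC [X in X + _]mulrC [RHS]addrC.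
  by apply: deriveM; [exact: dgj|exact: dhj].
by rewrite E; apply: goodD; exact: IH.
Qed.

End GoodAlgebra.

Section GoodComp.
Variables (R : realType) (m : nat) (mu : R).
Hypothesis mu01 : 0 <= mu <= 1.
Implicit Types (x y : 'rV[R]_m) (F : 'rV[R]_m -> R) (D : set 'rV[R]_m).
Variables (phi psi : 'I_m -> R -> R) (B : R).
Hypothesis B1 : 1 <= B.
Hypothesis dphi : forall j t, is_derive t (1 : R) (phi j) (psi j t).

Local Notation e_ j := (delta_mx 0 j : 'rV[R]_m).
Local Notation goodT q K g := (good mu q setT K g).

(** A map that acts on each coordinate separately sends axis-parallel lines to
    axis-parallel lines, hence is compatible with bounds along the axes. *)
Definition coordwise x : 'rV[R]_m := \row_j phi j (x 0 j).

Lemma coordwise_axis x j (u : R) : coordwise (x + u *: e_ j) =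
  coordwise x + (phi j (x 0 j + u) - phi j (x 0 j)) *: e_ j.
Proof.
apply/rowP => k; rewrite axis_coord !mxE eqxx /=.
have [->|_] := eqVneq k j; rewrite ?mulr1 ?mulr0 ?addr0//.
by rewrite [RHS]addrC subrK.
Qed.

Lemma is_derive_shift j (a t : R) :
  is_derive t 1 (fun t => phi j (a + t)) (psi j (a + t)).
Proof.
  have := @is_derive1_comp _ (phi j) (fun t => a + t) t (psi j (a + t)) 1 (dphi j (a + t)).
  rewrite mulr1; apply.
  by have := @is_deriveD _ _ _ (cst a) id t 1 _ _ (is_derive_cst _ _ _) (is_derive_id _ _);
    rewrite add0r.
Qed.

Lemma coordwise_lip j (a u : R) : (forall t, `|psi j t| <= B) ->
  `|phi j (a + u) - phi j a| <= B * `|u|.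
Proof.
move=> bpsi.
have [t [_ _]] := @MVT0 R (fun t => phi j (a + t)) (fun t => psi j (a + t)) u
  (fun t _ _ => is_derive_shift j a t).
by rewrite addr0 => ->; rewrite normrM mulrC ler_wpM2r.
Qed.

Lemma is_derive_displacement x j :
  is_derive (0 : R) 1 (fun u => phi j (x 0 j + u) - phi j (x 0 j)) (psi j (x 0 j)).
Proof.
have := @is_deriveB _ _ _ (fun u => phi j (x 0 j + u)) (cst (phi j (x 0 j))) (0 : R) 1 _ _
  (is_derive_shift j (x 0 j) 0) (is_derive_cst _ _ _).
by rewrite addr0 subr0.
Qed.

Lemma comp_lineE F x j : (fun u : R => F (coordwise (x + u *: e_ j))) =
  (fun u => F (coordwise x + u *: e_ j)) \o (fun u => phi j (x 0 j + u) - phi j (x 0 j)).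
Proof. by apply/funext => u /=; rewrite coordwise_axis. Qed.

Lemma is_derive_comp_line F x j : derivable F (coordwise x) (e_ j) ->
  is_derive (0 : R) 1 (fun u => F (coordwise (x + u *: e_ j)))
    ('D_(e_ j) F (coordwise x) * psi j (x 0 j)).
Proof.
move=> dF; rewrite comp_lineE.
apply: is_derive1_comp; last exact: is_derive_displacement.
have dF' : derivable F (coordwise x + 0 *: e_ j) (e_ j) by rewrite scale0r addr0.
by rewrite addr0 subrr; have := is_derive_line dF'; rewrite scale0r addr0.
Qed.

Lemma derivable_comp F x j : derivable F (coordwise x) (e_ j) ->
  derivable (F \o coordwise) x (e_ j) /\
  partial j (F \o coordwise) x = partial j F (coordwise x) * psi j (x 0 j).
Proof.
move=> /is_derive_comp_line [d E].
have H := derivable_lineE (F \o coordwise) x (e_ j) 0.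
have H' := derive_lineE (F \o coordwise) x (e_ j) 0.
rewrite scale0r addr0 in H H'.
by split; [rewrite -H|rewrite /partial -H' -[RHS]E].
Qed.

Lemma continuous_comp_line F x j :
  {for 0, continuous (fun u : R => F (coordwise x + u *: e_ j))} ->
  {for 0, continuous (fun u : R => F (coordwise (x + u *: e_ j)))}.
Proof.
move=> cF; rewrite comp_lineE.
apply: (@continuous_comp _ _ _ (fun u => phi j (x 0 j + u) - phi j (x 0 j))
   (fun u : R => F (coordwise x + u *: e_ j))).
  apply: differentiable_continuous; apply/derivable1_diffP.
  by case: (is_derive_displacement x j).
by rewrite /= addr0 subrr.
Qed.

(** The partial derivatives of [F \o coordwise] are again products of a function
    of one coordinate with a composition, so composition only costs a constant. *)
Lemma good_comp D q : (forall x, D (coordwise x)) ->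
  (forall j, goodT q B (fun x => psi j (x 0 j))) ->
  exists2 C : R, 1 <= C & forall (F : 'rV[R]_m -> R) (K : R), 0 <= K -> good mu q D K F ->
    goodT q (C * K) (F \o coordwise).
Proof.
move=> rD; have B0 : 0 <= B by apply: le_trans B1.
have H0 F K q' : (forall j, goodT q' B (fun x => psi j (x 0 j))) -> 0 <= K ->
    good mu q' D K F -> goodT 0 (B * K) (F \o coordwise).
  move=> Gpsi K0 G; have [cF bF hF _] : good mu 0 D K F by apply: goodW G.
  split => //= [x j _|x _|x j u _ _].
  - exact/continuous_comp_line/cF.
  - by apply: le_trans (bF _ (rD x)) _; rewrite ler_peMl.
  - have := hF (coordwise x) j (phi j (x 0 j + u) - phi j (x 0 j)) (rD x).
    rewrite -coordwise_axis => /(_ (rD _)) /le_trans; apply.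
    have bpsi t : `|psi j t| <= B.
      have [_ /(_ (t *: e_ j) I) + _ _] : goodT 0 B (fun x => psi j (x 0 j)).
        exact: goodW (Gpsi j).
      by rewrite !mxE !eqxx mulr1.
    rewrite [B * K]mulrC -mulrA ler_wpM2l//.
    have lip := coordwise_lip (x 0 j) u bpsi.
    apply: (@le_trans _ _ ((B * `|u|) `^ mu)).
      by apply: ge0_ler_powR; rewrite ?nnegrE ?mulr_ge0//; case/andP: mu01.
    rewrite powRM //.
    rewrite ler_wpM2r ?powR_ge0//; case/andP: mu01 => *.
    by apply: ler1_powR.
elim: q => [|q IH] Gpsi.
  by exists B => // F K K0 G; apply: (H0 _ _ 0%N).
have [|C C1 HC] := IH; first by move=> j; exact: goodW (Gpsi j).
have p1 : 1 <= 2 ^+ q.+1 :> R by rewrite exprn_ege1//; lra.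
have C'1 : 1 <= 2 ^+ q.+1 * B * C by rewrite !mulr_ege1.
have C'B : B <= 2 ^+ q.+1 * B * C.
  by rewrite mulrAC ler_peMl// mulr_ege1.
exists (2 ^+ q.+1 * B * C) => // F K K0 G.
have [cF bF hF _] := H0 _ _ _ Gpsi K0 G.
have BK : B * K <= 2 ^+ q.+1 * B * C * K by rewrite ler_wpM2r.
have [_ _ _ dF] := G; split => //.
- by move=> x _; apply: le_trans (bF x I) BK.
- by move=> x j u _ _; apply: le_trans (hF x j u I I) _; rewrite ler_wpM2r ?powR_ge0.
- move=> j; have [dFj GFj] := dF j; split.
    by move=> x _; apply: (derivable_comp _).1; exact: dFj.
  have -> : partial j (F \o coordwise)
      = (fun x => (partial j F \o coordwise) x * psi j (x 0 j)).
    by apply/funext => x; apply: (derivable_comp _).2; exact: dFj.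
  have -> : 2 ^+ q.+1 * B * C * K = 2 ^+ q.+1 * (C * K) * B by ring.
  by apply: good_mul; [exact: HC|exact: goodW (Gpsi j)].
Qed.

End GoodComp.

(** * Smooth functions of one variable *)

Section Smooth1.
Variable R : realType.
Implicit Types (f g psi : R -> R) (k : nat).

(** Derivatives are existentially quantified, so that the chain and product
    rules can be applied without computing them. *)
Fixpoint smooth1 k f : Prop :=
  (exists B : R, forall t, `|f t| <= B) /\
  (if k is k'.+1 then
     exists2 df, forall t, is_derive t (1 : R) f (df t) & smooth1 k' df
   else True).

Lemma smooth1W k f : smooth1 k.+1 f -> smooth1 k f.
Proof.
elim: k f => [|k IH] f [bf [df dfP Sdf]]; split => //.
by exists df => //; exact: IH.
Qed.

Lemma smooth1_le k k' f : (k <= k')%N -> smooth1 k' f -> smooth1 k f.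
Proof.
elim: k' => [|k' IH]; first by rewrite leqn0 => /eqP ->.
by rewrite leq_eqVlt => /predU1P[->//|kk' /smooth1W]; exact: IH.
Qed.

Lemma smooth1_cst k (c : R) : smooth1 k (cst c).
Proof.
elim: k c => [|k IH] c; split => //; try by exists `|c|.
by exists (cst 0) => // t; exact: is_derive_cst.
Qed.

Lemma smooth1D k f g : smooth1 k f -> smooth1 k g -> smooth1 k (fun t => f t + g t).
Proof.
elim: k f g => [|k IH] f g [[B bf] Sf] [[C bg] Sg];
  (have b : exists B, forall t, `|f t + g t| <= B
    by exists (B + C) => t; apply: le_trans (ler_normD _ _) (lerD (bf t) (bg t)));
  split => //.
move: Sf Sg => [df dfP Sf] [dg dgP Sg]; exists (fun t => df t + dg t); last exact: IH.
by move=> t; exact: is_deriveD.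
Qed.

Lemma smooth1M k f g : smooth1 k f -> smooth1 k g -> smooth1 k (fun t => f t * g t).
Proof.
elim: k f g => [|k IH] f g Sf0 Sg0; move: (Sf0) (Sg0) => [[B bf] Sf] [[C bg] Sg];
  (have b : exists B, forall t, `|f t * g t| <= B
    by exists (B * C) => t; rewrite normrM; apply: ler_pM);
  split => //.
move: Sf Sg => [df dfP Sf] [dg dgP Sg]; exists (fun t => f t * dg t + g t * df t).
  by move=> t; exact: is_deriveM.
by apply: smooth1D; apply: IH => //; exact: smooth1W.
Qed.

Lemma is_derive_affine (a b t : R) : is_derive t (1 : R) (fun t => a * t + b) a.
Proof.
have := @is_deriveD _ _ _ (fun t => a * t) (cst b) t 1 _ _
  (@is_deriveZ _ _ _ id a t 1 _ (is_derive_id _ _)) (is_derive_cst _ _ _).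
by rewrite addr0 /GRing.scale /= mulr1.
Qed.

Lemma smooth1_cos k (c a b : R) : smooth1 k (fun t => c * cos (a * t + b)).
Proof.
elim: k c a b => [|k IH] c a b;
  (have bd : exists B, forall t, `|c * cos (a * t + b)| <= B
    by exists `|c| => t; rewrite normrM ler_piMr// cos_max); split => //.
exists (fun t => c * a * cos (a * t + (b + pi / 2))); last exact: IH.
move=> t.
have := @is_deriveZ _ _ _ (cos \o (fun t => a * t + b)) c t 1 _
  (@is_derive1_comp _ _ (fun t => a * t + b) t _ _ (is_derive_cos (a * t + b))
    (is_derive_affine a b t)).
congr (is_derive _ _ _ _).
by rewrite /GRing.scale /= addrA cosDpihalf; ring.
Qed.

(** The [N]-th power of the positive part, of class C^(N-1): enough smoothness to
    build plateau functions for a given finite order. *)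
Definition posX N (y : R) : R := Num.max y 0 ^+ N.

Lemma is_derive_posX N (y : R) :
  is_derive y (1 : R) (posX N.+2) (N.+2%:R * posX N.+1 y).
Proof.
have [y0|y0|->] := ltgtP y 0.
- have E : {near y, cst 0 =1 posX N.+2}.
    by near=> z; rewrite /posX /cst max_r ?expr0n//; apply/ltW; near: z; exact: lt_nbhsl.
  have -> : posX N.+1 y = 0 by rewrite /posX max_r ?expr0n// ltW.
  rewrite mulr0.
  by apply: (near_eq_is_derive E); exact: is_derive_cst.
- have E : {near y, (fun z : R => z ^+ N.+2) =1 posX N.+2}.
    near=> z; rewrite /posX max_l// -oppr_le0; apply/ltW; near: z.
    by apply: Nlt_nbhsl; rewrite oppr_lt0.
  have -> : posX N.+1 y = y ^+ N.+1 by rewrite /posX max_l// ltW.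
  apply: (near_eq_is_derive E).
  have := @is_deriveX _ _ id N.+2 y 1 _ (is_derive_id _ _).
  rewrite /GRing.scale /= mulr1; congr (is_derive _ _ _ _).
  by apply/funext => z; elim: N.+2 => [|k IH]; rewrite ?expr0// !exprS -IH.
- have p0 k : posX k.+1 0 = 0 by rewrite /posX maxxx expr0n.
  rewrite p0 mulr0.
  have cv : h^-1 *: (posX N.+2 (h *: 1 + 0) - posX N.+2 0) @[h --> 0^'] --> (0 : R).
    apply/cvgrPdist_le => /= e e0; near=> h.
    rewrite sub0r normrN /GRing.scale /= mulr1 addr0 p0 subr0.
    have h1 : `|h| <= 1.
      near: h; apply: dnbhs0_le; exact: ltr01.
    have he : `|h| <= e by near: h; exact: dnbhs0_le.
    have h0 : h != 0 by near: h; exact: nbhs_dnbhs_neq.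
    rewrite normrM normfV ler_pdivrMl ?normr_gt0//.
    apply: (@le_trans _ _ (`|h| ^+ N.+2)).
      rewrite /posX normrX lerXn2r ?nnegrE//.
      by case: (leP h 0) => ?; rewrite ?normr0.
    rewrite exprS ler_wpM2l//; apply: le_trans he.
    by rewrite exprS ler_piMr// exprn_ile1.
  by apply: DeriveDef; [apply/cvg_ex; exists 0|exact/cvg_lim].
Unshelve. all: by end_near. Qed.

Lemma smooth1_posX k N psi : (k <= N)%N -> smooth1 k psi ->
  smooth1 k (fun t => posX N.+1 (psi t)).
Proof.
elim: k N psi => [|k IH] N psi kN Spsi0; move: (Spsi0) => [[B bpsi] Spsi];
  (have b : exists B, forall t, `|posX N.+1 (psi t)| <= B
    by (exists (B ^+ N.+1) => t; rewrite /posX normrX lerXn2r ?nnegrE//;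
      [exact: le_trans (bpsi t)|
       case: (leP (psi t) 0) => ? //; rewrite normr0; exact: le_trans (bpsi t)]));
  split => //.
case: N kN b => // N kN b; move: Spsi => [dpsi dpsiP Spsi].
exists (fun t => N.+2%:R * posX N.+1 (psi t) * dpsi t).
  move=> t; exact: (is_derive1_comp (is_derive_posX N (psi t)) (dpsiP t)).
apply: smooth1M => //; apply: smooth1M; first exact: smooth1_cst.
by apply: IH => //; exact: smooth1W.
Qed.

End Smooth1.

(** * A periodic model of the identity *)

Section Bump.
Variable R : realType.
Implicit Types (f g psi : R -> R) (k : nat).

Lemma smooth1_lip k psi : smooth1 k.+1 psi ->
  exists2 B : R, 1 <= B & forall a t, `|psi (a + t) - psi a| <= B * `|t|.
Proof.
move=> [_ [dpsi dP Sd]]; have [B bd] : exists B : R, forall t, `|dpsi t| <= B.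
  by case: k Sd => [|k] [].
exists (Num.max 1 B); first by rewrite le_max lexx.
move=> a t; have H (u : R) : is_derive u 1 (fun u => psi (a + u)) (dpsi (a + u)).
  have := @is_derive1_comp _ psi (fun t => 1 * t + a) u _ _ (dP _) (is_derive_affine 1 a u).
  rewrite mulr1 mul1r [u + a]addrC; congr (is_derive _ _ _ _).
  by apply/funext => z /=; rewrite mul1r addrC.
have [u [_ _]] := @MVT0 R (fun t => psi (a + t)) (fun t => dpsi (a + t)) t (fun t _ _ => H t).
rewrite addr0 => ->; rewrite normrM mulrC ler_wpM2r//.
by apply: le_trans (bd _) _; rewrite le_max lexx orbT.
Qed.

Lemma good_zero (m q : nat) (mu K : R) : 0 <= K ->
  good mu q setT K (fun _ : 'rV[R]_m => 0).
Proof.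
move=> K0; have c0 : {for (0 : R), continuous (fun u : R => (0 : R))}.
  exact: cst_continuous.
have h0 (u : R) : `|0 - 0| <= K * `|u| `^ mu.
  by rewrite subrr normr0 mulr_ge0 ?powR_ge0.
elim: q => [|q IH]; split=> //; try by move=> *; rewrite normr0.
move=> j; split; first by move=> x _; exact: derivable_cst.
rewrite (_ : partial j _ = fun=> 0) //.
by apply/funext => x; exact: derive_cst.
Qed.

Lemma coord_lineE (m : nat) psi (x : 'rV[R]_m) (i j : 'I_m) :
  (fun u : R => psi ((x + u *: delta_mx 0 i) 0 j))
  = psi \o (fun u => (j == i)%:R * u + x 0 j).
Proof. by apply/funext => u /=; rewrite axis_coord addrC mulrC. Qed.

Lemma is_derive_coord_line (m : nat) psi dpsi (x : 'rV[R]_m) (i j : 'I_m) :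
  (forall t, is_derive t (1 : R) psi (dpsi t)) ->
  is_derive (0 : R) 1 (fun u : R => psi ((x + u *: delta_mx 0 i) 0 j))
    (dpsi (x 0 j) * (j == i)%:R).
Proof.
move=> dP; rewrite coord_lineE.
apply: is_derive1_comp; last exact: is_derive_affine.
by rewrite mulr0 add0r.
Qed.

Lemma derivable_coord (m : nat) psi dpsi (x : 'rV[R]_m) (i j : 'I_m) :
  (forall t, is_derive t (1 : R) psi (dpsi t)) ->
  derivable (fun x : 'rV[R]_m => psi (x 0 j)) x (delta_mx 0 i) /\
  partial i (fun x => psi (x 0 j)) x = dpsi (x 0 j) * (j == i)%:R.
Proof.
move=> dP; have [d E] := is_derive_coord_line x i j dP.
have H := derivable_lineE (fun x : 'rV[R]_m => psi (x 0 j)) x (delta_mx 0 i) 0.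
have H' := derive_lineE (fun x : 'rV[R]_m => psi (x 0 j)) x (delta_mx 0 i) 0.
rewrite scale0r addr0 in H H'.
by split; [rewrite -H|rewrite /partial -H'].
Qed.

(** One order of smoothness is spent on the Hoelder bound. *)
Lemma good_coord (m k : nat) (mu : R) psi (j : 'I_m) : 0 <= mu <= 1 ->
  smooth1 k.+1 psi ->
  exists2 B : R, 1 <= B & good mu k setT B (fun x : 'rV[R]_m => psi (x 0 j)).
Proof.
move=> mu01.
have base psi' : smooth1 1 psi' -> exists2 B : R, 1 <= B &
    good mu 0 setT B (fun x : 'rV[R]_m => psi' (x 0 j)).
  move=> S1; have [B B1 lB] := smooth1_lip S1.
  move: S1 => [[B0 bpsi] [dpsi dP _]].
  pose K := Num.max B (2 * B0).
  have KB : B <= K by rewrite le_max lexx.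
  have KB0 : 2 * B0 <= K by rewrite le_max lexx orbT.
  have K0 : 0 <= K by lra.
  exists K; first lra.
  split=> // [x i _|x _|x i u _ _].
  - apply: differentiable_continuous; apply/derivable1_diffP.
    by case: (is_derive_coord_line x i j dP).
  - by have := bpsi (x 0 j); have := normr_ge0 (psi' (x 0 j)); lra.
  - rewrite axis_coord; have [u1|u1] := leP `|u| 1.
      apply: le_trans (lB _ _) _; apply: ler_pM => //; first lra.
      apply: (@le_trans _ _ `|u|).
        by case: eqP => _; rewrite ?mulr1 ?mulr0 ?normr0.
      by apply: le_powR_small => //; rewrite normr_ge0.
    apply: le_trans (ler_normB _ _) _; apply: (@le_trans _ _ (K * 1)).
      by have := bpsi (x 0 j + u * (j == i)%:R); have := bpsi (x 0 j); lra.
    by rewrite ler_wpM2l//; apply: powR_ge1; [exact: ltW|case/andP: mu01].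
elim: k psi => [|k IH] psi Spsi; first exact: base.
have [B B1 [cB bB hB _]] := base _ (smooth1_le (isT : (1 <= k.+2)%N) Spsi).
move: Spsi => [_ [dpsi dP Sd]]; have [B' B'1 GB'] := IH _ Sd.
pose K := Num.max B B'.
have KB : B <= K by rewrite le_max lexx.
have KB' : B' <= K by rewrite le_max lexx orbT.
exists K; first exact: le_trans KB.
split=> //.
- by move=> x _; apply: le_trans (bB x I) KB.
- by move=> x i u _ _; apply: le_trans (hB x i u I I) _; rewrite ler_wpM2r ?powR_ge0.
- move=> i; split; first by move=> x _; exact: (derivable_coord x i j dP).1.
  have [ji|ji] := eqVneq j i.
    rewrite (_ : partial i _ = fun x : 'rV[R]_m => dpsi (x 0 j)).
      exact: good_le GB'.
    by apply/funext => x; rewrite (derivable_coord x i j dP).2 ji eqxx mulr1.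
  rewrite (_ : partial i _ = fun=> 0); first by apply: good_zero; lra.
  by apply/funext => x; rewrite (derivable_coord x i j dP).2 (negbTE ji) mulr0.
Qed.

Section Saw.
Variable w : R.
Hypothesis w0 : 0 < w.

(** The sawtooth of period [pi / w]; its jumps sit where [cos (w * t) = 0]. *)
Definition saw (t : R) : R := w^-1 * atan (tan (w * t)).

Lemma is_derive_saw t : cos (w * t) != 0 -> is_derive t (1 : R) saw 1.
Proof.
move=> c0.
have dm : is_derive t (1 : R) (fun t => w * t) w.
  by have := is_derive_affine w 0 t; congr (is_derive _ _ _ _); apply/funext => z; rewrite addr0.
have := @is_deriveZ _ _ _ _ w^-1 t 1 _
  (@is_derive1_comp _ atan _ t _ _ (is_derive1_atan (tan (w * t)))
  (@is_derive1_comp _ tan _ t _ _ (is_derive_tan c0) dm)).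
congr (is_derive _ _ _ _); rewrite -cos2_tan2// /GRing.scale /= mulrA mulVf.
  by rewrite mul1r mulVf// gt_eqF.
by rewrite invr_eq0 expf_neq0.
Qed.

Lemma saw_bound t : `|saw t| < pi / (2 * w).
Proof.
rewrite /saw normrM gtr0_norm ?invr_gt0// invfM mulrA [ltRHS]mulrC ltr_pM2l ?invr_gt0//.
by rewrite ltr_norml atan_gtNpi2 atan_ltpi2.
Qed.

Lemma saw_id t : w * `|t| < pi / 2 -> saw t = t.
Proof.
move=> wt; rewrite /saw tanK; first by rewrite mulrA mulVf ?mul1r// gt_eqF.
by rewrite in_itv /= -ltr_norml normrM gtr0_norm.
Qed.

Lemma saw_periodic t : saw (t + pi / w) = saw t.
Proof.
by rewrite /saw mulrDr [w * (pi / w)]mulrC divfK ?gt_eqF// tanDpi.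
Qed.

(** Multiplying by a function that vanishes near the jumps makes the sawtooth
    smooth; the derivative of such a function vanishes there as well, which
    lets the argument be repeated. *)
Lemma smooth1_sawM k psi : smooth1 k psi ->
  (forall t, cos (2 * w * t) < - (1 / 2) -> psi t = 0) ->
  smooth1 k (fun t => saw t * psi t).
Proof.
elim: k psi => [|k IH] psi Spsi0 z; move: (Spsi0) => [[B bpsi] Spsi];
  (have b : exists B, forall t, `|saw t * psi t| <= B
    by exists (pi / (2 * w) * B) => t; rewrite normrM;
      apply: ler_pM => //; exact/ltW/saw_bound); split => //.
move: Spsi => [dpsi dP Sd].
have nz t : cos (2 * w * t) < - (1 / 2) -> {near t, cst 0 =1 psi}.
  move=> ct; near=> u; rewrite /cst z//; near: u.
  have cc : {for t, continuous (fun u : R => cos (2 * w * u))}.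
    apply: (@continuous_comp _ _ _ (fun u : R => 2 * w * u) cos).
      exact: scaler_continuous.
    exact: continuous_cos.
  exact: (cc _ (lt_nbhsl ct)).
have dz t : cos (2 * w * t) < - (1 / 2) -> dpsi t = 0.
  move=> ct; have [_ <-] := dP t; have [_ <-] := near_eq_is_derive (nz t ct) (is_derive_cst 0 t 1).
  by [].
exists (fun t => saw t * dpsi t + psi t).
  move=> t; have [c0|c0] := eqVneq (cos (w * t)) 0.
    have ct : cos (2 * w * t) < - (1 / 2).
      by rewrite -mulrA mulr_natl cos_mulr2n c0; lra.
    rewrite (dz t ct) (z t ct) mulr0 addr0.
    apply: near_eq_is_derive (is_derive_cst 0 t 1).
    by apply: filterS (nz t ct) => u; rewrite /cst => <-; rewrite mulr0.
  have := @is_deriveM _ _ saw psi t 1 _ _ (is_derive_saw c0) (dP t).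
  by rewrite /GRing.scale /= mulr1.
apply: smooth1D; first exact: IH.
exact: smooth1W.
Unshelve. all: by end_near. Qed.

End Saw.

(** With [w = pi / (4 * rho)], take the product of the sawtooth with a function
    of [cos (2 * w * t)] that is [1] where this cosine is nonnegative, which
    contains [-rho, rho], and [0] where it is at most [- 1 / 2], which contains
    the jumps. *)
Lemma periodic_identity k (rho : R) : 0 < rho -> exists phi psi : R -> R,
  [/\ forall t, is_derive t (1 : R) phi (psi t), smooth1 k psi,
      forall t, `|phi t| < 2 * rho,
      forall t, `|t| <= rho -> phi t = t
    & forall t, phi (t + 4 * rho) = phi t].
Proof.
move=> rho0; have p0 := pi_gt0 R; pose w := pi / (4 * rho).
have w0 : 0 < w by rewrite divr_gt0// mulr_gt0.
have piw : pi / w = 4 * rho.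
  by rewrite /w invf_div mulrCA divff ?mulr1// gt_eqF.
pose u t : R := - 2 * cos (2 * w * t + 0).
pose chi t := posX k.+2 (1 + -1 * posX k.+2 (u t)).
have Schi : smooth1 k.+1 chi.
  apply: smooth1_posX => //; apply: smooth1D; first exact: smooth1_cst.
  apply: smooth1M; first exact: smooth1_cst.
  by apply: smooth1_posX => //; exact: smooth1_cos.
have chi0 t : cos (2 * w * t) < - (1 / 2) -> chi t = 0.
  move=> ct; have u1 : 1 <= u t by rewrite /u addr0; lra.
  rewrite /chi {1}/posX max_r ?expr0n//.
  rewrite mulN1r subr_le0 /posX max_l; last by lra.
  exact: exprn_ege1.
have chi1 t : 0 <= cos (2 * w * t) -> chi t = 1.
  move=> ct; rewrite /chi {2}/posX max_r; last by rewrite /u addr0; lra.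
  by rewrite expr0n /= mulr0 addr0 /posX max_l// expr1n.
have chib t : 0 <= chi t <= 1.
  rewrite /chi /posX exprn_ge0 /=; last by rewrite le_max lexx orbT.
  rewrite exprn_ile1 ?ge_max ?ler01 ?le_max ?lexx ?orbT ?andbT// mulN1r gerBl.
  by rewrite exprn_ge0// le_max lexx orbT.
have [_ [psi dP Spsi]] := smooth1_sawM w0 Schi chi0.
exists (fun t => saw w t * chi t), psi; split => //.
- move=> t; rewrite normrM; have /andP[c0 c1] := chib t.
  apply: (@le_lt_trans _ _ `|saw w t|).
    by rewrite ler_piMr// ger0_norm.
  apply: lt_le_trans (saw_bound w0 t) _.
  by rewrite invfM mulrCA piw; lra.
- move=> t tr; have wt : w * `|t| <= pi / 4.
    have -> : pi / 4 = w * rho by rewrite /w invfM; field; rewrite gt_eqF.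
    by rewrite ler_wpM2l// ltW.
  rewrite saw_id//; last by lra.
  rewrite chi1 ?mulr1// cos_ge0_pihalf// -ler_norml normrM gtr0_norm; last by lra.
  by rewrite -mulrA; lra.
- move=> t; rewrite -piw saw_periodic//; congr (_ * _).
  rewrite /chi /u; congr (posX _ (1 + -1 * posX _ (-2 * _))).
  have -> : 2 * w * (t + pi / w) + 0 = 2 * w * t + pi *+ 2.
    by rewrite -[_ *+ 2]mulr_natl; field; rewrite gt_eqF.
  by rewrite cosD2pi addr0.
Qed.

End Bump.

(** * Periodic extension *)

Section Extension.
Variables (R : realType) (n : nat).

Local Notation e_ j := (delta_mx 0 j : 'rV[R]_(n + n)).

(** The period in direction [j] divided by [2 * pi]: with this scale
    [t |-> g (x + (axis_scale rho j * t) *: e_ j)] has period [2 * pi] in all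
    directions, for the extended function [g]. *)
Definition axis_scale (rho : R) (j : 'I_(n + n)) : R :=
  if fintype.split j is inl _ then 2 * rho / pi else 1.

Lemma axis_scale_gt0 rho j : 0 < rho -> 0 < axis_scale rho j.
Proof.
move=> r0; rewrite /axis_scale; case: fintype.split => _ //.
by rewrite divr_gt0 ?pi_gt0// mulr_gt0.
Qed.

Lemma row_mx_axis (k : 'I_n) : row_mx 0 ((2 * pi) *: vec_of_int R (delta_mx 0 k))
  = (2 * pi) *: e_ (rshift n k).
Proof.
apply/rowP => j; rewrite !mxE; case: splitP => i ji; rewrite !mxE eqxx /=.
  by rewrite -val_eqE /= ji ltn_eqF ?mulr0// ltn_addr.
rewrite -[j == _]val_eqE /= ji eqn_add2l val_eqE.
by case: (i == k).
Qed.

(** Compose [f] with the smooth periodic model of the identity in the action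
    coordinates. This avoids a cut-off: the composition is periodic and only
    evaluates [f] inside the larger ball. *)
Lemma periodic_extension (q : nat) (mu rho : R) : 0 <= mu <= 1 -> 0 < rho ->
  exists2 C : R, 1 <= C & forall (f : 'rV[R]_(n + n) -> R) (H : R), 0 <= H ->
    periodic_on (ball_torus n (2 * rho)) f ->
    good mu q (ball_torus n (2 * rho)) H f ->
    exists g : 'rV[R]_(n + n) -> R,
      [/\ good mu q setT (C * H) g,
          forall x, ball_torus n rho x -> g x = f x
        & forall x j, g (x + (2 * pi * axis_scale rho j) *: e_ j) = g x].
Proof.
move=> mu01 rho0.
have [phi [psi [dphi Spsi bphi idphi perphi]]] := @periodic_identity R q.+1 rho rho0.
pose Phi (j : 'I_(n + n)) := if fintype.split j is inl _ then phi else id.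
pose Psi (j : 'I_(n + n)) := if fintype.split j is inl _ then psi else cst 1.
have dPhi j t : is_derive t (1 : R) (Phi j) (Psi j t).
  by rewrite /Phi /Psi; case: fintype.split => _ //; exact: is_derive_id.
have SPsi j : smooth1 q.+1 (Psi j).
  by rewrite /Psi; case: fintype.split => _ //; exact: smooth1_cst.
have /choice[Bj BjP] : forall j, exists B : R, 1 <= B /\
    good mu q setT B (fun x : 'rV[R]_(n + n) => Psi j (x 0 j)).
  by move=> j; have [B B1 GB] := good_coord j mu01 (SPsi j); exists B.
pose B := 1 + \sum_j Bj j.
have Bj0 j : 0 <= Bj j by apply: le_trans (BjP j).1.
have B1 : 1 <= B by rewrite /B lerDl sumr_ge0.
have GPsi j : good mu q setT B (fun x : 'rV[R]_(n + n) => Psi j (x 0 j)).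
  apply: good_le (BjP j).2; rewrite /B (bigD1 j)//= addrCA lerDl.
  by rewrite addr_ge0// sumr_ge0.
have Phi_ball x : ball_torus n (2 * rho) (coordwise Phi x).
  apply/ball_torusE => j; rewrite mxE /Phi.
  by case: splitP => [i _|i]; [exact: bphi|move=> /= E; have := ltn_ord j; rewrite E; lia].
have [C C1 HC] := good_comp mu01 B1 dPhi Phi_ball GPsi.
exists C => // f H H0 pf Gf; exists (f \o coordwise Phi); split.
- exact: HC.
- move=> x /ball_torusE xr; congr f; apply/rowP => j; rewrite mxE /Phi.
  case: splitP => // i ji; apply: idphi; apply: ltW.
  by have -> : j = lshift n i by apply: val_inj.
- move=> x j /=; rewrite coordwise_axis /Phi /axis_scale.
  case: splitP => i ji.
    have -> : 2 * pi * (2 * rho / pi) = 4 * rho :> R.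
      by rewrite [2 * rho / pi]mulrC mulrA mulfK ?gt_eqF ?pi_gt0//; ring.
    by rewrite perphi subrr scale0r addr0.
  have -> : j = rshift n i by apply: val_inj.
  by rewrite mulr1 addrAC subrr add0r -row_mx_axis pf.
Qed.

End Extension.

(** * Means over a period *)

Section Mean.
Variable R : realType.
Implicit Types (F G : R -> R).

Local Notation mu := (@lebesgue_measure R).

Definition mean F : R := (2 * pi)^-1 * \int[mu]_(t in `[- pi, pi]) F t.

Let twopi0 : 0 < 2 * pi :> R.
Proof. by rewrite mulr_gt0// pi_gt0. Qed.

Lemma integrable_segment (a b : R) F : continuous F ->
  mu.-integrable `[a, b] (EFin \o F).
Proof.
move=> cF; apply: continuous_compact_integrable; first exact: segment_compact.
exact: continuous_subspaceT.
Qed.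

Hint Extern 0 (measurable _) => exact: measurable_itv : core.

Lemma meanD F G : continuous F -> continuous G ->
  mean (fun t => F t + G t) = mean F + mean G.
Proof.
by move=> cF cG; rewrite /mean RintegralD ?mulrDr//; exact: integrable_segment.
Qed.

Lemma meanZ (c : R) F : continuous F -> mean (fun t => c * F t) = c * mean F.
Proof.
move=> cF; rewrite /mean RintegralZl//; first by rewrite mulrCA.
exact: integrable_segment.
Qed.

Lemma meanB F G : continuous F -> continuous G ->
  mean (fun t => F t - G t) = mean F - mean G.
Proof.
by move=> cF cG; rewrite /mean RintegralB ?mulrBr//; exact: integrable_segment.
Qed.

Lemma eq_mean F G : (forall t, F t = G t) -> mean F = mean G.
Proof. by move=> FG; congr mean; apply/funext. Qed.

Lemma le_mean F G : continuous F -> continuous G ->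
  (forall t, - pi <= t <= pi -> F t <= G t) -> mean F <= mean G.
Proof.
move=> cF cG FG; rewrite /mean ler_wpM2l ?invr_ge0 ?(ltW twopi0)//.
apply: le_Rintegral; [by []|exact: integrable_segment|exact: integrable_segment|].
by move=> t; rewrite /= in_itv /=; exact: FG.
Qed.

Lemma norm_mean_le F G : continuous F -> continuous G ->
  (forall t, - pi <= t <= pi -> `|F t| <= G t) -> `|mean F| <= mean G.
Proof.
move=> cF cG FG; rewrite ler_norml.
have -> : - mean G = mean (fun t => -1 * G t) by rewrite meanZ// mulN1r.
apply/andP; split; apply: le_mean => //.
- by move=> t; apply: cvgM; [exact: cvg_cst|exact: cG].
- by move=> t /FG; rewrite mulN1r ler_norml => /andP[].
- by move=> t /FG; rewrite ler_norml => /andP[].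
Qed.

Lemma mean_ge0 F : (forall t, 0 <= F t) -> 0 <= mean F.
Proof.
move=> F0; rewrite /mean mulr_ge0// ?invr_ge0 ?(ltW twopi0)//.
exact: Rintegral_ge0.
Qed.

(** The primitive [G] is only asked to be differentiable on the closed segment, as
    the ones of [antiderivative] are not so on the whole line. *)
Lemma FTC_segment (a b : R) F G : a < b -> continuous F ->
  (forall t, a <= t <= b -> is_derive t (1 : R) G (F t)) ->
  \int[mu]_(t in `[a, b]) F t = G b - G a.
Proof.
move=> ab cF dG; rewrite /Rintegral (@continuous_FTC2 _ _ G)//.
- exact: continuous_subspaceT.
- have cG t : a <= t <= b -> {for t, continuous G}.
    move=> /dG [dGt _]; apply: differentiable_continuous; exact/derivable1_diffP.
  split.
  + by move=> t; rewrite in_itv /= => /andP[/ltW at_ /ltW tb]; case: (dG t); rewrite ?at_.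
  + by apply: cvg_at_right_filter; apply: cG; rewrite lexx ltW.
  + by apply: cvg_at_left_filter; apply: cG; rewrite lexx andbT ltW.
- move=> t; rewrite in_itv /= => /andP[/ltW at_ /ltW tb].
  by rewrite derive1E; case: (dG t); rewrite ?at_.
Qed.

Lemma mean_FTC F G : continuous F ->
  (forall t, is_derive t (1 : R) G (F t)) ->
  mean F = (2 * pi)^-1 * (G pi - G (- pi)).
Proof.
move=> cF dG; rewrite /mean (@FTC_segment _ _ _ G)//.
by rewrite gtrN ?pi_gt0.
Qed.

Lemma mean_cst (c : R) : mean (cst c) = c.
Proof.
have d t : is_derive t (1 : R) (fun t => c * t) (cst c t).
  have := @is_deriveZ _ _ _ id c t 1 _ (is_derive_id _ _).
  by rewrite /GRing.scale /= mulr1.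
have cc : continuous (cst c : R -> R) by move=> ?; exact: cst_continuous.
rewrite (mean_FTC cc d) (_ : c * pi - c * - pi = 2 * pi * c) ?mulKf ?gt_eqF//; ring.
Qed.

(** Differentiability is only available to the right of the base point [a], so
    [a] is a parameter, to be taken below all the points that matter. *)
Lemma antiderivative F (a : R) : continuous F ->
  exists P : R -> R, forall x, a < x -> is_derive x (1 : R) P (F x).
Proof.
move=> cF; exists (fun x => \int[mu]_(t in `[a, x]) F t) => x ax.
have xu : x < x + 1 by rewrite ltrDl.
have [d E] := continuous_FTC1_closed xu (integrable_segment a (x + 1) cF) ax (cF x).
by apply: DeriveDef; [exact: d|rewrite -derive1E; exact: E].
Qed.

Lemma is_derive_translate F (P : R -> R) (a c t : R) :
  (forall x, a < x -> is_derive x (1 : R) P (F x)) -> a < c + t ->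
  is_derive t (1 : R) (fun t => P (c + t)) (F (c + t)).
Proof.
move=> dP act; have := @is_derive1_comp _ P (fun t => c + t) t _ 1 (dP _ act).
rewrite mulr1; apply.
by have := @is_deriveD _ _ _ (cst c) id t 1 _ _ (is_derive_cst _ _ _) (is_derive_id _ _);
  rewrite add0r.
Qed.

Lemma mean_translate F (P : R -> R) (a w : R) : continuous F ->
  (forall x, a < x -> is_derive x (1 : R) P (F x)) -> a < w - pi ->
  mean (fun t => F (t + w)) = (2 * pi)^-1 * (P (w + pi) - P (w - pi)).
Proof.
move=> cF dP aw; have p0 := pi_gt0 R.
rewrite /mean (_ : (fun t => F (t + w)) = (fun t => F (w + t))); last first.
  by apply/funext => t; rewrite addrC.
have cwF : continuous (fun t => F (w + t)).
  move=> t; apply: (@continuous_comp _ _ _ (fun t => w + t) F); last exact: cF.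
  by apply: cvgD; [exact: cvg_cst|exact: cvg_id].
have d t : - pi <= t <= pi -> is_derive t (1 : R) (fun t => P (w + t)) (F (w + t)).
  by move=> /andP[tp _]; apply: (is_derive_translate dP); lra.
have pp : - pi < pi :> R by rewrite gtrN.
by rewrite (FTC_segment pp cwF d).
Qed.

(** Both sides are increments over a period of one antiderivative, and such an
    increment has derivative [0] as a function of the starting point. *)
Lemma mean_shift F (v : R) : continuous F -> (forall t, F (t + 2 * pi) = F t) ->
  mean (fun t => F (t + v)) = mean F.
Proof.
move=> cF pF; have p0 := pi_gt0 R.
pose a := - pi - `|v| - 1; have [P dP] := antiderivative a cF.
have -> : mean F = mean (fun t => F (t + 0)) by apply: eq_mean => t; rewrite addr0.
have vv : - `|v| <= v by rewrite lerNl -normrN ler_norm.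
have v0 : 0 <= `|v| by [].
rewrite !(mean_translate cF dP); [|by rewrite /a; lra|by rewrite /a; lra].
have dD (t : R) : `|t| <= `|v| -> 0 <= t * v ->
    is_derive t (1 : R) (fun w => P (w + pi) - P (w - pi)) 0.
  rewrite ler_norml => /andP[t1 t2] _.
  have b1 : a < pi + t by rewrite /a; lra.
  have b2 : a < - pi + t by rewrite /a; lra.
  have := @is_deriveB _ _ _ _ _ t 1 _ _ (is_derive_translate dP b1) (is_derive_translate dP b2).
  rewrite -(pF (- pi + t)) [- pi + t + _](_ : _ = pi + t); last by ring.
  rewrite subrr; congr (is_derive _ _ _ _).
  by apply/funext => z /=; rewrite ![z + _]addrC.
have [t [_ _]] := @MVT0 R (fun w => P (w + pi) - P (w - pi)) (cst 0) v dD.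
by rewrite /cst mulr0 => /eqP; rewrite subr_eq0 => /eqP ->.
Qed.

Lemma Rintegral_period F : continuous F -> (forall t, F (t + 2 * pi) = F t) ->
  \int[mu]_(t in `[0, 2 * pi]) F t = 2 * pi * mean F.
Proof.
move=> cF pF; have p0 := pi_gt0 R; have [P dP] := antiderivative (- 1) cF.
have d t : 0 <= t <= 2 * pi -> is_derive t (1 : R) P (F t).
  by move=> /andP[t0 _]; apply: dP; lra.
rewrite (FTC_segment twopi0 cF d) -(mean_shift pi cF pF) (mean_translate cF dP); last by lra.
by rewrite subrr mulVKf ?gt_eqF//; congr (P _ - _); ring.
Qed.

Lemma continuous_mean (F : R -> R -> R) (G : R) :
  (forall t, continuous (F ^~ t)) -> (forall u, continuous (F u)) ->
  (forall u t, `|F u t| <= G) -> continuous (fun u => mean (F u)).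
Proof.
move=> c1 c2 bF u; apply: (@cvgM _ _ _ _ (cst (2 * pi)^-1) _ _ _ (cvg_cst _)).
have := @continuity_under_integral R _ _ mu F `[- pi, pi] (measurable_itv _) (u - 1) (u + 1).
apply.
- by move=> x _; exact: integrable_segment.
- by apply: aeW => t _ x _; exact: c1.
- by apply: (integrable_segment (- pi) pi (F := cst G)) => ?; exact: cst_continuous.
- by move=> x _; apply: aeW => t _.
- by rewrite inE /= in_itv /=; apply/andP; split; lra.
Qed.

Lemma is_derive_mean (F dF : R -> R -> R) (G : R) :
  (forall u t, is_derive u (1 : R) (F ^~ t) (dF u t)) -> (forall u, continuous (F u)) ->
  (forall u t, `|dF u t| <= G) ->
  forall u, is_derive u (1 : R) (fun u => mean (F u)) (mean (dF u)).
Proof.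
move=> dFP cF bF u.
have E : partial1of2 F = dF.
  apply/funext => x; apply/funext => t; rewrite partial1of2E.
  by case: (dFP x t).
have G0 : 0 <= G by apply: le_trans (bF 0 0).
have Iu : (`]u - 1, u + 1[%classic : set R) u by rewrite /= in_itv /=; apply/andP; split; lra.
have cG : continuous (cst G : R -> R) by move=> ?; exact: cst_continuous.
have h1 (x : R) : (`]u - 1, u + 1[%classic : set R) x -> mu.-integrable `[- pi, pi] (EFin \o F x).
  by move=> _; exact: integrable_segment.
have h2 (x t : R) : (`]u - 1, u + 1[%classic : set R) x ->
    (`[- pi, pi]%classic : set R) t -> derivable (F ^~ t) x 1.
  by move=> _ _; case: (dFP x t).
have h3 (x t : R) : (`]u - 1, u + 1[%classic : set R) x ->
    (`[- pi, pi]%classic : set R) t -> `|partial1of2 F x t| <= cst G t.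
  by move=> _ _; rewrite E.
have h4 := integrable_segment (- pi) pi cG.
have d := @derivable_under_integral R _ _ mu F _ (measurable_itv _) u (u - 1) (u + 1) Iu h1 h2
  (cst G) (fun=> G0) h4 h3.
have e := @differentiation_under_integral R _ _ mu F _ (measurable_itv _) u (u - 1) (u + 1) Iu h1 h2
  (cst G) (fun=> G0) h4 h3.
rewrite E in e.
have D : is_derive u (1 : R) (fun x => \int[mu]_(y in `[- pi, pi]) F x y)
    (\int[mu]_(y in `[- pi, pi]) dF u y).
  by apply: DeriveDef; [exact: d|rewrite -derive1E; exact: e].
exact: (@is_deriveZ _ _ _ _ (2 * pi)^-1 u 1 _ D).
Qed.

End Mean.

(** * Smoothing by averages along the axes *)

Section Averaging.
Variables (R : realType) (m : nat) (mu : R).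
Hypothesis mu01 : 0 <= mu <= 1.
Implicit Types (x y : 'rV[R]_m) (f g h : 'rV[R]_m -> R).

Local Notation e_ j := (delta_mx 0 j : 'rV[R]_m).
Local Notation goodT q K g := (good mu q setT K g).

Lemma good_line_continuous q K g x j : goodT q K g ->
  continuous (fun u : R => g (x + u *: e_ j)).
Proof.
move=> G; have [cg _ _ _] := goodW (leq0n q) G => u.
have -> : (fun u : R => g (x + u *: e_ j)) =
    (fun v : R => g ((x + u *: e_ j) + v *: e_ j)) \o (fun t => t - u).
  by apply/funext => t /=; rewrite -addrA -scalerDl [u + _]addrC subrK.
apply: (@continuous_comp _ _ _ (fun t : R => t - u) (fun v : R => g (x + u *: e_ j + v *: e_ j))).
  by apply: cvgB; [exact: cvg_id|exact: cvg_cst].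
by rewrite subrr; exact: cg.
Qed.

Arguments good_line_continuous {q K g} x j _.

Lemma good_bound q K g x : goodT q K g -> `|g x| <= K.
Proof. by move=> G; have [_ bg _ _] := goodW (leq0n q) G; exact: bg. Qed.

Lemma good_hoelder q K g x j (u : R) : goodT q K g ->
  `|g (x + u *: e_ j) - g x| <= K * `|u| `^ mu.
Proof. by move=> G; have [_ _ hg _] := goodW (leq0n q) G; exact: hg. Qed.

Variables (V : R -> R) (lam : 'I_m -> R) (BV : R).
Hypothesis V_cont : continuous V.
Hypothesis V_ge0 : forall t, 0 <= V t.
Hypothesis V_le : forall t, V t <= BV.
Hypothesis V_mean : mean V = 1.

Definition avg (j : 'I_m) g : 'rV[R]_m -> R :=
  fun x => mean (fun t => g (x + (lam j * t) *: e_ j) * V t).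

Lemma avg_integrand_cont q K g x j : goodT q K g ->
  continuous (fun t => g (x + (lam j * t) *: e_ j) * V t).
Proof.
move=> G t; apply: cvgM; last exact: V_cont.
apply: (@continuous_comp _ _ _ (fun t : R => lam j * t) (fun v : R => g (x + v *: e_ j))).
  exact: scaler_continuous.
exact: (good_line_continuous x j G).
Qed.

Arguments avg_integrand_cont {q K g} x j _.

Lemma continuousZV (c : R) : continuous (fun t => c * V t).
Proof. by move=> t; apply: cvgM; [exact: cvg_cst|exact: V_cont]. Qed.

Lemma norm_avg_le q K L g x j : goodT q K g -> (forall y, `|g y| <= L) ->
  `|avg j g x| <= L.
Proof.
move=> G bg; rewrite -[leRHS]mulr1 -V_mean -meanZ//.
apply: norm_mean_le; [exact: avg_integrand_cont G|exact: continuousZV|].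
by move=> t _; rewrite normrM (ger0_norm (V_ge0 t)) ler_wpM2r.
Qed.

Lemma avg_lineE g x i j (u : R) : avg j g (x + u *: e_ i) =
  mean (fun t => g ((x + (lam j * t) *: e_ j) + u *: e_ i) * V t).
Proof. by apply: eq_mean => t; rewrite addrAC. Qed.

Lemma avg_line_continuous q K g x i j : goodT q K g ->
  continuous (fun u : R => avg j g (x + u *: e_ i)).
Proof.
move=> G; rewrite (_ : (fun u => _) = (fun u => mean (fun t =>
  g ((x + (lam j * t) *: e_ j) + u *: e_ i) * V t))); last first.
  by apply/funext => u; exact: avg_lineE.
apply: (@continuous_mean _ _ (K * BV)).
- move=> t u; apply: cvgM; last exact: cvg_cst.
  exact: (good_line_continuous (x + (lam j * t) *: e_ j) i G).
- move=> u t.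
  have := avg_integrand_cont (x + u *: e_ i) j G t.
  by under eq_fun do rewrite addrAC.
- move=> u t; rewrite normrM (ger0_norm (V_ge0 t)).
  by apply: ler_pM => //; exact: good_bound G.
Qed.

Arguments avg_line_continuous {q K g} x i j _.

Lemma is_derive_avg q K g x i j : goodT q.+1 K g ->
  is_derive (0 : R) 1 (fun u : R => avg j g (x + u *: e_ i)) (avg j (partial i g) x).
Proof.
move=> G; have [_ _ _ /(_ i)[dg Gi]] := G.
rewrite (_ : (fun u => _) = (fun u => mean (fun t =>
  g ((x + (lam j * t) *: e_ j) + u *: e_ i) * V t))); last first.
  by apply/funext => u; exact: avg_lineE.
pose dF (u t : R) := partial i g ((x + (lam j * t) *: e_ j) + u *: e_ i) * V t.
have -> : avg j (partial i g) x = mean (dF 0).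
  by apply: eq_mean => t; rewrite /dF scale0r addr0.
apply: (@is_derive_mean _ _ dF (K * BV)).
- move=> u t; rewrite /dF.
  have := @is_deriveM R R (fun u : R => g (x + (lam j * t) *: e_ j + u *: e_ i)) (cst (V t)) u 1 _ _
    (is_derive_line (dg _ I)) (is_derive_cst _ _ _).
  by rewrite scaler0 add0r; congr (is_derive _ _ _ _); rewrite /GRing.scale /= mulrC.
- move=> u t.
  have := avg_integrand_cont (x + u *: e_ i) j G t.
  by under eq_fun do rewrite addrAC.
- move=> u t; rewrite normrM (ger0_norm (V_ge0 t)).
  by apply: ler_pM => //; exact: good_bound Gi.
Qed.

Lemma derivable_avg q K g x i j : goodT q.+1 K g -> derivable (avg j g) x (e_ i).
Proof.
move=> /(is_derive_avg x i j)[d _].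
by move: d; rewrite derivable_lineE scale0r addr0.
Qed.

Lemma partial_avg q K g i j : goodT q.+1 K g ->
  partial i (avg j g) = avg j (partial i g).
Proof.
move=> G; apply/funext => x; have [_ <-] := is_derive_avg x i j G.
by rewrite derive_lineE scale0r addr0.
Qed.

Lemma good_avg q K g j : goodT q K g -> goodT q K (avg j g).
Proof.
elim: q g => [|q IH] g G.
  split=> // [x i _|x _|x i u _ _].
  - exact: (avg_line_continuous x i j G).
  - by apply: norm_avg_le (G) _ => y; exact: good_bound G.
  - rewrite avg_lineE -meanB; first last.
    + exact: avg_integrand_cont G.
    + move=> t; have := avg_integrand_cont (x + u *: e_ i) j G t.
      by under eq_fun do rewrite addrAC.
    rewrite -[leRHS]mulr1 -V_mean -meanZ//; apply: norm_mean_le.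
    + move=> t; apply: cvgB; last exact: (avg_integrand_cont x j G).
      have := avg_integrand_cont (x + u *: e_ i) j G t.
      by under eq_fun do rewrite addrAC.
    + exact: continuousZV.
    + move=> t _; rewrite -mulrBl normrM (ger0_norm (V_ge0 t)) ler_wpM2r//.
      exact: good_hoelder G.
have [c b h _] : goodT 0 K (avg j g) by apply: goodW (leq0n q) _; exact/IH/goodW/G.
split => // i; split; first by move=> x _; exact: derivable_avg G.
rewrite (partial_avg i j G); apply: IH.
by have [_ _ _ /(_ i)[]] := G.
Qed.

Definition avg_rem j g : 'rV[R]_m -> R := fun x => g x - avg j g x.

Lemma good_rem q K g j : goodT q K g -> goodT q (2 * K) (avg_rem j g).
Proof. by move=> G; rewrite mulr_natl; exact: goodB G (good_avg j G). Qed.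

Lemma good_iter_rem q K g j r : goodT q K g -> goodT q (2 ^+ r * K) (iter r (avg_rem j) g).
Proof.
move=> G; elim: r => [|r IH] /=; first by rewrite mul1r.
by rewrite exprS -mulrA; exact: good_rem.
Qed.

Lemma partial_rem q K g i j : goodT q.+1 K g ->
  partial i (avg_rem j g) = avg_rem j (partial i g).
Proof.
move=> G; have [_ _ _ /(_ i)[dg _]] := G.
rewrite /avg_rem -(partial_avg i j G); apply/funext => x.
by apply: deriveB; [exact: dg|exact: derivable_avg G].
Qed.

Lemma partial_iter_rem q K g i j r : goodT q.+1 K g ->
  partial i (iter r (avg_rem j) g) = iter r (avg_rem j) (partial i g).
Proof.
move=> G; elim: r => //= r <-.
exact: partial_rem (good_iter_rem j r G).
Qed.

Lemma avg_remE q K g j x : goodT q K g ->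
  avg_rem j g x = mean (fun t => (g x - g (x + (lam j * t) *: e_ j)) * V t).
Proof.
move=> G; rewrite /avg_rem -[X in X - _]mulr1 -V_mean -meanZ// -meanB.
- by apply: eq_mean => t; rewrite mulrBl.
- exact: continuousZV.
- exact: avg_integrand_cont G.
Qed.

Lemma norm_rem_le2 q K E g j x : goodT q K g -> (forall y, `|g y| <= E) ->
  `|avg_rem j g x| <= 2 * E.
Proof.
move=> G bg; rewrite /avg_rem mulr_natl mulr2n; apply: le_trans (ler_normB _ _) _.
by apply: lerD => //; exact: norm_avg_le G bg.
Qed.

Lemma norm_iter_rem_le q K E g j r x : goodT q K g -> (forall y, `|g y| <= E) ->
  `|iter r (avg_rem j) g x| <= 2 ^+ r * E.
Proof.
move=> G bg; elim: r x => [|r IH] x /=; first by rewrite mul1r.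
by rewrite exprS -mulrA; exact: norm_rem_le2 (good_iter_rem j r G) IH.
Qed.

Variables (s c Lam : R).
Hypothesis s_gt0 : 0 < s.
Hypothesis c_ge0 : 0 <= c.
Hypothesis V_moment : mean (fun t => `|t| * V t) <= c * s.
Hypothesis lam_gt0 : forall j, 0 < lam j.
Hypothesis lam_le : forall j, lam j <= Lam.

Lemma continuous_normV (a b : R) : continuous (fun t => (a + b * `|t|) * V t).
Proof.
move=> t; apply: cvgM; last exact: V_cont.
apply: cvgD; first exact: cvg_cst.
by apply: cvgM; [exact: cvg_cst|exact: norm_continuous].
Qed.

Lemma mean_affine_le (a b : R) : 0 <= b ->
  mean (fun t => (a + b * `|t|) * V t) <= a + b * (c * s).
Proof.
move=> b0; rewrite (_ : (fun t => _) = (fun t => a * V t + b * (`|t| * V t))); last first.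
  by apply/funext => t; rewrite mulrDl mulrA.
have cn : continuous (fun t => `|t| * V t).
  by move=> t; apply: cvgM; [exact: norm_continuous|exact: V_cont].
rewrite meanD ?meanZ// ?V_mean ?mulr1.
- by rewrite lerD2l ler_wpM2l.
- exact: continuousZV.
- by move=> t; apply: cvgM; [exact: cvg_cst|exact: cn].
Qed.

(** The inequality [a ^ mu <= 1 + a] turns the moment of order [mu] of the kernel,
    at scale [s], into its first moment. *)
Lemma norm_rem_hoelder q K g j x : goodT q K g ->
  `|avg_rem j g x| <= K * ((Lam * s) `^ mu * (1 + c)).
Proof.
move=> G; have K0 := good_ge0 G; rewrite (avg_remE j x G).
have [mu0 mu1] : 0 <= mu /\ mu <= 1 by apply/andP.
have Lam0 : 0 < Lam by apply: lt_le_trans (lam_le j).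
pose b := K * (Lam * s) `^ mu.
have b0 : 0 <= b by rewrite mulr_ge0// powR_ge0.
apply: (@le_trans _ _ (mean (fun t => (b + b / s * `|t|) * V t))).
  apply: norm_mean_le.
  - move=> t; rewrite (_ : (fun t => _) = (fun t => g x * V t - g (x + (lam j * t) *: e_ j) * V t)).
      by apply: cvgB; [exact: continuousZV|exact: (avg_integrand_cont x j G)].
    by apply/funext => u; rewrite mulrBl.
  - exact: continuous_normV.
  - move=> t _; rewrite normrM (ger0_norm (V_ge0 t)) ler_wpM2r// distrC.
    apply: le_trans (good_hoelder x j _ G) _.
    have -> : b + b / s * `|t| = K * ((Lam * s) `^ mu * (1 + `|t| / s)).
      by rewrite /b; field; rewrite gt_eqF.
    rewrite ler_wpM2l// normrM gtr0_norm//.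
    have ts0 : 0 <= `|t| / s by rewrite divr_ge0// ltW.
    have -> : lam j * `|t| = lam j * s * (`|t| / s).
      by rewrite -[RHS]mulrA [s * _]mulrC divfK ?gt_eqF.
    have ls0 : 0 <= lam j * s by apply/ltW/mulr_gt0.
    have Ls0 : 0 <= Lam * s by apply/ltW/mulr_gt0.
    rewrite powRM //; apply: ler_pM; rewrite ?powR_ge0//.
      by apply: ge0_ler_powR => //; rewrite ler_pM2r.
    have [ts1|ts1] := leP 1 (`|t| / s).
      by apply: le_trans (ler1_powR ts1 mu1) _; rewrite lerDr.
    apply: (@le_trans _ _ 1); last by rewrite lerDl.
    have p1 : 1 `^ mu = 1 :> R by rewrite powR1.
    by rewrite -[leRHS]p1; apply: ge0_ler_powR; rewrite ?nnegrE ?ler01//; exact: ltW.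
apply: le_trans (mean_affine_le _ _) _; first by rewrite divr_ge0// ltW.
rewrite /b le_eqVlt; apply/orP; left; apply/eqP; field.
by rewrite gt_eqF.
Qed.

Lemma norm_rem_lipschitz K E g j x : goodT 1 K g -> (forall y, `|partial j g y| <= E) ->
  `|avg_rem j g x| <= E * (Lam * (c * s)).
Proof.
move=> G bE; rewrite (avg_remE j x G); have [_ _ _ /(_ j)[dg _]] := G.
have E0 : 0 <= E by apply: le_trans (bE x).
have Lam0 : 0 < Lam by apply: lt_le_trans (lam_le j).
apply: (@le_trans _ _ (mean (fun t => (0 + E * Lam * `|t|) * V t))).
  apply: norm_mean_le.
  - move=> t; rewrite (_ : (fun t => _) = (fun t => g x * V t - g (x + (lam j * t) *: e_ j) * V t)).
      by apply: cvgB; [exact: continuousZV|exact: (avg_integrand_cont x j G)].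
    by apply/funext => u; rewrite mulrBl.
  - exact: continuous_normV.
  - move=> t _; rewrite normrM (ger0_norm (V_ge0 t)) ler_wpM2r// distrC add0r.
    have [u [_ _ ->]] := @MVT_line R m g x (e_ j) (lam j * t) (fun _ _ _ => dg _ I).
    rewrite normrM mulrC -mulrA; apply: ler_pM => //; first exact: bE.
    by rewrite normrM gtr0_norm// ler_wpM2r.
apply: le_trans (mean_affine_le _ _) _; first by rewrite mulr_ge0// ltW.
by rewrite add0r !mulrA.
Qed.

(** The rate [s ^ (r + mu)], with the constants of the kernel and of the scales. *)
Definition rem_rate (r : nat) : R := (Lam * (c * s)) ^+ r * ((Lam * s) `^ mu * (1 + c)).

(** Each of the first [r] remainders gains a factor [s] by the mean value
    theorem, since remainders commute with partial derivatives; the last one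
    gains [s `^ mu] from Hoelder continuity. *)
Lemma norm_iter_rem r K g j x : goodT r K g ->
  `|iter r.+1 (avg_rem j) g x| <= K * rem_rate r.
Proof.
elim: r g x => [|r IH] g x G.
  by rewrite /rem_rate mul1r; exact: norm_rem_hoelder G.
rewrite iterS.
have G' : goodT 1 (2 ^+ r.+1 * K) (iter r.+1 (avg_rem j) g).
  by apply: goodW (good_iter_rem j r.+1 G).
rewrite (_ : K * rem_rate r.+1 = K * rem_rate r * (Lam * (c * s))); last first.
  by rewrite /rem_rate exprS; ring.
apply: norm_rem_lipschitz G' _ => y.
rewrite (partial_iter_rem j j r.+1 G); apply: IH.
by have [_ _ _ /(_ j)[]] := G.
Qed.

Variable q : nat.

(** The operator 1 - (1 - A)^(q+1), where A is the average [avg j]. A alone would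
    only approximate with an error of order [s]; the error of this combination is
    an iterated remainder. It is a polynomial in A without constant term, so it still maps periodic
    functions to trigonometric polynomials when the kernel is one. *)
Definition smooth_axis j g : 'rV[R]_m -> R :=
  fun x => g x - iter q.+1 (avg_rem j) g x.

Definition smooth_axes (js : seq 'I_m) g : 'rV[R]_m -> R :=
  foldr smooth_axis g js.

Let A : R := 1 + 2 ^+ q.+1.

Lemma good_smooth_axis r K g j : goodT r K g -> goodT r (A * K) (smooth_axis j g).
Proof. by move=> G; rewrite /A mulrDl mul1r; exact: goodB G (good_iter_rem j q.+1 G). Qed.

Lemma good_smooth_axes r K g js : goodT r K g ->
  goodT r (A ^+ size js * K) (smooth_axes js g).
Proof.
move=> G; elim: js => [|j js IH] /=; first by rewrite mul1r.
by rewrite exprS -mulrA; exact: good_smooth_axis.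
Qed.

Lemma partial_smooth_axes r K g i js : goodT r.+1 K g ->
  partial i (smooth_axes js g) = smooth_axes js (partial i g).
Proof.
move=> G; elim: js => //= j js <-.
have G' := good_smooth_axes js G; have [_ _ _ /(_ i)[dg _]] := G'.
rewrite /smooth_axis -[iter q.+1 _ (partial _ _)](partial_iter_rem i j q.+1 G').
apply/funext => x; apply: deriveB; first exact: dg.
by have [_ _ _ /(_ i)[d _]] := good_iter_rem j q.+1 G'; exact: d.
Qed.

Lemma dword_smooth_axes K g w js : goodT (size w) K g ->
  dword w (smooth_axes js g) = smooth_axes js (dword w g).
Proof.
elim: w => //= i w IH G; rewrite IH; last exact: goodW (leqnSn _) G.
apply: (@partial_smooth_axes 0 K).
by apply: good_dword; rewrite addn1.
Qed.

Lemma smooth_axis_err r K g j x : (r <= q)%N -> goodT r K g ->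
  `|g x - smooth_axis j g x| <= 2 ^+ (q - r) * (K * rem_rate r).
Proof.
move=> rq G; rewrite /smooth_axis opprB addrC subrK.
rewrite -[in X in iter X](subnK rq) -addnS iterD.
apply: norm_iter_rem_le (good_iter_rem j r.+1 G) _ => y.
exact: norm_iter_rem.
Qed.

Lemma rem_rate_ge0 r : (0 < m)%N -> 0 <= rem_rate r.
Proof.
move=> m0; have Lam0 : 0 < Lam by apply: lt_le_trans (lam_le (Ordinal m0)).
by rewrite !mulr_ge0 ?exprn_ge0 ?powR_ge0// ?addr_ge0// !mulr_ge0// ltW.
Qed.

(** Telescoping over the axes: each step acts on a function smoothed along other
    axes, which satisfies the bounds of [g] up to a constant. The same estimate
    then holds for derivatives, because they commute with the smoothing. *)
Lemma smooth_axes_err r K g js x : (0 < m)%N -> (r <= q)%N -> goodT r K g ->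
  `|g x - smooth_axes js g x| <=
    (size js)%:R * A ^+ size js * 2 ^+ q * K * rem_rate r.
Proof.
move=> m0 rq G; have K0 := good_ge0 G; have E0 := rem_rate_ge0 r m0.
have A1 : 1 <= A by rewrite /A lerDl exprn_ge0.
elim: js => [|j js IH] /=; first by rewrite subrr normr0 !mul0r.
have -> : g x - smooth_axis j (smooth_axes js g) x = (g x - smooth_axes js g x)
   + (smooth_axes js g x - smooth_axis j (smooth_axes js g) x) by rewrite addrA subrK.
apply: le_trans (ler_normD _ _) _.
have step := smooth_axis_err j x rq (good_smooth_axes js G).
apply: le_trans (lerD IH step) _.
have A0 : 0 <= A ^+ size js by rewrite exprn_ge0//; lra.
set P := A ^+ size js.
have P1 : 2 ^+ (q - r) * (P * K * rem_rate r) <= 2 ^+ q * (P * K * rem_rate r).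
  apply: ler_wpM2r; first by apply: mulr_ge0 => //; exact: mulr_ge0.
  by rewrite ler_weXn2l ?leq_subr//; lra.
apply: (@le_trans _ _ ((size js).+1%:R * (P * (2 ^+ q * K * rem_rate r)))).
  apply: le_trans (lerD (lexx _) P1) _.
  by rewrite -natr1 le_eqVlt; apply/orP; left; apply/eqP; ring.
rewrite exprS -/P; set X := P * _.
have X0 : 0 <= X by apply: mulr_ge0 => //; apply: mulr_ge0 => //; apply: mulr_ge0.
have -> : (size js).+1%:R * (A * P) * 2 ^+ q * K * rem_rate r = (size js).+1%:R * (A * X).
  by rewrite /X; ring.
by rewrite ler_wpM2l// ler_peMl.
Qed.

End Averaging.

Arguments good_line_continuous [R m mu q K g] x j _.

(** * Complex means and Bessel's inequality *)

Section ComplexMean.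
Variable R : realType.
Implicit Types (F G : R -> R[i]) (a z : R[i]) (k l : int).

Local Notation rRe := (@complex.Re R).
Local Notation rIm := (@complex.Im R).

Lemma cReD z a : rRe (z + a) = rRe z + rRe a. Proof. by case: z a => ? ? []. Qed.
Lemma cImD z a : rIm (z + a) = rIm z + rIm a. Proof. by case: z a => ? ? []. Qed.
Lemma cReM z a : rRe (z * a) = rRe z * rRe a - rIm z * rIm a.
Proof. by case: z a => ? ? []. Qed.
Lemma cImM z a : rIm (z * a) = rRe z * rIm a + rIm z * rRe a.
Proof. by case: z a => ? ? []. Qed.

Lemma eq_complexP z a : rRe z = rRe a -> rIm z = rIm a -> z = a.
Proof. by case: z a => ? ? [? ?] /= -> ->. Qed.

Definition sqn z : R := rRe z ^+ 2 + rIm z ^+ 2.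

Lemma sqn_ge0 z : 0 <= sqn z. Proof. by rewrite addr_ge0 ?sqr_ge0. Qed.

Lemma cabsE z : cabs z = Num.sqrt (sqn z). Proof. by case: z. Qed.

Lemma cabs_ge0 z : 0 <= cabs z. Proof. by rewrite cabsE sqrtr_ge0. Qed.

Lemma sqr_cabs z : cabs z ^+ 2 = sqn z.
Proof. by rewrite cabsE sqr_sqrtr// sqn_ge0. Qed.

Lemma sqnM z a : sqn (z * a) = sqn z * sqn a.
Proof. by rewrite /sqn cReM cImM; ring. Qed.

Lemma cabsM z a : cabs (z * a) = cabs z * cabs a.
Proof. exact: ComplexField.Normc.normcM. Qed.

Lemma sqn_real (x : R) : sqn x%:C = x ^+ 2.
Proof. by rewrite /sqn /= expr0n addr0. Qed.

Lemma cabs_real (x : R) : cabs x%:C = `|x|.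
Proof. by rewrite cabsE sqn_real sqrtr_sqr. Qed.

Lemma le_Re_cabs z : `|rRe z| <= cabs z.
Proof. by rewrite cabsE -sqrtr_sqr ler_sqrt ?sqn_ge0// lerDl sqr_ge0. Qed.

Lemma le_Im_cabs z : `|rIm z| <= cabs z.
Proof. by rewrite cabsE -sqrtr_sqr ler_sqrt ?sqn_ge0// lerDr sqr_ge0. Qed.

Lemma sqn_expi (t : R) : sqn (expi t) = 1.
Proof. by rewrite /sqn /= cos2Dsin2. Qed.

Lemma cabs_expi (t : R) : cabs (expi t) = 1.
Proof. by rewrite cabsE sqn_expi sqrtr1. Qed.

Lemma expiD (t u : R) : expi (t + u) = expi t * expi u.
Proof.
apply: eq_complexP; rewrite ?cReM ?cImM /= ?cosD ?sinD//.
by rewrite addrC.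
Qed.

Lemma expi0 : expi (0 : R) = 1.
Proof. by rewrite /expi cos0 sin0. Qed.

Lemma expi_int2pi k : expi (k%:~R * (2 * pi) : R) = 1.
Proof.
have e1 : expi (2 * pi : R) = 1 by rewrite mulr_natl /expi cos2pi sin2pi.
have N n : expi (n%:R * (2 * pi) : R) = 1.
  elim: n => [|n IH]; first by rewrite mul0r expi0.
  by rewrite -natr1 mulrDl expiD IH !mul1r.
case: k => n; first exact: N.
rewrite NegzE mulrNz mulNr.
have := expi0; rewrite -{1}(subrr (n.+1%:R * (2 * pi))) expiD N.
by rewrite mul1r.
Qed.

(** Complex integrals are pairs of real ones here, and so continuity is asked of
    the real and imaginary parts. *)
Definition ccont F := continuous (rRe \o F) /\ continuous (rIm \o F).

Lemma ccontM F G : ccont F -> ccont G -> ccont (fun t => F t * G t).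
Proof.
move=> [F1 F2] [G1 G2]; split => t /=.
  rewrite (_ : rRe \o _ = fun t => (rRe \o F) t * (rRe \o G) t - (rIm \o F) t * (rIm \o G) t).
    by apply: cvgB; apply: cvgM; [exact: F1|exact: G1|exact: F2|exact: G2].
  by apply/funext => u /=; rewrite cReM.
rewrite (_ : rIm \o _ = fun t => (rRe \o F) t * (rIm \o G) t + (rIm \o F) t * (rRe \o G) t).
  by apply: cvgD; apply: cvgM; [exact: F1|exact: G2|exact: F2|exact: G1].
by apply/funext => u /=; rewrite cImM.
Qed.

Lemma ccontD F G : ccont F -> ccont G -> ccont (fun t => F t + G t).
Proof.
move=> [F1 F2] [G1 G2]; split => t /=.
  rewrite (_ : rRe \o _ = fun t => (rRe \o F) t + (rRe \o G) t).
    by apply: cvgD; [exact: F1|exact: G1].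
  by apply/funext => u /=; rewrite cReD.
rewrite (_ : rIm \o _ = fun t => (rIm \o F) t + (rIm \o G) t).
  by apply: cvgD; [exact: F2|exact: G2].
by apply/funext => u /=; rewrite cImD.
Qed.

Lemma ccont_cst a : ccont (fun=> a).
Proof. by split => t; exact: cvg_cst. Qed.

Lemma ccontZ a F : ccont F -> ccont (fun t => a * F t).
Proof. exact/ccontM/ccont_cst. Qed.

Lemma ccont_sum (I : eqType) (s : seq I) (F : I -> R -> R[i]) :
  (forall i, i \in s -> ccont (F i)) -> ccont (fun t => \sum_(i <- s) F i t).
Proof.
elim: s => [|i s IH] cF.
  rewrite (_ : (fun t => _) = fun=> 0); first exact: ccont_cst.
  by apply/funext => t; rewrite big_nil.
rewrite (_ : (fun t => _) = fun t => F i t + \sum_(i <- s) F i t).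
  apply: ccontD; first by apply: cF; rewrite mem_head.
  by apply: IH => l ls; apply: cF; rewrite in_cons ls orbT.
by apply/funext => t; rewrite big_cons.
Qed.

Lemma ccont_expi (c : R) : ccont (fun t => expi (c * t)).
Proof.
split => t /=.
  apply: (@continuous_comp _ _ _ (fun t : R => c * t) cos); last exact: continuous_cos.
  exact: scaler_continuous.
apply: (@continuous_comp _ _ _ (fun t : R => c * t) sin); last exact: continuous_sin.
exact: scaler_continuous.
Qed.

Lemma ccont_conj F : ccont F -> ccont (fun t => (F t)^*).
Proof.
move=> [F1 F2]; split => t /=.
  rewrite (_ : rRe \o _ = rRe \o F); first exact: F1.
  by apply/funext => u /=; case: (F u).
rewrite (_ : rIm \o _ = (fun t => - (rIm \o F) t)).
  by apply: cvgN; exact: F2.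
by apply/funext => u /=; case: (F u).
Qed.

Lemma sqnE z : sqn z = rRe (z * z^*).
Proof. by case: z => x y; rewrite /sqn /=; ring. Qed.

Lemma continuous_sqn F : ccont F -> continuous (fun t => sqn (F t)).
Proof.
move=> cF; have -> : (fun t => sqn (F t)) = rRe \o (fun t => F t * (F t)^*).
  by apply/funext => t /=; exact: sqnE.
by case: (ccontM cF (ccont_conj cF)).
Qed.

Definition cmean F : R[i] := mean (rRe \o F) +i* mean (rIm \o F).

Lemma eq_cmean F G : (forall t, F t = G t) -> cmean F = cmean G.
Proof. by move=> FG; congr cmean; apply/funext. Qed.

Lemma cmeanD F G : ccont F -> ccont G ->
  cmean (fun t => F t + G t) = cmean F + cmean G.
Proof.
move=> [F1 F2] [G1 G2]; apply: eq_complexP; rewrite ?cReD ?cImD /= -meanD//;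
  by apply: eq_mean => t /=; rewrite ?cReD ?cImD.
Qed.

Lemma cmeanZ a F : ccont F -> cmean (fun t => a * F t) = a * cmean F.
Proof.
move=> [F1 F2].
have cZ (c : R) (f : R -> R) : continuous f -> continuous (fun t => c * f t).
  by move=> cf t; apply: cvgM; [exact: cvg_cst|exact: cf].
apply: eq_complexP; rewrite ?cReM ?cImM /= -!meanZ//.
  rewrite -meanB; [|exact: cZ|exact: cZ].
  by apply: eq_mean => t /=; rewrite cReM.
rewrite -meanD; [|exact: cZ|exact: cZ].
by apply: eq_mean => t /=; rewrite cImM.
Qed.

Lemma cmean_cst a : cmean (fun=> a) = a.
Proof. by apply: eq_complexP => /=; exact: mean_cst. Qed.

Lemma cmean_sum (I : eqType) (s : seq I) (F : I -> R -> R[i]) :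
  (forall i, i \in s -> ccont (F i)) ->
  cmean (fun t => \sum_(i <- s) F i t) = \sum_(i <- s) cmean (F i).
Proof.
elim: s => [|i s IH] cF.
  by rewrite big_nil -[RHS](cmean_cst 0); apply: eq_cmean => t; rewrite big_nil.
rewrite big_cons -IH; last by move=> l ls; apply: cF; rewrite in_cons ls orbT.
rewrite -cmeanD; first by apply: eq_cmean => t; rewrite big_cons.
  by apply: cF; rewrite mem_head.
by apply: ccont_sum => l ls; apply: cF; rewrite in_cons ls orbT.
Qed.

Lemma cmean_shift F (v : R) : ccont F -> (forall t, F (t + 2 * pi) = F t) ->
  cmean (fun t => F (t + v)) = cmean F.
Proof.
move=> [F1 F2] pF; rewrite /cmean /comp.
rewrite (mean_shift (F := rRe \o F) v F1); last by move=> t /=; rewrite pF.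
by rewrite (mean_shift (F := rIm \o F) v F2)// => t /=; rewrite pF.
Qed.

Lemma cmean_real (f : R -> R) : cmean (fun t => (f t)%:C) = (mean f)%:C.
Proof. by apply: eq_complexP => //=; exact: mean_cst. Qed.

(** A half-period shift changes the sign of a nonconstant exponential. *)
Lemma cmean_expi k : cmean (fun t => expi (k%:~R * t)) = (k == 0)%:R.
Proof.
have [->|k0] := eqVneq k 0.
  by rewrite -[RHS](cmean_cst 1); apply: eq_cmean => t; rewrite mul0r expi0.
have k0' : (k%:~R : R) != 0 by rewrite intr_eq0.
set c := cmean _; suff : c = - c by case: c => x y [] *; apply: eq_complexP => /=; lra.
rewrite -[RHS]mulN1r -cmeanZ; last exact: ccont_expi.
rewrite /c -(@cmean_shift _ (pi / k%:~R)); last first.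
- by move=> t; rewrite mulrDr expiD expi_int2pi mulr1.
- exact: ccont_expi.
apply: eq_cmean => t; rewrite mulrDr expiD mulrC; congr (_ * _).
rewrite mulrC divfK// /expi cospi sinpi.
by apply: eq_complexP => //=; rewrite oppr0.
Qed.

(** Expansion of the mean square of the difference between [F] and its
    projection on the exponentials with frequencies in [ks]. *)
Lemma bessel1 F (ks : seq int) : ccont F -> uniq ks ->
  \sum_(k <- ks) sqn (cmean (fun t => F t * expi (- (k%:~R * t))))
    <= mean (fun t => sqn (F t)).
Proof.
move=> cF uks; pose c k := cmean (fun t => F t * expi (- (k%:~R * t))).
have cE k : ccont (fun t => expi (- (k%:~R * t))).
  have := ccont_expi (- k%:~R); congr ccont; apply/funext => t.
  by rewrite mulNr.
have cE' k : ccont (fun t => expi (k%:~R * t)) by exact: ccont_expi.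
have conjE k t : (expi (k%:~R * t : R))^* = expi (- (k%:~R * t)).
  by rewrite /expi /= cosN sinN.
pose P t := \sum_(k <- ks) c k * expi (k%:~R * t).
have cP : ccont P by apply: ccont_sum => k _; exact: ccontZ.
have FP : cmean (fun t => F t * (P t)^*) = \sum_(k <- ks) (c k)^* * c k.
  transitivity (cmean (fun t => \sum_(k <- ks) (c k)^* * (F t * expi (- (k%:~R * t))))).
    apply: eq_cmean => t; rewrite /P rmorph_sum mulr_sumr; apply: eq_bigr => k _.
    by rewrite rmorphM /= -conjE; ring.
  rewrite cmean_sum => [|k _]; last exact/ccontZ/ccontM.
  by apply: eq_bigr => k _; rewrite cmeanZ//; exact: ccontM.
have PE l : l \in ks -> cmean (fun t => P t * expi (- (l%:~R * t))) = c l.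
  move=> lks.
  transitivity (cmean (fun t => \sum_(k <- ks) c k * expi ((k - l)%:~R * t))).
    apply: eq_cmean => t; rewrite /P mulr_suml; apply: eq_bigr => k _.
    by rewrite -mulrA -expiD intrB mulrBl.
  rewrite cmean_sum => [|k _]; last exact/ccontZ/ccont_expi.
  rewrite (big_rem l) //= big1_seq ?addr0 => [|k /andP[_]].
    by rewrite cmeanZ ?cmean_expi ?subrr ?eqxx ?mulr1//; exact: ccont_expi.
  rewrite mem_rem_uniq// inE => /andP[kl _].
  rewrite cmeanZ ?cmean_expi; last exact: ccont_expi.
  by rewrite subr_eq0 (negbTE kl) mulr0.
have PP : cmean (fun t => P t * (P t)^*) = \sum_(k <- ks) (c k)^* * c k.
  transitivity (cmean (fun t => \sum_(k <- ks) (c k)^* * (P t * expi (- (k%:~R * t))))).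
    apply: eq_cmean => t; rewrite {2}/P rmorph_sum mulr_sumr; apply: eq_bigr => k _.
    by rewrite rmorphM /= -conjE; ring.
  rewrite cmean_sum => [|k _]; last exact/ccontZ/ccontM.
  by apply: eq_big_seq => k kks; rewrite cmeanZ ?PE//; exact: ccontM.
have sumE : rRe (\sum_(k <- ks) (c k)^* * c k) = \sum_(k <- ks) sqn (c k).
  elim: (ks) => [|k s IH]; rewrite ?big_nil// !big_cons cReD IH; congr (_ + _).
  by rewrite sqnE mulrC.
have cG := continuous_sqn cF; have cH := continuous_sqn cP.
have cX : continuous (fun t => 2 * rRe (F t * (P t)^*)).
  have [c1 _] := ccontM cF (ccont_conj cP).
  by move=> t; apply: cvgM; [exact: cvg_cst|exact: c1].
have : 0 <= mean (fun t => sqn (F t - P t)) by apply: mean_ge0 => t; exact: sqn_ge0.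
have -> : mean (fun t => sqn (F t - P t))
    = mean (fun t => (sqn (F t) - 2 * rRe (F t * (P t)^*)) + sqn (P t)).
  apply: eq_mean => t; case: (F t) (P t) => x y [u v]; rewrite /sqn /=; ring.
rewrite meanD//; last by move=> t; apply: cvgB; [exact: cG|exact: cX].
rewrite meanB// meanZ; last by case: (ccontM cF (ccont_conj cP)).
have -> : mean (fun t => rRe (F t * (P t)^*)) = \sum_(k <- ks) sqn (c k).
  by rewrite -sumE -FP.
have -> : mean (fun t => sqn (P t)) = \sum_(k <- ks) sqn (c k).
  by rewrite -sumE -PP /cmean /=; apply: eq_mean => t; rewrite sqnE.
by move=> H; lra.
Qed.

(** The Cauchy-Schwarz inequality against an exponential, as Bessel's inequality
    with one frequency. *)
Lemma sqn_cmean_le F (k : int) : ccont F ->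
  sqn (cmean (fun t => F t * expi (- (k%:~R * t)))) <= mean (fun t => sqn (F t)).
Proof.
by move=> cF; have := bessel1 cF (isT : uniq [:: k]); rewrite big_seq1.
Qed.

End ComplexMean.

(** * Fourier modes in several directions *)

Section Modes.
Variables (R : realType) (m : nat) (lam : 'I_m -> R).
Hypothesis lam_gt0 : forall j, 0 < lam j.
Implicit Types (x y v : 'rV[R]_m) (g h : 'rV[R]_m -> R[i]) (a z : R[i]) (k : int).

Local Notation rRe := (@complex.Re R).
Local Notation rIm := (@complex.Im R).
Local Notation e_ j := (delta_mx 0 j : 'rV[R]_m).

(** Continuity along the axes and a bound on the square of the modulus are all
    that Bessel's inequality needs; both survive the extraction of a mode. *)
Definition clcont g := forall x j, ccont (fun u : R => g (x + u *: e_ j)).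

Definition cgood (L : R) g := clcont g /\ forall x, sqn (g x) <= L.

Lemma cgood_good q (mu K : R) (f : 'rV[R]_m -> R) : good mu q setT K f ->
  cgood (K ^+ 2) (fun x => (f x)%:C).
Proof.
move=> G; split=> [x j|x].
  split; first exact: (good_line_continuous x j G).
  by move=> t; exact: cvg_cst.
rewrite sqn_real -real_normK ?num_real// lerXn2r ?nnegrE ?(good_bound x G)//.
by apply: le_trans (good_bound x G).
Qed.

(** The part of [g] that has frequency [k] in direction [j]. It is kept as a
    function on the whole space, for periodic [g] covariant under translations
    along the axis ([mode_shift]), so that directions can be treated one after the
    other. *)
Definition mode (j : 'I_m) k g : 'rV[R]_m -> R[i] :=
  fun x => cmean (fun t => g (x + (lam j * t) *: e_ j) * expi (- (k%:~R * t))).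

Lemma ccont_scale (F : R -> R[i]) (c : R) : ccont F -> ccont (fun t => F (c * t)).
Proof.
move=> [c1 c2]; split => t.
  apply: (@continuous_comp _ _ _ (fun t : R => c * t) (rRe \o F)); last exact: c1.
  exact: scaler_continuous.
apply: (@continuous_comp _ _ _ (fun t : R => c * t) (rIm \o F)); last exact: c2.
exact: scaler_continuous.
Qed.

Lemma ccont_expiN k : ccont (fun t : R => expi (- (k%:~R * t))).
Proof.
have := @ccont_expi R (- k%:~R); rewrite /ccont.
by under eq_fun do rewrite mulNr.
Qed.

Lemma mode_integrand_cont g x j k : clcont g ->
  ccont (fun t => g (x + (lam j * t) *: e_ j) * expi (- (k%:~R * t))).
Proof.
move=> cg; apply: ccontM (ccont_expiN k).
exact: (ccont_scale (F := fun u => g (x + u *: e_ j)) _ (cg x j)).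
Qed.

Arguments mode_integrand_cont {g} x j k _.

Lemma sqn_mode_le L g x j k : cgood L g -> sqn (mode j k g x) <= L.
Proof.
move=> [cg bg].
have cF : ccont (fun t => g (x + (lam j * t) *: e_ j)).
  exact: (ccont_scale (F := fun u => g (x + u *: e_ j)) _ (cg x j)).
apply: le_trans (sqn_cmean_le k cF) _; rewrite -[leRHS]mean_cst; apply: le_mean => //.
  exact: continuous_sqn cF.
by move=> t; exact: cst_continuous.
Qed.

Lemma cgood_mode L g j k : cgood L g -> cgood L (mode j k g).
Proof.
move=> G; split=> [x i|x]; last exact: sqn_mode_le.
have [cg bg] := G.
pose F (u t : R) := g ((x + (lam j * t) *: e_ j) + u *: e_ i) * expi (- (k%:~R * t)).
have FE u : mode j k g (x + u *: e_ i) = cmean (F u).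
  by apply: eq_cmean => t; rewrite /F addrAC.
have Fc1 t : ccont (F ^~ t).
  by apply: ccontM; [exact: cg|exact: ccont_cst].
have Fc2 u : ccont (F u).
  have := mode_integrand_cont (x + u *: e_ i) j k cg.
  by rewrite /ccont /F; under eq_fun do rewrite addrAC.
have Fb u t : cabs (F u t) <= Num.sqrt L.
  by rewrite cabsE /F sqnM -mulNr sqn_expi mulr1 ler_wsqrtr.
rewrite (_ : (fun u => _) = fun u => cmean (F u)); last by apply/funext.
split.
  apply: (@continuous_mean _ (fun u => rRe \o F u) (Num.sqrt L)) => [t|u|u t].
  - by case: (Fc1 t).
  - by case: (Fc2 u).
  - exact: le_trans (le_Re_cabs _) (Fb u t).
apply: (@continuous_mean _ (fun u => rIm \o F u) (Num.sqrt L)) => [t|u|u t].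
- by case: (Fc1 t).
- by case: (Fc2 u).
- exact: le_trans (le_Im_cabs _) (Fb u t).
Qed.

Lemma modeZ g a j k x : clcont g -> mode j k (fun y => a * g y) x = a * mode j k g x.
Proof.
move=> G; rewrite /mode -cmeanZ; last exact: mode_integrand_cont G.
by apply: eq_cmean => t; rewrite mulrA.
Qed.

Lemma modeD g h j k x : clcont g -> clcont h ->
  mode j k (fun y => g y + h y) x = mode j k g x + mode j k h x.
Proof.
move=> G H; rewrite /mode -cmeanD.
- by apply: eq_cmean => t; rewrite mulrDl.
- exact: mode_integrand_cont G.
- exact: mode_integrand_cont H.
Qed.

Lemma mode_sum (I : eqType) (s : seq I) (G : I -> 'rV[R]_m -> R[i]) (c : I -> R[i]) j k x :
  (forall i, clcont (G i)) ->
  mode j k (fun y => \sum_(i <- s) c i * G i y) x = \sum_(i <- s) c i * mode j k (G i) x.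
Proof.
move=> GL; rewrite /mode.
transitivity (cmean (fun t =>
    \sum_(i <- s) c i * (G i (x + (lam j * t) *: e_ j) * expi (- (k%:~R * t))))).
  by apply: eq_cmean => t; rewrite mulr_suml; apply: eq_bigr => i _; rewrite mulrA.
rewrite cmean_sum => [|i _].
  by apply: eq_bigr => i _; rewrite cmeanZ//; exact: mode_integrand_cont (GL i).
exact/ccontZ/(mode_integrand_cont _ _ _ (GL i)).
Qed.

Lemma mode_covariant g v a j k x : clcont g -> (forall y, g (y + v) = a * g y) ->
  mode j k g (x + v) = a * mode j k g x.
Proof.
move=> G gv; rewrite /mode -cmeanZ; last exact: mode_integrand_cont G.
by apply: eq_cmean => t; rewrite addrAC gv mulrA.
Qed.

Lemma mode_shift g j k x (u : R) : clcont g ->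
  (forall y, g (y + (2 * pi * lam j) *: e_ j) = g y) ->
  mode j k g (x + u *: e_ j) = expi (k%:~R * (u / lam j)) * mode j k g x.
Proof.
move=> G pg.
pose F t := g (x + (lam j * t) *: e_ j) * expi (- (k%:~R * t)).
have cF : ccont F by exact: mode_integrand_cont G.
have pF t : F (t + 2 * pi) = F t.
  rewrite /F mulrDr scalerDl addrA [lam j * (2 * pi)]mulrC pg; congr (_ * _).
  rewrite mulrDr opprD expiD.
  by have := @expi_int2pi R (- k); rewrite mulrNz mulNr => ->; rewrite mulr1.
rewrite -[mode j k g x]/(cmean F) -(cmean_shift (u / lam j) cF pF) -cmeanZ; last first.
  have [c1 c2] := cF; split => t.
    apply: (@continuous_comp _ _ _ (fun t => t + u / lam j) (rRe \o F)); last exact: c1.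
    by apply: cvgD; [exact: cvg_id|exact: cvg_cst].
  apply: (@continuous_comp _ _ _ (fun t => t + u / lam j) (rIm \o F)); last exact: c2.
  by apply: cvgD; [exact: cvg_id|exact: cvg_cst].
apply: eq_cmean => t; rewrite /F.
have -> : x + (lam j * (t + u / lam j)) *: e_ j = x + u *: e_ j + (lam j * t) *: e_ j.
  by rewrite mulrDr [lam j * (u / _)]mulrC divfK ?gt_eqF// scalerDl addrA addrAC.
rewrite mulrCA -expiD; congr (_ * expi _).
by ring.
Qed.

(** Orthogonality of the exponentials: modes in one direction are projections that
    annihilate each other, which diagonalizes the iterated remainders. *)
Lemma mode_proj h j k l x :
  (forall y (u : R), h (y + u *: e_ j) = expi (l%:~R * (u / lam j)) * h y) ->
  mode j k h x = (l == k)%:R * h x.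
Proof.
move=> hl; rewrite /mode.
transitivity (cmean (fun t => h x * expi ((l - k)%:~R * t))).
  apply: eq_cmean => t; rewrite hl [lam j * t]mulrC mulfK ?gt_eqF ?lam_gt0//.
  by rewrite mulrAC mulrC -expiD intrB mulrBl.
by rewrite cmeanZ ?cmean_expi ?subr_eq0 1?mulrC//; exact: ccont_expi.
Qed.

Lemma bessel_mode L g j (ks : seq int) x : cgood L g -> uniq ks ->
  \sum_(k <- ks) sqn (mode j k g x) <= mean (fun t => sqn (g (x + (lam j * t) *: e_ j))).
Proof.
move=> [cg _]; apply: bessel1.
exact: (ccont_scale (F := fun u => g (x + u *: e_ j)) _ (cg x j)).
Qed.

Fixpoint modes (js : seq 'I_m) (l : seq int) g : 'rV[R]_m -> R[i] :=
  match js, l with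
  | j :: js', k :: l' => mode j k (modes js' l' g)
  | _, _ => g
  end.

Lemma cgood_modes L g js l : cgood L g -> cgood L (modes js l g).
Proof. by move=> G; elim: js l => [|j js IH] [|k l] //=; exact: cgood_mode. Qed.

Lemma modes_covariant L g v a js l x : cgood L g -> (forall y, g (y + v) = a * g y) ->
  modes js l g (x + v) = a * modes js l g x.
Proof.
move=> G gv; elim: js l x => [|j js IH] [|k l] x //=.
exact: mode_covariant (cgood_modes js l G).1 (IH l).
Qed.

Lemma modesZ L g a js l x : cgood L g ->
  modes js l (fun y => a * g y) x = a * modes js l g x.
Proof.
move=> G; elim: js l x => [|j js IH] [|k l] x //=.
rewrite -(modeZ a j k x (cgood_modes js l G).1).
by apply: (congr1 (fun h => mode j k h x)); apply/funext => y; exact: IH.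
Qed.

Lemma modesD L L' g h js l x : cgood L g -> cgood L' h ->
  modes js l (fun y => g y + h y) x = modes js l g x + modes js l h x.
Proof.
move=> G H; elim: js l x => [|j js IH] [|k l] x //=.
rewrite -(modeD j k x (cgood_modes js l G).1 (cgood_modes js l H).1).
by apply: (congr1 (fun h => mode j k h x)); apply/funext => y; exact: IH.
Qed.

Lemma modes_translate g v js l x :
  modes js l (fun y => g (y + v)) x = modes js l g (x + v).
Proof.
elim: js l x => [|j js IH] [|k l] x //=.
by apply: eq_cmean => t; rewrite IH addrAC.
Qed.

Lemma modes_shift L g js l j x (u : R) : cgood L g -> uniq js -> size l = size js ->
  (forall i y, g (y + (2 * pi * lam i) *: e_ i) = g y) -> j \in js ->
  modes js l g (x + u *: e_ j)
  = expi ((nth 0 l (index j js))%:~R * (u / lam j)) * modes js l g x.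
Proof.
move=> G + + pg; elim: js l x => [|i js IH] [|k l] //= x /andP[ijs ujs] [sl].
rewrite inE; have [->|ji] /= := eqVneq j i => [_|jjs].
  apply: mode_shift (cgood_modes js l G).1 _ => y.
  by rewrite -[RHS]mul1r; apply: modes_covariant G _ => z; rewrite mul1r pg.
by apply: mode_covariant (cgood_modes js l G).1 _ => y; exact: IH.
Qed.

Variables (ks : seq int).
Hypothesis ks_uniq : uniq ks.

(** Frequencies are sequences, in parallel with the sequence of directions over
    which modes are iterated. *)
Fixpoint freqs (r : nat) : seq (seq int) :=
  if r is r'.+1 then [seq k :: l | k <- ks, l <- freqs r'] else [:: [::]].

Lemma size_freqs r l : l \in freqs r -> size l = r.
Proof.
elim: r l => [|r IH] l /=; first by rewrite inE => /eqP ->.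
by move=> /allpairsP[[k l'] [_ /= l'r ->]] /=; rewrite IH.
Qed.

Lemma mem_freqs r l k : l \in freqs r -> k \in l -> k \in ks.
Proof.
elim: r l => [|r IH] l /=; first by rewrite inE => /eqP ->.
move=> /allpairsP[[k' l'] [kks /= l'r ->]] /=; rewrite inE => /predU1P[->//|].
exact: IH.
Qed.

(** The one-dimensional inequality is used one direction at a time. The remaining
    directions are summed under the mean by induction, pointwise, so that no
    interchange of integrals is needed. *)
Lemma bessel_modes L g js x : cgood L g ->
  \sum_(l <- freqs (size js)) sqn (modes js l g x) <= L.
Proof.
move=> G; elim: js x => [|j js IH] x /=; first by rewrite big_seq1; exact: G.2.
rewrite big_allpairs_dep exchange_big /=.
have cH l : ccont (fun t => modes js l g (x + (lam j * t) *: e_ j)).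
  have [cg _] := cgood_modes js l G.
  exact: (ccont_scale (F := fun u => modes js l g (x + u *: e_ j)) _ (cg x j)).
have sc l := continuous_sqn (cH l).
apply: (@le_trans _ _ (\sum_(l <- freqs (size js))
    mean (fun t => sqn (modes js l g (x + (lam j * t) *: e_ j))))).
  by apply: ler_sum => l _; apply: bessel_mode (cgood_modes js l G) ks_uniq.
have mean_sum (s : seq (seq int)) (F : seq int -> R -> R) : (forall l, continuous (F l)) ->
    continuous (fun t => \sum_(l <- s) F l t) /\
    \sum_(l <- s) mean (F l) = mean (fun t => \sum_(l <- s) F l t).
  move=> cF; elim: s => [|l s [c E]].
    rewrite big_nil (_ : (fun t => \sum_(l0 <- [::]) F l0 t) = cst 0); last first.
      by apply/funext => t; rewrite big_nil.
    by rewrite mean_cst; split=> // t; exact: cst_continuous.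
  rewrite big_cons E (_ : (fun t => \sum_(l0 <- l :: s) F l0 t)
      = fun t => F l t + \sum_(l <- s) F l t); last first.
    by apply/funext => t; rewrite big_cons.
  by rewrite meanD//; split=> // t; apply: cvgD; [exact: cF|exact: c].
have [cS ->] := mean_sum (freqs (size js)) _ sc.
rewrite -[leRHS]mean_cst; apply: le_mean => //.
by move=> t; exact: cst_continuous.
Qed.

End Modes.

Arguments mode_integrand_cont [R m] lam [g] x j k _.

(** * Smoothing as a Fourier multiplier *)

Lemma multiplier_step (R : realType) (M : R[i]) (P c : R) :
  (P - 1)%:C * M - c%:C * (M + (P - 1)%:C * M) = ((1 - c) * P - 1)%:C * M.
Proof.
rewrite !rmorphB rmorphM rmorphB rmorph1 /=.
move: (real_complex R c) (real_complex R P) => c' P'; ring.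
Qed.

Section Representation.
Variables (R : realType) (m : nat) (lam : 'I_m -> R) (mu : R).
Hypothesis lam_gt0 : forall j, 0 < lam j.
Variables (V : R -> R) (BV : R) (ks : seq int) (kap : int -> R).
Hypothesis V_cont : continuous V.
Hypothesis V_ge0 : forall t, 0 <= V t.
Hypothesis V_le : forall t, V t <= BV.
Hypothesis V_mean : mean V = 1.
Hypothesis ks_uniq : uniq ks.
Hypothesis V_fourier : forall t,
  (V t)%:C = \sum_(k <- ks) (kap k)%:C * expi (- (k%:~R * t)).
Implicit Types (x y v : 'rV[R]_m) (g h : 'rV[R]_m -> R) (k : int).

Local Notation e_ j := (delta_mx 0 j : 'rV[R]_m).
Local Notation goodT q K g := (good mu q setT K g).
Local Notation toC g := (fun x => (g x)%:C).

(** The expansion of the kernel is inserted under the mean. *)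
Lemma avg_modes q K g j x : goodT q K g ->
  (avg V lam j g x)%:C = \sum_(k <- ks) (kap k)%:C * mode lam j k (toC g) x.
Proof.
move=> G; have [cg _] := cgood_good G.
rewrite /avg -cmean_real.
transitivity (cmean (fun t => \sum_(k <- ks)
    (kap k)%:C * ((g (x + (lam j * t) *: e_ j))%:C * expi (- (k%:~R * t))))).
  apply: eq_cmean => t; rewrite rmorphM /= V_fourier mulr_sumr.
  by apply: eq_bigr => k _; rewrite mulrCA.
rewrite cmean_sum => [|k _]; last exact/ccontZ/(mode_integrand_cont lam x j k cg).
by apply: eq_bigr => k _; rewrite cmeanZ//; exact: (mode_integrand_cont lam x j k cg).
Qed.

Lemma clcont_sum (I : eqType) (s : seq I) (G : I -> 'rV[R]_m -> R[i]) (c : I -> R[i]) :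
  (forall i, clcont (G i)) -> clcont (fun y => \sum_(i <- s) c i * G i y).
Proof.
move=> GL x j; apply: (@ccont_sum _ _ s (fun i u => c i * G i (x + u *: e_ j))) => i _.
exact/ccontZ/GL.
Qed.

(** On the mode of frequency [k] the remainder acts as the factor [1 - kap k];
    the modes outside [ks] are left unchanged, and are accounted for by the term
    [g x], from which the modes in [ks] are subtracted. *)
Lemma iter_rem_modes q K g j r x : goodT q K g ->
  (forall y, g (y + (2 * pi * lam j) *: e_ j) = g y) ->
  (iter r (avg_rem V lam j) g x)%:C =
  (g x)%:C + \sum_(k <- ks) ((1 - kap k) ^+ r - 1)%:C * mode lam j k (toC g) x.
Proof.
move=> G pg; have GC := cgood_good G.
have pgC y : toC g (y + (2 * pi * lam j) *: e_ j) = toC g y by rewrite pg.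
elim: r x => [|r IH] x.
  by rewrite big1 ?addr0// => k _; rewrite expr0 subrr mul0r.
rewrite iterS; set h := iter r _ g.
have H : goodT q (2 ^+ r * K) h by exact: (good_iter_rem lam V_cont V_ge0 V_le V_mean j r G).
have hE : toC h = fun y =>
    toC g y + \sum_(k <- ks) ((1 - kap k) ^+ r - 1)%:C * mode lam j k (toC g) y.
  by apply/funext => y; exact: IH.
have cm k : clcont (mode lam j k (toC g)) by case: (cgood_mode lam j k GC).
rewrite /avg_rem rmorphB /= (avg_modes j x H) [(h x)%:C]IH -addrA; congr (_ + _).
rewrite -sumrB; apply: eq_big_seq => k kks.
rewrite hE (modeD lam j k x GC.1 (clcont_sum _ _ cm)) (mode_sum lam _ _ _ _ _ cm).
have -> : \sum_(l <- ks) ((1 - kap l) ^+ r - 1)%:C * mode lam j k (mode lam j l (toC g)) x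
    = ((1 - kap k) ^+ r - 1)%:C * mode lam j k (toC g) x.
  have shift l y (u : R) := mode_shift lam_gt0 l y u GC.1 pgC.
  rewrite (big_rem k) //= big1_seq ?addr0 => [|l /andP[_]].
    by rewrite (mode_proj lam_gt0 k x (shift k)) eqxx mul1r.
  rewrite mem_rem_uniq// inE => /andP[lk _].
  by rewrite (mode_proj lam_gt0 k x (shift l)) (negbTE lk) mul0r mulr0.
rewrite exprS; move: (mode _ _ _ _ _) ((1 - kap k) ^+ r) (kap k) => M P c.
exact: multiplier_step.
Qed.

(** The Fourier multiplier of one smoothing step of order [r]. *)
Definition multiplier (r : nat) k : R := 1 - (1 - kap k) ^+ r.

Lemma smooth_axis_modes q r K g j x : goodT q K g ->
  (forall y, g (y + (2 * pi * lam j) *: e_ j) = g y) ->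
  (smooth_axis V lam r j g x)%:C =
  \sum_(k <- ks) (multiplier r.+1 k)%:C * mode lam j k (toC g) x.
Proof.
move=> G pg; rewrite /smooth_axis rmorphB /= (iter_rem_modes r.+1 x G pg).
rewrite opprD addrA subrr add0r -sumrN; apply: eq_bigr => k _.
by rewrite -mulNr -rmorphN opprB.
Qed.

Lemma smooth_axes_translate r js g v x :
  smooth_axes V lam r js (fun y => g (y + v)) x = smooth_axes V lam r js g (x + v).
Proof.
have rem_tr j h y : avg_rem V lam j (fun y => h (y + v)) y = avg_rem V lam j h (y + v).
  by congr (_ - _); apply: eq_mean => t; rewrite addrAC.
have iter_tr j s h y : iter s (avg_rem V lam j) (fun y => h (y + v)) y
    = iter s (avg_rem V lam j) h (y + v).
  elim: s y => //= s IH y; rewrite -rem_tr.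
  by congr (avg_rem _ _ _ _ _); apply/funext => z; exact: IH.
elim: js x => //= j js IH x.
have -> : smooth_axes V lam r js (fun y => g (y + v)) = fun y => smooth_axes V lam r js g (y + v).
  by apply/funext => y; exact: IH.
by rewrite /smooth_axis iter_tr.
Qed.

(** Since iterated modes are exponentials, this is where the smoothed function is
    seen to extend to complex arguments. *)
Lemma smooth_axes_modes q r K g js x : goodT q K g ->
  (forall j y, g (y + (2 * pi * lam j) *: e_ j) = g y) ->
  (smooth_axes V lam r js g x)%:C =
  \sum_(l <- freqs ks (size js))
     (\prod_(k <- l) multiplier r.+1 k)%:C * modes lam js l (toC g) x.
Proof.
move=> G pg; have GC := cgood_good G; elim: js x => [|j js IH] x.
  by rewrite /= big_seq1 big_nil mul1r.
have pS y : smooth_axes V lam r js g (y + (2 * pi * lam j) *: e_ j) = smooth_axes V lam r js g y.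
  rewrite -smooth_axes_translate; congr (smooth_axes _ _ _ _ _ _).
  by apply/funext => z; exact: pg.
rewrite /= (smooth_axis_modes r x (good_smooth_axes lam V_cont V_ge0 V_le V_mean r js G) pS).
rewrite big_allpairs_dep; apply: eq_bigr => k _.
have -> : (fun x => (smooth_axes V lam r js g x)%:C) = (fun x => \sum_(l <- freqs ks (size js))
     (\prod_(k <- l) multiplier r.+1 k)%:C * modes lam js l (toC g) x).
  by apply/funext => y; exact: IH.
rewrite (mode_sum lam) => [|l]; last by case: (cgood_modes lam js l GC).
rewrite mulr_sumr; apply: eq_bigr => l _.
by rewrite big_cons rmorphM mulrA.
Qed.

End Representation.

(** * Decay of the modes of a regular function *)

(** Up to [pi / 2] the half-angle formula and the mean value theorem for the sine
    give this; beyond, the right side is at least 1, and the left side at most 1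
    because [`|t| <= 4]. *)
Lemma one_sub_cos_ge (R : realType) (t : R) : `|t| <= pi -> t ^+ 2 / 16 <= 1 - cos t.
Proof.
wlog t0 : t / 0 <= t => [H|].
  have [t0|t0] := leP 0 t; first exact: H.
  move=> tp; rewrite -sqrrN -cosN; apply: H; first by rewrite oppr_ge0 ltW.
  by rewrite normrN.
rewrite ger0_norm// => tp; have p0 := pi_gt0 R; have p2 := pihalf_lt2 R.
have [tp2|tp2] := leP t (pi / 2); last first.
  have c0 : cos t <= 0.
    rewrite leNgt; apply/negP; rewrite -cos_pihalf ltr_cos ?in_itv /=;
      [lra|apply/andP; split; lra|].
    by apply/andP; split; lra.
  have : t ^+ 2 <= 16 by rewrite (_ : 16 = 4 ^+ 2); [rewrite lerXn2r ?nnegrE//; lra|ring].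
  by lra.
pose u := t / 2.
have cE : cos t = 1 - 2 * sin u ^+ 2.
  by rewrite sin2cos2 (_ : t = u *+ 2) ?cos_mulr2n /u; [ring|rewrite -mulr_natr; field].
pose c := cos (pi / 4 : R).
have c2 : c ^+ 2 = 1 / 2.
  have := cos_mulr2n (pi / 4 : R); rewrite (_ : pi / 4 *+ 2 = pi / 2); last first.
    by rewrite -mulr_natr; field.
  by rewrite cos_pihalf -/c; lra.
have c0 : 0 < c by apply: cos_gt0_pihalf; apply/andP; split; lra.
have [w [wu _]] := @MVT0 R sin cos u (fun z _ _ => is_derive_sin z).
rewrite sin0 subr0 => su.
have u0 : 0 <= u by rewrite /u; lra.
have cw : c <= cos w.
  have wu' : `|w| <= pi / 4 by move: wu; rewrite (ger0_norm u0) /u; lra.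
  have w1 : `|w| \in `[0, pi] by rewrite in_itv /= normr_ge0; lra.
  have w2 : pi / 4 \in `[0, pi : R] by rewrite in_itv /=; apply/andP; split; lra.
  by rewrite -(cos_norm w) leNgt; apply/negP; rewrite /c ltr_cos//; lra.
have : u ^+ 2 * (1 / 2) <= sin u ^+ 2.
  by rewrite su [X in _ <= X]exprMn -c2 ler_wpM2l ?sqr_ge0// lerXn2r ?nnegrE//; lra.
by rewrite cE /u; have := sqr_ge0 t; rewrite expr_div_n; lra.
Qed.

Section DifferenceQuotients.
Variables (R : realType) (m : nat) (mu : R).
Implicit Types (x y : 'rV[R]_m) (g : 'rV[R]_m -> R).

Local Notation e_ j := (delta_mx 0 j : 'rV[R]_m).
Local Notation goodT q K g := (good mu q setT K g).

Lemma derivable_translate g (v : 'rV[R]_m) x i : derivable g (x + v) (e_ i) ->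
  derivable (fun y => g (y + v)) x (e_ i) /\
  partial i (fun y => g (y + v)) x = partial i g (x + v).
Proof.
have E : (fun u : R => g (x + u *: e_ i + v)) = (fun u : R => g (x + v + u *: e_ i)).
  by apply/funext => u; rewrite addrAC.
have d1 := derivable_lineE (fun y => g (y + v)) x (e_ i) 0.
have d2 := derivable_lineE g (x + v) (e_ i) 0.
have d3 := derive_lineE (fun y => g (y + v)) x (e_ i) 0.
have d4 := derive_lineE g (x + v) (e_ i) 0.
rewrite scale0r addr0 E in d1; rewrite scale0r addr0 in d2.
rewrite scale0r addr0 E in d3; rewrite scale0r addr0 in d4.
by move=> dg; rewrite -d1 d2; split; [exact: dg|rewrite /partial -d3; exact: d4].
Qed.

Lemma good_translate q K g (v : 'rV[R]_m) : goodT q K g -> goodT q K (fun x => g (x + v)).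
Proof.
elim: q g => [|q IH] g G.
  have [cg bg hg _] := G; split => [x j _|x _|x j u _ _|//].
  - rewrite (_ : (fun u : R => g (x + u *: e_ j + v)) = (fun u => g (x + v + u *: e_ j))).
      exact: cg.
    by apply/funext => u; rewrite addrAC.
  - exact: bg.
  - by rewrite addrAC; exact: hg.
apply: goodS; first exact/IH/(goodW (leqnSn q) G).
move=> j; have [_ _ _ /(_ j)[d Gj]] := G; split.
  by move=> x _; apply: (derivable_translate _).1; exact: d.
rewrite (_ : partial j _ = fun x => partial j g (x + v)); first exact: IH.
by apply/funext => x; apply: (derivable_translate _).2; exact: d.
Qed.

Lemma good_scale q K (c : R) g : goodT q K g -> goodT q (`|c| * K) (fun x => c * g x).
Proof.
elim: q g => [|q IH] g G.
  have [cg bg hg _] := G; split => [x j _|x _|x j u _ _|//].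
  - by apply: cvgM; [exact: cvg_cst|exact: cg].
  - by rewrite normrM ler_wpM2l//; exact: bg.
  - by rewrite -mulrBr normrM -mulrA ler_wpM2l//; exact: hg.
apply: goodS; first exact/IH/(goodW (leqnSn q) G).
move=> j; have [_ _ _ /(_ j)[d Gj]] := G; split.
  by move=> x _; apply: derivableZ; exact: d.
rewrite (_ : partial j _ = fun x => c * partial j g x); first exact: IH.
by apply/funext => x; apply: deriveZ; exact: d.
Qed.

Variables (j : 'I_m) (v : R).
Hypothesis v0 : v != 0.

(** Difference quotients are bounded by derivatives ([iter_diffq_le]) and act on
    modes as multipliers ([modes_diffq]), so they transfer bounds on derivatives
    to modes without an integration by parts. *)
Definition diffq g : 'rV[R]_m -> R := fun x => v^-1 * (g (x + v *: e_ j) - g x).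

Lemma good_diffq q K g : goodT q K g -> goodT q (`|v^-1| * (K + K)) (diffq g).
Proof. by move=> G; apply/good_scale/goodB => //; exact: good_translate. Qed.

Lemma partial_diffq q K g i : goodT q.+1 K g -> partial i (diffq g) = diffq (partial i g).
Proof.
move=> G; have [_ _ _ /(_ i)[d _]] := G.
have [_ _ _ /(_ i)[d' _]] := good_translate (v *: e_ j) G.
apply/funext => x; rewrite /diffq -(derivable_translate (d (x + v *: e_ j) I)).2.
transitivity (v^-1 * partial i (fun y => g (y + v *: e_ j) - g y) x).
  by apply: deriveZ; apply: derivableB; [exact: d'|exact: d].
by congr (_ * _); apply: deriveB; [exact: d'|exact: d].
Qed.

Lemma good_iter_diffq q K g r : goodT q K g -> exists K', goodT q K' (iter r diffq g).
Proof.
move=> G; elim: r => [|r [K' G']] /=; first by exists K.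
by eexists; exact: good_diffq G'.
Qed.

Lemma partial_iter_diffq q K g i r : goodT q.+1 K g ->
  partial i (iter r diffq g) = iter r diffq (partial i g).
Proof.
move=> G; elim: r => //= r IH; rewrite -IH.
by have [K' G'] := good_iter_diffq r G; exact: partial_diffq G'.
Qed.

Lemma diffq_le K E g x : goodT 1 K g -> (forall y, `|partial j g y| <= E) ->
  `|diffq g x| <= E.
Proof.
move=> [_ _ _ /(_ j)[d _]] bE.
have [t [_ _ H]] := @MVT_line R m g x (e_ j) v (fun _ _ _ => d _ I).
by rewrite /diffq H mulKf//; exact: bE.
Qed.

Lemma iter_diffq_le r K g x : goodT r K g -> `|iter r diffq g x| <= K.
Proof.
elim: r g x => [|r IH] g x G; first exact: good_bound G.
have [K' G'] := good_iter_diffq r G.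
apply: (diffq_le (K := K')) => [|y]; first exact: goodW G'.
rewrite (partial_iter_diffq j r G); apply: IH.
by have [_ _ _ /(_ j)[]] := G.
Qed.

End DifferenceQuotients.

Section Decay.
Variables (R : realType) (m : nat) (lam : 'I_m -> R) (mu : R).
Hypothesis lam_gt0 : forall j, 0 < lam j.
Implicit Types (x y : 'rV[R]_m) (g : 'rV[R]_m -> R).

Local Notation e_ j := (delta_mx 0 j : 'rV[R]_m).
Local Notation goodT q K g := (good mu q setT K g).
Local Notation toC g := (fun x => (g x)%:C).

Lemma diffq_periodic g j v : (forall i y, g (y + (2 * pi * lam i) *: e_ i) = g y) ->
  forall i y, diffq j v g (y + (2 * pi * lam i) *: e_ i) = diffq j v g y.
Proof. by move=> pg i y; rewrite /diffq addrAC !pg. Qed.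

Lemma modes_diffq q K g j v js l x : goodT q K g -> uniq js -> size l = size js ->
  (forall i y, g (y + (2 * pi * lam i) *: e_ i) = g y) -> j \in js ->
  modes lam js l (toC (diffq j v g)) x =
  (v^-1)%:C * (expi ((nth 0 l (index j js))%:~R * (v / lam j)) - 1) * modes lam js l (toC g) x.
Proof.
move=> G ujs sl pg jjs; have GC := cgood_good G.
have G'C := cgood_good (good_translate (v *: e_ j) G).
have pgC i y : toC g (y + (2 * pi * lam i) *: e_ i) = toC g y by rewrite pg.
have G1 : cgood ((`|v^-1| * K) ^+ 2) (fun y => (v^-1)%:C * (g (y + v *: e_ j))%:C).
  rewrite (_ : (fun y => _) = toC (fun y => v^-1 * g (y + v *: e_ j))).
    exact: cgood_good (good_scale v^-1 (good_translate (v *: e_ j) G)).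
  by apply/funext => y; rewrite rmorphM.
have G2 : cgood ((`|- v^-1| * K) ^+ 2) (fun y => (- v^-1)%:C * (g y)%:C).
  rewrite (_ : (fun y => _) = toC (fun y => - v^-1 * g y)).
    exact: cgood_good (good_scale (- v^-1) G).
  by apply/funext => y; rewrite rmorphM.
have -> : toC (diffq j v g) = fun y => (v^-1)%:C * (g (y + v *: e_ j))%:C + (- v^-1)%:C * (g y)%:C.
  by apply/funext => y; rewrite /diffq mulrBr rmorphB !rmorphM rmorphN mulNr.
rewrite (modesD lam js l x G1 G2) (modesZ lam _ js l x G'C) (modesZ lam _ js l x GC).
rewrite (modes_translate lam (toC g)) (modes_shift lam_gt0 x v GC ujs sl pgC jjs).
by rewrite rmorphN; ring.
Qed.

Lemma modes_iter_diffq q K g j v js l x r : goodT q K g -> uniq js -> size l = size js ->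
  (forall i y, g (y + (2 * pi * lam i) *: e_ i) = g y) -> j \in js ->
  modes lam js l (toC (iter r (diffq j v) g)) x =
  ((v^-1)%:C * (expi ((nth 0 l (index j js))%:~R * (v / lam j)) - 1)) ^+ r
    * modes lam js l (toC g) x.
Proof.
move=> G ujs sl pg jjs.
have pr s : forall i y,
    iter s (diffq j v) g (y + (2 * pi * lam i) *: e_ i) = iter s (diffq j v) g y.
  by elim: s => //= s IH; exact: diffq_periodic.
elim: r => [|r IH]; first by rewrite mul1r.
have [K' G'] := good_iter_diffq j v r G.
by rewrite iterS (modes_diffq v x G' ujs sl (pr r) jjs) IH exprS mulrA.
Qed.

Variables (ks : seq int) (N : nat) (Lam : R).
Hypothesis ks_uniq : uniq ks.
Hypothesis ks_le : forall k, k \in ks -> `|k%:~R| <= N.+1%:R :> R.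
Hypothesis lam_le : forall j, lam j <= Lam.

Lemma sqn_expi_sub1 (t : R) : sqn (expi t - 1) = 2 * (1 - cos t).
Proof. by rewrite /sqn /=; have := cos2Dsin2 t; lra. Qed.

(** On a mode of frequency [k] with [`|k| <= N.+1] the difference quotient with
    step [lam j / N.+1] is the multiplication by a number of modulus at least a
    constant times [`|k|], since the phase [k / N.+1] stays in [-pi, pi]. Bessel's
    inequality for the [q]-th iterated difference quotient, which is bounded by
    [K], then gives the decay of a [q]-th derivative. *)
Lemma decay_axis q K g js j x : goodT q K g -> uniq js ->
  (forall i y, g (y + (2 * pi * lam i) *: e_ i) = g y) -> j \in js ->
  \sum_(l <- freqs ks (size js))
    ((nth 0 l (index j js))%:~R ^+ 2) ^+ q * sqn (modes lam js l (toC g) x)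
  <= (8 * Lam ^+ 2) ^+ q * K ^+ 2.
Proof.
move=> G ujs pg jjs; pose v := lam j / N.+1%:R.
have N0 : (0 : R) < N.+1%:R by rewrite ltr0n.
have v0 : 0 < v by rewrite divr_gt0.
have Lam0 : 0 < Lam by exact: lt_le_trans (lam_le j).
have Bq : cgood (K ^+ 2) (toC (iter q (diffq j v) g)).
  have [K' G'] := good_iter_diffq j v q G.
  split; first by case: (cgood_good G').
  move=> y; rewrite sqn_real -real_normK ?num_real// lerXn2r ?nnegrE ?(good_ge0 G)//.
  by apply: iter_diffq_le G; rewrite gt_eqF.
have := bessel_modes lam ks_uniq js x Bq.
rewrite -[X in X <= _]mul1r -(ler_pM2l (x := (8 * Lam ^+ 2) ^+ q)); last first.
  by rewrite exprn_gt0// mulr_gt0// exprn_gt0.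
apply: le_trans; rewrite mul1r mulr_sumr big_seq [leRHS]big_seq ler_sum// => l lfr.
have sl := size_freqs lfr.
rewrite (modes_iter_diffq v x q G ujs sl pg jjs) sqnM mulrA ler_wpM2r ?sqn_ge0//.
set k := nth 0 l _.
have kks : k \in ks by apply: mem_freqs lfr _; apply: mem_nth; rewrite sl index_mem.
have sqnX z r : sqn (z ^+ r : R[i]) = sqn z ^+ r.
  by elim: r => [|r IH]; rewrite ?expr0 ?exprS ?sqnM ?IH// /sqn /=; ring.
have L8 : 0 <= 8 * Lam ^+ 2 by rewrite mulr_ge0 ?sqr_ge0.
rewrite sqnX -exprMn; apply: lerXn2r; rewrite ?nnegrE ?sqr_ge0//.
  by rewrite mulr_ge0 ?sqn_ge0.
rewrite sqnM sqn_real sqn_expi_sub1.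
have -> : k%:~R * (v / lam j) = k%:~R / N.+1%:R :> R.
  by rewrite /v; field; rewrite !gt_eqF ?lam_gt0//.
have tp : `|k%:~R / N.+1%:R : R| <= pi.
  rewrite normrM [`|_^-1|]gtr0_norm ?invr_gt0//; apply: (@le_trans _ _ 1).
    by rewrite ler_pdivrMr// mul1r; exact: ks_le.
  by have := pi_ge2 R; lra.
have ge := one_sub_cos_ge tp.
have ll : v^-1 ^+ 2 = N.+1%:R ^+ 2 / lam j ^+ 2.
  by rewrite /v invf_div expr_div_n.
rewrite ll; set X := 1 - cos _ in ge *.
apply: (@le_trans _ _ (8 * Lam ^+ 2 *
    (N.+1%:R ^+ 2 / lam j ^+ 2 * (2 * ((k%:~R / N.+1%:R) ^+ 2 / 16))))); last first.
  apply: ler_wpM2l => //; apply: ler_wpM2l; first by rewrite divr_ge0 ?sqr_ge0.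
  exact: ler_wpM2l.
have -> : 8 * Lam ^+ 2 * (N.+1%:R ^+ 2 / lam j ^+ 2 * (2 * ((k%:~R / N.+1%:R) ^+ 2 / 16)))
   = (Lam / lam j) ^+ 2 * k%:~R ^+ 2.
  by field; rewrite !gt_eqF ?lam_gt0.
rewrite ler_peMl ?sqr_ge0// exprn_ege1// ler_pdivlMr ?lam_gt0// mul1r.
exact: lam_le.
Qed.

End Decay.

(** * Absolute summability of the modes *)

Definition sym_freqs (N : nat) : seq int := [seq i%:Z - N%:Z | i <- iota 0 N.*2.+1].

Lemma sym_freqs_uniq N : uniq (sym_freqs N).
Proof. by rewrite map_inj_uniq ?iota_uniq// => i j; lia. Qed.

Lemma mem_sym_freqs N k : k \in sym_freqs N -> (`|k| <= N)%N.
Proof. by move=> /mapP[p]; rewrite mem_iota => *; lia. Qed.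

Lemma sum_sym_freqs (V : nmodType) N (F : int -> V) :
  \sum_(k <- sym_freqs N) F k
  = F 0 + \sum_(0 <= i < N) (F i.+1%:Z + F (- i.+1%:Z)).
Proof.
have E M : \sum_(k <- sym_freqs M) F k = \sum_(0 <= i < M.*2.+1) F (i%:Z - M%:Z).
  by rewrite /sym_freqs big_map /index_iota subn0.
elim: N => [|N IH]; first by rewrite E big_nat1 big_geq// subrr addr0.
rewrite [in RHS]big_nat_recr//= [RHS]addrA -IH !E doubleS big_nat_recl// big_nat_recr//=.
rewrite (eq_bigr (fun i : nat => F (i%:Z - N%:Z))) => [|i _]; last by congr F; lia.
have -> : (N.*2.+2)%:Z - N.+1%:Z = N.+1%:Z by lia.
have -> : 0%:Z - N.+1%:Z = - N.+1%:Z by lia.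
by rewrite addrC addrA.
Qed.

Section Weights.
Variable R : realType.

(** A discrete form of the fact that [x ^ (- (1 + al))] is the derivative of
    [- x ^ (- al) / al]; summing it telescopes. *)
Lemma powR_step (al : R) (N : nat) : 0 < al ->
  (N.+2%:R : R) `^ (- (1 + al)) <= (N.+1%:R `^ (- al) - N.+2%:R `^ (- al)) / al.
Proof.
move=> al0; set x : R := N.+2%:R; set y : R := N.+1%:R.
have x0 : 0 < x by rewrite ltr0n.
have y0 : 0 < y by rewrite ltr0n.
have xy : y = x - 1 by rewrite /x /y -[N.+2]addn1 natrD addrK.
clearbody x y.
rewrite ler_pdivlMr// lerBrDr.
have xE : x `^ (- (1 + al)) = x `^ (- al) / x.
  rewrite opprD powRD; last by rewrite (gt_eqF x0) implybT.
  by rewrite [x `^ -1]powRN powRr1 ?(ltW x0)// mulrC.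
have key : x `^ (- al) * (1 + al / x) <= y `^ (- al).
  rewrite /powR !gt_eqF//.
  apply: (@le_trans _ _ (expR (- al * ln x) * expR (al / x))).
    by rewrite ler_wpM2l ?expR_ge0// expR_ge1Dx.
  rewrite -expRD ler_expR.
  have lny : ln y <= ln x - 1 / x.
    have -> : y = x * (1 + - (1 / x)) by rewrite xy; field; rewrite gt_eqF.
    have yx0 : 0 < 1 + - (1 / x).
      have -> : 1 + - (1 / x) = y / x by rewrite xy; field; rewrite gt_eqF.
      by rewrite divr_gt0.
    rewrite lnM ?posrE// lerD2l; apply: le_ln1Dx; by rewrite -subr_gt0 opprK addrC.
  have := ler_wpM2l (ltW al0) lny; rewrite mulrBr mulrA mulr1.
  by lra.
by rewrite xE; lra.
Qed.

Lemma pseries_bound (al : R) (N : nat) : 0 < al ->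
  \sum_(0 <= i < N) (i.+1%:R : R) `^ (- (1 + al)) <= 1 + 1 / al.
Proof.
move=> al0; case: N => [|N].
  by rewrite big_geq// addr_ge0// divr_ge0// ltW.
have H : \sum_(0 <= i < N.+1) (i.+1%:R : R) `^ (- (1 + al))
    <= 1 + (1 - N.+1%:R `^ (- al)) / al.
  elim: N => [|N IH]; first by rewrite big_nat1 powR1 subrr mul0r addr0.
  rewrite big_nat_recr//=; apply: le_trans (lerD IH (powR_step N al0)) _.
  by rewrite le_eqVlt; apply/orP; left; apply/eqP; field; rewrite gt_eqF.
apply: le_trans H _; rewrite lerD2l; apply: ler_wpM2r; first by rewrite invr_ge0 ltW.
by rewrite gerBl powR_ge0.
Qed.

Definition freq_size (k : int) : R := Num.max 1 `|k%:~R|.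

Lemma freq_size_ge1 k : 1 <= freq_size k.
Proof. by rewrite /freq_size le_max lexx. Qed.

Lemma sum_freq_size (al : R) N : 0 < al ->
  \sum_(k <- sym_freqs N) (freq_size k) `^ (- (1 + al)) <= 1 + 2 * (1 + 1 / al).
Proof.
move=> al0; rewrite sum_sym_freqs /freq_size normr0 max_l// powR1 lerD2l.
have E i : `|(i.+1%:Z)%:~R| = i.+1%:R :> R by rewrite ger0_norm ?ler0z.
rewrite (eq_bigr (fun i => 2 * (i.+1%:R : R) `^ (- (1 + al)))) => [|i _].
  by rewrite -mulr_sumr ler_wpM2l// pseries_bound.
by rewrite mulrNz normrN E max_r ?ler1n// mulr_natl.
Qed.

Lemma sum_freqs_prod (b : int -> R) (ks : seq int) r :
  \sum_(l <- freqs ks r) \prod_(k <- l) b k = (\sum_(k <- ks) b k) ^+ r.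
Proof.
elim: r => [|r IH] /=; first by rewrite big_seq1 big_nil.
rewrite big_allpairs_dep exprS -IH mulr_suml; apply: eq_bigr => k _.
by rewrite mulr_sumr; apply: eq_bigr => l _; rewrite big_cons.
Qed.

(** A product of one-dimensional weights, whose inverses have an explicitly
    summable product structure ([sum_freqs_prod]). *)
Definition weight (a : R) (l : seq int) : R := \prod_(k <- l) (freq_size k) `^ a.

Lemma weight_gt0 a l : 0 < weight a l.
Proof.
by rewrite prodr_gt0// => k _; rewrite powR_gt0// (lt_le_trans ltr01)// freq_size_ge1.
Qed.

Lemma weightN a l : weight (- a) l = (weight a l)^-1.
Proof.
rewrite /weight; elim: l => [|k l IH]; first by rewrite !big_nil invr1.
by rewrite !big_cons IH powRN invfM.
Qed.

Lemma max_freq_size (l : seq int) : exists M : R, [/\ 1 <= M,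
  forall k, k \in l -> freq_size k <= M
  & M = 1 \/ exists2 k, k \in l & M = `|k%:~R|].
Proof.
elim: l => [|k l [M [M1 lM Mx]]]; first by exists 1; split; [|by []|left].
exists (Num.max M (freq_size k)); split.
- by rewrite le_max M1.
- move=> i; rewrite inE => /predU1P[->|/lM il]; first by rewrite le_max lexx orbT.
  by rewrite le_max il.
- have [kM|kM] := leP (freq_size k) M.
    case: Mx => [->|[i il ->]]; first by left.
    by right; exists i => //; rewrite inE il orbT.
  right; exists k; first exact: mem_head.
  rewrite /freq_size; case: (leP 1 `|k%:~R : R|) => // k1.
  by move: kM; rewrite /freq_size max_l ?ltW// ltNge M1.
Qed.

(** All the factors are at most the largest one, [M], and [M ^ (2 * q)] is one of
    the terms on the right. *)
Lemma weight_le (a : R) (l : seq int) (q : nat) : 0 <= a ->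
  a * (size l)%:R <= (2 * q)%:R ->
  weight a l <= 1 + \sum_(k <- l) (k%:~R ^+ 2) ^+ q.
Proof.
move=> a0 alq; have [M [M1 lM Mx]] := max_freq_size l.
have M0 : 0 <= M by apply: le_trans M1.
have S0 : 0 <= \sum_(k <- l) (k%:~R ^+ 2) ^+ q :> R.
  by rewrite sumr_ge0// => k _; rewrite exprn_ge0// sqr_ge0.
apply: (@le_trans _ _ (M ^+ (2 * q))).
  apply: (@le_trans _ _ ((M `^ a) ^+ size l)).
    rewrite /weight; elim: l lM {alq Mx S0} => [|k l IH] lM; first by rewrite big_nil.
    rewrite big_cons exprS ler_pM ?powR_ge0 ?prodr_ge0//.
    - by move=> i _; rewrite powR_ge0.
    - apply: ge0_ler_powR; rewrite ?nnegrE//.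
        by apply: le_trans (freq_size_ge1 k).
      by apply: lM; rewrite mem_head.
    - by apply: IH => i il; apply: lM; rewrite inE il orbT.
  by rewrite -!powR_mulrn ?powR_ge0// -powRrM ler_powR.
case: Mx => [->|[k kl ->]]; first by rewrite expr1n lerDl.
rewrite exprM real_normK ?num_real// (big_rem k)//= addrCA lerDl addr_ge0//.
by rewrite sumr_ge0// => i _; rewrite exprn_ge0// sqr_ge0.
Qed.

End Weights.

Section CoefSum.
Variables (R : realType) (n q : nat) (lam : 'I_(n + n) -> R) (Lam : R).
Hypothesis n_ge1 : (1 <= n)%N.
Hypothesis nq : (n.+1 <= q)%N.
Hypothesis lam_gt0 : forall j, 0 < lam j.
Hypothesis lam_le : forall j, lam j <= Lam.

Local Notation m := (n + n)%N.
Local Notation e_ j := (delta_mx 0 j : 'rV[R]_m).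
Local Notation toC g := (fun x => (g x)%:C).

(** The inequality of arithmetic and geometric means, with a scale [K] that makes
    the sums of both terms multiples of [K]; it plays the part of the
    Cauchy-Schwarz inequality. *)
Lemma young (K w c : R) : 0 < K -> 0 < w -> c <= (K * w^-1 + w * c ^+ 2 / K) / 2.
Proof.
move=> K0 w0; have : 0 <= (K / w) * (w * c / K - 1) ^+ 2.
  by rewrite mulr_ge0 ?sqr_ge0// divr_ge0// ltW.
have -> : (K / w) * (w * c / K - 1) ^+ 2 = w * c ^+ 2 / K - 2 * c + K * w^-1.
  by field; rewrite !gt_eqF.
by move=> H; lra.
Qed.

(** Bessel's inequality gives square summability against the weight
    [1 + \sum k_j ^ (2 q)]; since [2 q > 2 n] this weight dominates a product of
    one-dimensional weights with summable inverses. *)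
Lemma sum_modes_le : exists2 C : R, 0 <= C & forall (N : nat) (mu K : R) (g : 'rV[R]_m -> R),
  good mu q setT K g -> (forall j y, g (y + (2 * pi * lam j) *: e_ j) = g y) ->
  \sum_(l <- freqs (sym_freqs N) m) cabs (modes lam (enum 'I_m) l (toC g) 0) <= C * K.
Proof.
(* The exponent [1 + al] of the weights has to exceed 1, for summability, and
   [(1 + al) * (n + n)] must not exceed [2 * q], where [n + 1 <= q]. *)
pose al : R := n%:R^-1.
have n0 : 0 < n%:R :> R by rewrite ltr0n.
have al0 : 0 < al by rewrite invr_gt0.
pose S : R := 1 + 2 * (1 + 1 / al).
pose C1 : R := 1 + m%:R * (8 * Lam ^+ 2) ^+ q.
have L8 : 0 <= 8 * Lam ^+ 2 by rewrite mulr_ge0// sqr_ge0.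
have C10 : 0 <= C1 by rewrite addr_ge0// mulr_ge0// exprn_ge0.
have S0 : 0 <= S by rewrite /S addr_ge0// mulr_ge0// addr_ge0// divr_ge0// ltW.
exists ((S ^+ m + C1) / 2); first by rewrite divr_ge0// addr_ge0// exprn_ge0.
move=> N mu K g G pg; have K0 := good_ge0 G; have GC := cgood_good G.
pose c l := modes lam (enum 'I_m) l (toC g) 0.
have uks := sym_freqs_uniq N.
have em : size (enum 'I_m) = m by rewrite size_enum_ord.
have B0 : \sum_(l <- freqs (sym_freqs N) m) sqn (c l) <= K ^+ 2.
  by have := bessel_modes lam uks (enum 'I_m) 0 GC; rewrite em.
move: K0; rewrite le_eqVlt => /predU1P[K0|K0].
  rewrite -K0 mulr0 big1 // => l _.
  have := (cgood_modes lam (enum 'I_m) l GC).2 0.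
  rewrite -K0 expr0n /= => sq0; rewrite cabsE (_ : sqn _ = 0) ?sqrtr0//.
  by apply/eqP; rewrite eq_le sq0 sqn_ge0.
have ksN k : k \in sym_freqs N -> `|k%:~R| <= N.+1%:R :> R.
  move=> /mem_sym_freqs kN; rewrite -intr_norm -[N.+1%:R]/(N.+1%:Z%:~R) ler_int.
  by lia.
have Bj (j : 'I_m) : \sum_(l <- freqs (sym_freqs N) m) ((nth 0 l j)%:~R ^+ 2) ^+ q * sqn (c l)
    <= (8 * Lam ^+ 2) ^+ q * K ^+ 2.
  have := decay_axis lam_gt0 uks ksN lam_le 0 G (enum_uniq _) pg (mem_enum _ j).
  by rewrite em index_enum_ord.
pose a := 1 + al.
have step l : l \in freqs (sym_freqs N) m -> cabs (c l) <=
    (K * weight (- a) l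
      + (sqn (c l) + \sum_(j < m) ((nth 0 l j)%:~R ^+ 2) ^+ q * sqn (c l)) / K) / 2.
  move=> /size_freqs sl; apply: le_trans (young (cabs (c l)) K0 (weight_gt0 a l)) _.
  rewrite weightN ler_pM2r ?invr_gt0// lerD2l ler_pM2r ?invr_gt0// sqr_cabs.
  rewrite -mulr_suml -[X in _ <= X + _]mul1r -mulrDl ler_wpM2r ?sqn_ge0//.
  have -> : \sum_(j < m) ((nth 0 l j)%:~R ^+ 2) ^+ q = \sum_(k <- l) (k%:~R ^+ 2) ^+ q :> R.
    by rewrite (big_nth 0) big_mkord sl.
  apply: weight_le; first by rewrite addr_ge0// ltW.
  rewrite sl /a /al natrD.
  have -> : (1 + n%:R^-1) * (n%:R + n%:R) = (2 * n.+1)%:R :> R.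
    by rewrite natrM -[n.+1%:R]natr1; field; rewrite gt_eqF.
  by rewrite ler_nat leq_mul2l.
rewrite big_seq; apply: le_trans (ler_sum _ step) _; rewrite -big_seq.
have W1 : \sum_(l <- freqs (sym_freqs N) m) weight (- a) l <= S ^+ m.
  rewrite /weight sum_freqs_prod; apply: lerXn2r; rewrite ?nnegrE//.
    by rewrite sumr_ge0// => k _; rewrite powR_ge0.
  exact: sum_freq_size.
have W2 : \sum_(l <- freqs (sym_freqs N) m)
    (sqn (c l) + \sum_(j < m) ((nth 0 l j)%:~R ^+ 2) ^+ q * sqn (c l)) <= C1 * K ^+ 2.
  rewrite big_split /= exchange_big /= mulrDl mul1r; apply: lerD => //.
  apply: le_trans (ler_sum _ (fun j _ => Bj j)) _.
  by rewrite sumr_const card_ord -mulrA [X in _ <= X]mulr_natl.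
rewrite -mulr_suml big_split /= -mulr_sumr -mulr_suml.
have KW := ler_wpM2l (ltW K0) W1.
have KW2 : (\sum_(l <- freqs (sym_freqs N) m)
    (sqn (c l) + \sum_(j < m) ((nth 0 l j)%:~R ^+ 2) ^+ q * sqn (c l))) / K <= C1 * K.
  by rewrite ler_pdivrMr// -mulrA.
have := lerD KW KW2; set X := _ + _ => XS.
have -> : (S ^+ m + C1) / 2 * K = (K * S ^+ m + C1 * K) / 2 by ring.
by rewrite ler_pM2r ?invr_gt0.
Qed.

End CoefSum.

(** * De la Vallee-Poussin's kernel *)

Section Kernel.
Variable R : realType.
Implicit Types (k : int) (t : R).

Local Notation rRe := (@complex.Re R).

(** De la Vallee-Poussin's kernel. It is nonnegative with mean 1, so that its
    averages do not increase sup norms; it is a trigonometric polynomial; and its Fourier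
    coefficients, quotients of binomial coefficients, have Gaussian decay at
    scale [sqrt N]. *)
Definition dlvp (N : nat) t : R := (2 + 2 * cos t) ^+ N / 'C(N.*2, N)%:R.

Definition dlvp_coef (N : nat) k : R := 'C(N.*2, `|(k + N%:Z)%R|%N)%:R / 'C(N.*2, N)%:R.

Lemma centralbin_gt0 N : 0 < 'C(N.*2, N)%:R :> R.
Proof. by rewrite ltr0n bin_gt0 -addnn leq_addl. Qed.

Lemma dlvp_ge0 N t : 0 <= dlvp N t.
Proof.
rewrite divr_ge0 ?(ltW (centralbin_gt0 N))// exprn_ge0//.
Qed.

Lemma dlvp_le N t : dlvp N t <= 4 ^+ N.
Proof.
have b1 : 1 <= 'C(N.*2, N)%:R :> R by rewrite ler1n bin_gt0 -addnn leq_addl.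
rewrite /dlvp ler_pdivrMr ?centralbin_gt0//; apply: (@le_trans _ _ (4 ^+ N)).
  by apply: lerXn2r; rewrite ?nnegrE//; have := cos_geN1 t; have := cos_le1 t; lra.
by rewrite ler_peMr// exprn_ge0.
Qed.

Lemma dlvp_continuous N : continuous (dlvp N).
Proof.
move=> t; apply: cvgM; last exact: cvg_cst.
have c : (fun u => 2 + 2 * cos u) @ t --> 2 + 2 * cos t.
  by apply: cvgD; [exact: cvg_cst|apply: cvgM; [exact: cvg_cst|exact: continuous_cos]].
elim: N => [|N IH]; first by under eq_fun do rewrite expr0; exact: cvg_cst.
by under eq_fun do rewrite exprS; rewrite exprS; exact: cvgM.
Qed.

Lemma sum_sym_freqs_ord (W : nmodType) N (F : int -> W) :
  \sum_(k <- sym_freqs N) F k = \sum_(i < N.*2.+1) F (i%:Z - N%:Z).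
Proof.
by rewrite /sym_freqs big_map -(big_mkord xpredT (fun i => F (i%:Z - N%:Z))) /index_iota subn0.
Qed.

Lemma expiX (n : nat) t : expi t ^+ n = expi (n%:R * t).
Proof.
elim: n => [|n IH]; first by rewrite mul0r expi0.
by rewrite exprS IH -expiD -natr1 mulrDl mul1r addrC.
Qed.

(** [2 + 2 * cos t] is [(1 + z) ^ 2 / z] for [z = expi (- t)], and the binomial
    theorem expands [(1 + z) ^ (2 * N)]. *)
Lemma dlvp_fourier N t :
  (dlvp N t)%:C = \sum_(k <- sym_freqs N) (dlvp_coef N k)%:C * expi (- (k%:~R * t)).
Proof.
pose z := expi (- t).
have zz : z * expi t = 1 by rewrite -expiD addNr expi0.
have E : (2 + 2 * cos t)%:C = (1 + z) ^+ 2 * expi t.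
  have -> : (1 + z) ^+ 2 * expi t = z * (z * expi t) + 2 * (z * expi t) + expi t by ring.
  rewrite zz !mulr1 -[2 in RHS](rmorph_nat (real_complex R)) /z.
  by apply: eq_complexP; rewrite ?cReD ?cImD /expi /= ?cosN ?sinN; ring.
rewrite /dlvp rmorphM rmorphXn /= E exprMn -exprM mul2n exprDn sum_sym_freqs_ord.
rewrite expiX mulr_suml mulr_suml; apply: eq_bigr => i _.
rewrite /dlvp_coef subrK expr1n mul1r -mulr_natl rmorphM /= rmorph_nat fmorphV.
rewrite /z expiX -[expi (- _)]mul1r.
have -> : expi (- ((i%:Z - N%:Z)%:~R * t)) = expi (i%:R * - t) * expi (N%:R * t) :> R[i].
  by rewrite -expiD intrB; congr expi; ring.
by rewrite mul1r; ring.
Qed.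

Lemma dlvp_coef0 N : dlvp_coef N 0 = 1.
Proof. by rewrite /dlvp_coef add0r divff// gt_eqF// centralbin_gt0. Qed.

Lemma cmean_dlvp N k : k \in sym_freqs N ->
  cmean (fun t => (dlvp N t)%:C * expi (k%:~R * t)) = (dlvp_coef N k)%:C.
Proof.
move=> kN; transitivity (cmean (fun t =>
    \sum_(l <- sym_freqs N) (dlvp_coef N l)%:C * expi ((k - l)%:~R * t))).
  apply: eq_cmean => t; rewrite dlvp_fourier mulr_suml; apply: eq_bigr => l _.
  by rewrite -mulrA -expiD intrB mulrBl addrC.
rewrite cmean_sum => [|l _]; last exact/ccontZ/ccont_expi.
rewrite (eq_bigr (fun l => (dlvp_coef N l)%:C * (k == l)%:R)) => [|l _]; last first.
  by rewrite cmeanZ ?cmean_expi ?subr_eq0//; exact: ccont_expi.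
rewrite (big_rem k)// eqxx mulr1 big1_seq => [|l /andP[_]]; first exact: addr0.
rewrite mem_rem_uniq ?sym_freqs_uniq// inE => /andP[lk _].
by rewrite eq_sym (negbTE lk) mulr0.
Qed.

Lemma in_sym_freqs N k : (`|k| <= N)%N -> k \in sym_freqs N.
Proof.
move=> kN; apply/mapP; exists `|(k + N%:Z)%R|%N; first by rewrite mem_iota; lia.
by lia.
Qed.

Lemma dlvp_mean N : mean (dlvp N) = 1.
Proof.
have := cmean_dlvp (in_sym_freqs (isT : (`|0%R : int| <= N)%N)).
rewrite dlvp_coef0 => /(congr1 rRe) /= <-; apply: eq_mean => t /=.
by rewrite !mul0r cos0 mulr1 subr0.
Qed.

(** The mean is the Fourier coefficient of index 1, a quotient of neighbouring
    binomial coefficients. *)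
Lemma dlvp_mean_cos N : (0 < N)%N -> mean (fun t => cos t * dlvp N t) = N%:R / N.+1%:R.
Proof.
move=> N0; have := @cmean_dlvp N 1 (@in_sym_freqs N 1 N0).
have -> : dlvp_coef N 1 = N%:R / N.+1%:R.
  rewrite /dlvp_coef (_ : `|(1 + N%:Z)%R|%N = N.+1); last by lia.
  have := mul_bin_left N.*2 N; rewrite -addnn addnK addnn => /(congr1 (fun n => n%:R : R)).
  rewrite !natrM => H; apply/eqP; rewrite eqr_div ?pnatr_eq0//.
    by rewrite mulrC H mulrC.
  by rewrite -(pnatr_eq0 R) gt_eqF// centralbin_gt0.
move=> /(congr1 rRe) /= <-; apply: eq_mean => t /=.
by rewrite !mul1r mul0r subr0 mulrC.
Qed.

(** The mean of [1 - cos t] is [1 / N.+1], at most [s ^ 2]; it controls the second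
    moment, and [`|t| <= t ^ 2 / (2 * s) + s / 2] goes back to the first. *)
Lemma dlvp_moment N (s : R) : (0 < N)%N -> 0 < s -> N.+1%:R^-1 <= s ^+ 2 ->
  mean (fun t => `|t| * dlvp N t) <= 9 * s.
Proof.
move=> N0 s0 Ns; have cV := @dlvp_continuous N.
have cc : continuous (fun t => cos t * dlvp N t).
  by move=> t; apply: cvgM; [exact: continuous_cos|exact: cV].
have cZ (c : R) (f : R -> R) : continuous f -> continuous (fun t => c * f t).
  by move=> cf t; apply: cvgM; [exact: cvg_cst|exact: cf].
apply: (@le_trans _ _ (mean (fun t => (8 / s + s / 2) * dlvp N t
    - 8 / s * (cos t * dlvp N t)))).
  apply: le_mean.
  - by move=> t; apply: cvgM; [exact: norm_continuous|exact: cV].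
  - by move=> t; apply: cvgB; [exact: (cZ _ _ cV)|exact: (cZ _ _ cc)].
  - move=> t tp.
    have -> : (8 / s + s / 2) * dlvp N t - 8 / s * (cos t * dlvp N t)
      = (8 / s + s / 2 - 8 / s * cos t) * dlvp N t by ring.
    apply: ler_wpM2r; first exact: dlvp_ge0.
    have := @one_sub_cos_ge R t; rewrite ler_norml => /(_ tp) h.
    have sq : 0 <= (`|t| - s) ^+ 2 by exact: sqr_ge0.
    have tt : `|t| ^+ 2 = t ^+ 2 by rewrite real_normK ?num_real.
    rewrite -(ler_pM2r s0).
    have -> : (8 / s + s / 2 - 8 / s * cos t) * s = 8 * (1 - cos t) + s ^+ 2 / 2.
      by field; rewrite gt_eqF.
    move: sq; rewrite sqrrB tt => sq; lra.
rewrite meanB; [|exact: cZ|exact: cZ].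
rewrite !meanZ// dlvp_mean dlvp_mean_cos// mulr1.
have -> : N%:R / N.+1%:R = 1 - N.+1%:R^-1 :> R.
  by rewrite -[N.+1%:R]natr1; field; rewrite natr1 gt_eqF.
have h : 8 / s * N.+1%:R^-1 <= 8 / s * s ^+ 2.
  by rewrite ler_wpM2l// divr_ge0// ltW.
have e : 8 / s * s ^+ 2 = 8 * s by field; rewrite gt_eqF.
rewrite e in h; apply: (@le_trans _ _ (s / 2 + 8 * s)); last by lra.
by apply: le_trans (lerD (lexx _) h); rewrite le_eqVlt; apply/orP; left; apply/eqP; ring.
Qed.

(** The quotient of consecutive coefficients is at most
    [exp (- (2 j + 1) / (2 N + 1))], and the odd numbers [2 j + 1] add up to
    squares. *)
Lemma bin_gauss N j : (j <= N)%N ->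
  'C(N.*2, N + j)%:R <= 'C(N.*2, N)%:R * expR (- (j%:R ^+ 2 / N.*2.+1%:R)) :> R.
Proof.
elim: j => [|j IH] jN; first by rewrite addn0 expr0n mul0r oppr0 expR0 mulr1.
have d0 : (0 : R) < (N + j).+1%:R by rewrite ltr0n.
have M0 : (0 : R) < N.*2.+1%:R by rewrite ltr0n.
have H : (N + j).+1%:R * 'C(N.*2, (N + j).+1)%:R = (N - j)%:R * 'C(N.*2, N + j)%:R :> R.
  rewrite -!natrM mul_bin_left; congr (_ * _)%:R.
  by rewrite -addnn subnDl.
have r1 : (N - j)%:R / (N + j).+1%:R <= expR (- ((2 * j + 1)%:R / N.*2.+1%:R)) :> R.
  apply: le_trans (expR_ge1Dx _); rewrite ler_pdivrMr//.
  have -> : (N - j)%:R = (N + j).+1%:R - (2 * j + 1)%:R :> R.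
    by rewrite -natrB; [congr _%:R; lia|lia].
  rewrite mulrDl mul1r lerD2l mulNr lerN2 -mulrA ler_piMr// mulrC ler_pdivrMr// mul1r.
  by rewrite ler_nat; lia.
have -> : 'C(N.*2, N + j.+1)%:R = (N - j)%:R / (N + j).+1%:R * 'C(N.*2, N + j)%:R :> R.
  by rewrite addnS mulrAC -H mulrAC mulfV ?mul1r// gt_eqF.
apply: (@le_trans _ _ (expR (- ((2 * j + 1)%:R / N.*2.+1%:R)) *
   ('C(N.*2, N)%:R * expR (- (j%:R ^+ 2 / N.*2.+1%:R))))).
  by apply: ler_pM => //; exact/IH/ltnW.
rewrite mulrCA -expRD ler_wpM2l// ler_expR le_eqVlt; apply/orP; left; apply/eqP.
by rewrite natrD natrM -[j.+1%:R]natr1; field; rewrite gt_eqF.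
Qed.

Lemma dlvp_coef_ge0 N k : 0 <= dlvp_coef N k.
Proof. by rewrite divr_ge0. Qed.

Lemma dlvp_coef_gauss N k : k \in sym_freqs N ->
  dlvp_coef N k <= expR (- (k%:~R ^+ 2 / N.*2.+1%:R)).
Proof.
move=> /mem_sym_freqs kN; rewrite /dlvp_coef ler_pdivrMr ?centralbin_gt0// mulrC.
have -> : 'C(N.*2, `|(k + N%:Z)%R|) = 'C(N.*2, N + `|k|).
  have [k0|k0] := leP 0 k; first by congr 'C(_, _); lia.
  by rewrite -[RHS]bin_sub; [congr 'C(_, _); lia|lia].
have -> : k%:~R ^+ 2 = `|k|%N%:R ^+ 2 :> R.
  by rewrite natr_absz intr_norm real_normK ?num_real.
exact: bin_gauss.
Qed.

Lemma dlvp_coef_le1 N k : k \in sym_freqs N -> dlvp_coef N k <= 1.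
Proof.
move=> /dlvp_coef_gauss /le_trans; apply; rewrite expR_le1 oppr_le0.
by rewrite divr_ge0// sqr_ge0.
Qed.

Lemma multiplier_bounds (kap : int -> R) r k : 0 <= kap k <= 1 ->
  0 <= multiplier kap r k <= r%:R * kap k.
Proof.
move=> /andP[k0 k1]; rewrite /multiplier subr_ge0 exprn_ile1 ?subr_ge0 ?gerBl//=.
elim: r => [|r IH]; first by rewrite expr0 subrr mul0r.
have p1 : (1 - kap k) ^+ r <= 1 by rewrite exprn_ile1 ?subr_ge0 ?gerBl.
have kp : kap k * (1 - kap k) ^+ r <= kap k by rewrite ler_piMr.
have := IH; rewrite exprS -[r.+1%:R]natr1; lra.
Qed.

(** On a strip of width [sig] the exponential of frequency [k] grows up to
    [exp (`|k| * sig)]; completing the square shows that the Gaussian decay of the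
    multiplier compensates this as long as [sig ^ 2 * N] stays bounded. *)
Lemma multiplier_exp_le N r k (sig : R) : k \in sym_freqs N ->
  `|multiplier (dlvp_coef N) r k| * expR (`|k%:~R| * sig)
   <= r%:R * expR (sig ^+ 2 * N.*2.+1%:R / 4).
Proof.
move=> kN; have M0 : (0 : R) < N.*2.+1%:R by rewrite ltr0n.
have kb : 0 <= dlvp_coef N k <= 1 by rewrite dlvp_coef_ge0 dlvp_coef_le1.
have /andP[m0 m1] := multiplier_bounds r kb.
rewrite ger0_norm//; apply: (@le_trans _ _ (r%:R * expR (- (k%:~R ^+ 2 / N.*2.+1%:R)) *
    expR (`|k%:~R| * sig))).
  rewrite ler_wpM2r ?expR_ge0//; apply: le_trans m1 _.
  by rewrite ler_wpM2l//; exact: dlvp_coef_gauss.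
rewrite -mulrA -expRD ler_wpM2l// ler_expR.
set M : R := N.*2.+1%:R in M0 *.
have kk : k%:~R ^+ 2 = `|k%:~R| ^+ 2 :> R by rewrite real_normK ?num_real.
rewrite kk; set x := `|_|.
have : 0 <= (x - sig * M / 2) ^+ 2 / M by rewrite divr_ge0 ?sqr_ge0// ltW.
have -> : (x - sig * M / 2) ^+ 2 / M = x ^+ 2 / M - x * sig + sig ^+ 2 * M / 4.
  by field; rewrite gt_eqF.
by move=> H; clearbody x M; lra.
Qed.

End Kernel.

(** * The complex exponential series *)

Section ComplexConvergence.
Variable R : realType.
Implicit Types (u v : nat -> R[i]) (a b z w : R[i]).

Lemma cabs0 : cabs (0 : R[i]) = 0.
Proof. by rewrite cabsE /sqn /= expr0n addr0 sqrtr0. Qed.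

Lemma cabsD z w : cabs (z + w) <= cabs z + cabs w.
Proof. exact: le_normcD. Qed.

Lemma cabs_sum (I : Type) (s : seq I) (F : I -> R[i]) :
  cabs (\sum_(p <- s) F p) <= \sum_(p <- s) cabs (F p).
Proof.
elim: s => [|p s IH]; first by rewrite !big_nil cabs0.
by rewrite !big_cons; apply: le_trans (cabsD _ _) _; rewrite lerD2l.
Qed.

Lemma cabsX z n : cabs (z ^+ n) = cabs z ^+ n.
Proof.
elim: n => [|n IH]; first by rewrite !expr0 cabsE /sqn /= expr0n addr0 expr1n sqrtr1.
by rewrite !exprS cabsM IH.
Qed.

Lemma cabs_prod (I : Type) (s : seq I) (F : I -> R[i]) :
  cabs (\prod_(p <- s) F p) = \prod_(p <- s) cabs (F p).
Proof.
elim: s => [|p s IH]; last by rewrite !big_cons cabsM IH.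
by rewrite !big_nil -(expr0 1) cabsX expr0.
Qed.

Lemma cabs_le_ReIm z : cabs z <= `|complex.Re z| + `|complex.Im z|.
Proof.
have h : 0 <= `|complex.Re z| + `|complex.Im z| by rewrite addr_ge0.
rewrite cabsE -(ger0_norm h) -sqrtr_sqr ler_wsqrtr// /sqn sqrrD.
rewrite !real_normK ?num_real//.
by rewrite -addrA [_ *+ 2 + _]addrC addrA lerDl mulrn_wge0// mulr_ge0.
Qed.

(** Convergence of complex sequences in the form in which analyticity is stated:
    the moduli of the differences tend to 0. *)
Definition ccvg u a := (fun N => cabs (u N - a)) @ \oo --> (0 : R).

Lemma ccvg_le u a (e : nat -> R) : (forall N, cabs (u N - a) <= e N) ->
  e @ \oo --> (0 : R) -> ccvg u a.
Proof.
move=> ue e0; apply: (squeeze_cvgr _ (cvg_cst 0) e0).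
by apply: nearW => N; rewrite cabs_ge0 ue.
Qed.

Lemma ccvg_cst a : ccvg (fun=> a) a.
Proof.
apply: (@ccvg_le _ _ (fun=> 0)); last exact: cvg_cst.
by move=> N; rewrite subrr cabs0.
Qed.

Lemma ccvgD u v a b : ccvg u a -> ccvg v b -> ccvg (fun N => u N + v N) (a + b).
Proof.
move=> ua vb; apply: (@ccvg_le _ _ (fun N => cabs (u N - a) + cabs (v N - b))).
  by move=> N; rewrite opprD addrACA; exact: cabsD.
by rewrite -[0](addr0 (0 : R)); exact: cvgD.
Qed.

Lemma ccvgM u v a b : ccvg u a -> ccvg v b -> ccvg (fun N => u N * v N) (a * b).
Proof.
move=> ua vb; apply: (@ccvg_le _ _ (fun N => cabs (u N - a) * cabs (v N - b)
   + (cabs (u N - a) * cabs b + cabs a * cabs (v N - b)))).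
  move=> N; have -> : u N * v N - a * b = (u N - a) * (v N - b)
     + ((u N - a) * b + a * (v N - b)) by ring.
  apply: le_trans (cabsD _ _) _; rewrite cabsM lerD2l.
  by apply: le_trans (cabsD _ _) _; rewrite !cabsM.
have -> : (0 : R) = 0 * 0 + (0 * cabs b + cabs a * 0) by ring.
apply: cvgD; first exact: cvgM.
by apply: cvgD; apply: cvgM => //; exact: cvg_cst.
Qed.

Lemma ccvg_sum (I : Type) (s : seq I) (u : I -> nat -> R[i]) (a : I -> R[i]) :
  (forall p, ccvg (u p) (a p)) -> ccvg (fun N => \sum_(p <- s) u p N) (\sum_(p <- s) a p).
Proof.
move=> ua; elim: s => [|p s IH].
  rewrite big_nil (_ : (fun N => _) = fun=> 0); first exact: ccvg_cst.
  by apply/funext => N; rewrite big_nil.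
rewrite big_cons (_ : (fun N => \sum_(p0 <- p :: s) u p0 N)
    = fun N => u p N + \sum_(p <- s) u p N); first exact: ccvgD.
by apply/funext => N; rewrite big_cons.
Qed.

Lemma ccvg_prod (I : Type) (s : seq I) (u : I -> nat -> R[i]) (a : I -> R[i]) :
  (forall p, ccvg (u p) (a p)) -> ccvg (fun N => \prod_(p <- s) u p N) (\prod_(p <- s) a p).
Proof.
move=> ua; elim: s => [|p s IH].
  rewrite big_nil (_ : (fun N => _) = fun=> 1); first exact: ccvg_cst.
  by apply/funext => N; rewrite big_nil.
rewrite big_cons (_ : (fun N => \prod_(p0 <- p :: s) u p0 N)
    = fun N => u p N * \prod_(p <- s) u p N); first exact: ccvgM.
by apply/funext => N; rewrite big_cons.
Qed.

End ComplexConvergence.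

Section ExpPartial.
Variable F : numFieldType.
Implicit Types (u v : F).

Definition exp_partial u (N : nat) : F := \sum_(k < N) u ^+ k / k`!%:R.

(** The truncated exponential series with a formal variable, in which the Cauchy
    product of two of them can be read off coefficientwise. *)
Definition exp_poly u N : {poly F} := \poly_(k < N) (u ^+ k / k`!%:R).

Local Notation P := exp_poly.

Let P1 u N : (P u N).[1] = exp_partial u N.
Proof.
rewrite (horner_coef_wide _ (size_poly _ _)); apply: eq_bigr => k _.
by rewrite coef_poly ltn_ord expr1n mulr1.
Qed.

Lemma exp_partial_coefM u v N k : (k < N)%N -> (P u N * P v N)`_k = (u + v) ^+ k / k`!%:R.
Proof.
move=> kN; rewrite coefM addrC exprDn mulr_suml; apply: eq_bigr => p _.
have pk : (p <= k)%N by rewrite -ltnS.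
rewrite !coef_poly (leq_ltn_trans pk kN) (leq_ltn_trans (leq_subr _ _) kN).
rewrite -mulr_natr -(bin_fact pk) !natrM.
have f0 r : r`!%:R != 0 :> F by rewrite pnatr_eq0 -lt0n fact_gt0.
have b0 : 'C(k, p)%:R != 0 :> F by rewrite pnatr_eq0 -lt0n bin_gt0.
by field; rewrite !f0 b0.
Qed.

(** The product of two truncated series agrees with the truncated series of the
    sum below degree [N]; the rest is a sum of coefficients of higher degree. *)
Lemma exp_partial_defect u v N :
  exp_partial u N * exp_partial v N - exp_partial (u + v) N
  = \sum_(k < N) (P u N * P v N)`_(N + k).
Proof.
rewrite -!P1 -hornerM.
have sz : (size (P u N * P v N)%R <= N + N)%N.
  apply: leq_trans (size_polyMleq _ _) _; apply: leq_trans (leq_pred _) _.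
  by apply: leq_add; exact: size_poly.
rewrite (horner_coef_wide _ sz) big_split_ord /= P1 addrC.
have -> : exp_partial (u + v) N = \sum_(p < N) (P u N * P v N)`_p * 1 ^+ p.
  by apply: eq_bigr => p _; rewrite exp_partial_coefM// expr1n mulr1.
by rewrite addrK; apply: eq_bigr => p _; rewrite expr1n mulr1.
Qed.

Lemma coef_exp_partial u N p : (P u N)`_p = if (p < N)%N then u ^+ p / p`!%:R else 0.
Proof. exact: coef_poly. Qed.

End ExpPartial.

Section ComplexExp.
Variable R : realType.
Implicit Types (x y : R) (z w u v : R[i]).

(** The exponential through its polar form; [exp_partial_ccvg] shows that it is the
    sum of the exponential series. *)
Definition cexp z : R[i] := (expR (complex.Re z))%:C * expi (complex.Im z).

Lemma cexpD z w : cexp (z + w) = cexp z * cexp w.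
Proof.
by rewrite /cexp cReD cImD expRD expiD rmorphM /=; ring.
Qed.

Lemma cexp0 : cexp 0 = 1.
Proof. by rewrite /cexp /= expR0 expi0 mulr1. Qed.

Lemma cexp_sum (I : Type) (s : seq I) (F : I -> R[i]) :
  cexp (\sum_(p <- s) F p) = \prod_(p <- s) cexp (F p).
Proof.
elim: s => [|p s IH]; first by rewrite !big_nil cexp0.
by rewrite !big_cons cexpD IH.
Qed.

Lemma cabs_cexp z : cabs (cexp z) = expR (complex.Re z).
Proof. by rewrite /cexp cabsM cabs_real cabs_expi mulr1 ger0_norm// expR_ge0. Qed.

Lemma exp_partial_cvg x : exp_partial x @ \oo --> expR x.
Proof.
rewrite (_ : exp_partial x = series (exp_coeff x)); first exact: is_cvg_series_exp_coeff.
by apply/funext => N; rewrite /exp_partial /series /= big_mkord.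
Qed.

Lemma exp_partial_le x N : 0 <= x -> exp_partial x N <= expR x.
Proof.
move=> x0; rewrite (_ : exp_partial x N = series (exp_coeff x) N); last first.
  by rewrite /exp_partial /series /= big_mkord.
apply: nondecreasing_cvgn_le; last exact: is_cvg_series_exp_coeff.
by apply: nondecreasing_series => n _ _; rewrite /exp_coeff /= divr_ge0// exprn_ge0.
Qed.

Lemma defect_cvg x y :
  (fun N => exp_partial x N * exp_partial y N - exp_partial (x + y) N) @ \oo --> (0 : R).
Proof.
rewrite -(subrr (expR (x + y))) [X in _ --> X - _]expRD.
by apply: cvgB; [apply: cvgM|]; exact: exp_partial_cvg.
Qed.

Lemma cabs_coef_exp_poly z N p : cabs (exp_poly z N)`_p = (exp_poly (cabs z) N)`_p.
Proof.
rewrite !coef_exp_partial; case: ifP => _; last exact: cabs0.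
rewrite cabsM cabsX; congr (_ * _).
by rewrite -(rmorph_nat (real_complex R)) -fmorphV cabs_real ger0_norm// invr_ge0.
Qed.

(** The coefficients of the defect [exp_partial_defect] are sums of products with
    nonnegative coefficients, so passing to moduli can only increase it; for
    nonnegative reals it tends to 0 by the addition formula. *)
Lemma cabs_defect_le u v N :
  cabs (exp_partial u N * exp_partial v N - exp_partial (u + v) N)
  <= exp_partial (cabs u) N * exp_partial (cabs v) N - exp_partial (cabs u + cabs v) N.
Proof.
rewrite !exp_partial_defect; apply: le_trans (cabs_sum _ _) _.
apply: ler_sum => k _; rewrite !coefM; apply: le_trans (cabs_sum _ _) _.
by apply: ler_sum => p _; rewrite cabsM !cabs_coef_exp_poly.
Qed.

Lemma imag_powE y k : (0 +i* y) ^+ k / k`!%:R = cos_coeff y k +i* sin_coeff y k.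
Proof.
have e2 : (0 +i* y) ^+ 2 = (- y ^+ 2)%:C.
  by apply: eq_complexP; rewrite expr2 ?cReM ?cImM /=; ring.
have f : (k`!%:R : R[i])^-1 = (k`!%:R^-1)%:C.
  by rewrite fmorphV rmorph_nat.
have yk : y ^+ k = y ^+ odd k * (y ^+ 2) ^+ k./2.
  by rewrite -exprM mul2n -exprD odd_double_half.
rewrite -{1}(odd_double_half k) exprD -mul2n exprM e2 -rmorphXn f /=.
rewrite /cos_coeff /sin_coeff /= yk [(- y ^+ 2) ^+ _]exprNn -!exprnP.
have [ok|ok] := boolP (odd k); last first.
  by apply: eq_complexP; rewrite ?cReM ?cImM /= ?expr0 /=; ring.
have -> : k.-1./2 = k./2.
  by move: ok; case: (k) => //= p op; rewrite uphalf_half (negbTE op).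
by apply: eq_complexP; rewrite ?cReM ?cImM /= ?expr1; ring.
Qed.

Lemma exp_partial_imag_cvg y : ccvg (exp_partial (0 +i* y)) (expi y).
Proof.
have E N : exp_partial (0 +i* y) N = series (cos_coeff y) N +i* series (sin_coeff y) N.
  rewrite /exp_partial /series /= !big_mkord.
  elim: N => [|N IH]; first by rewrite !big_ord0.
  by rewrite !big_ord_recr /= IH imag_powE.
have cc : series (cos_coeff y) @ \oo --> cos y.
  by rewrite cos.unlock; exact: is_cvg_series_cos_coeff.
have cs : series (sin_coeff y) @ \oo --> sin y.
  by rewrite sin.unlock; exact: is_cvg_series_sin_coeff.
apply: (@ccvg_le _ _ _ (fun N =>
    `|series (cos_coeff y) N - cos y| + `|series (sin_coeff y) N - sin y|)).
  by move=> N; rewrite E; exact: cabs_le_ReIm.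
rewrite -[0](addr0 (0 : R)); apply: cvgD.
  by apply/norm_cvg0P; rewrite -(subrr (cos y)); apply: cvgB => //; exact: cvg_cst.
by apply/norm_cvg0P; rewrite -(subrr (sin y)); apply: cvgB => //; exact: cvg_cst.
Qed.

Lemma exp_partial_real x N : exp_partial x%:C N = (exp_partial x N)%:C.
Proof.
rewrite /exp_partial rmorph_sum; apply: eq_bigr => k _.
by rewrite rmorphM rmorphXn fmorphV rmorph_nat.
Qed.

(** For real and imaginary arguments these are the series of exp, cos and sin; the
    truncated series at a sum is the product of the truncated series up to a
    defect that tends to 0. *)
Lemma exp_partial_ccvg z : ccvg (exp_partial z) (cexp z).
Proof.
pose u := (complex.Re z)%:C; pose v := 0 +i* complex.Im z.
have zE : z = u + v by apply: eq_complexP; rewrite ?cReD ?cImD /=; ring.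
have cu : ccvg (exp_partial u) (expR (complex.Re z))%:C.
  apply: (@ccvg_le _ _ _ (fun N => `|exp_partial (complex.Re z) N - expR (complex.Re z)|)).
    by move=> N; rewrite exp_partial_real -rmorphB cabs_real.
  apply/norm_cvg0P; rewrite -(subrr (expR (complex.Re z))); apply: cvgB; last exact: cvg_cst.
  exact: exp_partial_cvg.
have cv : ccvg (exp_partial v) (expi (complex.Im z)) by exact: exp_partial_imag_cvg.
have cd : ccvg (fun N => exp_partial u N * exp_partial v N - exp_partial (u + v) N) 0.
  apply: (@ccvg_le _ _ _ (fun N => exp_partial (cabs u) N * exp_partial (cabs v) N
      - exp_partial (cabs u + cabs v) N)); last exact: defect_cvg.
  by move=> N; rewrite subr0; exact: cabs_defect_le.
have := ccvgD (ccvgM cu cv) (ccvgM (ccvg_cst (-1)) cd).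
rewrite mulr0 addr0 -/(cexp z).
by under [in X in X -> _]eq_fun do rewrite mulN1r opprB addrC subrK -zE.
Qed.

End ComplexExp.

(** * Finite sums of exponentials are entire *)

Section ExpSums.
Variables (R : realType) (m : nat).
Implicit Types (z h : 'rV[R[i]]_m) (w : 'I_m -> R).

Definition wsum w z : R[i] := \sum_(j < m) (w j)%:C * z 0 j.

Lemma wsumD w z h : wsum w (z + h) = wsum w z + wsum w h.
Proof. by rewrite /wsum -big_split; apply: eq_bigr => j _; rewrite mxE mulrDr. Qed.

Lemma Re_iM (z : R[i]) : complex.Re ('i * z) = - complex.Im z.
Proof. by case: z => x y /=; ring. Qed.

Lemma Im_wsum w z : complex.Im (wsum w z) = \sum_(j < m) w j * complex.Im (z 0 j).
Proof.
have Im_real (x : R) (p : R[i]) : complex.Im (x%:C * p) = x * complex.Im p.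
  by rewrite cImM /= mul0r addr0.
rewrite /wsum; elim: (index_enum _) => [|j s IH]; first by rewrite !big_nil.
by rewrite !big_cons cImD IH Im_real.
Qed.

Lemma cabs_cexp_wsum_le w z (s : R) : (forall j, `|complex.Im (z 0 j)| <= s) ->
  cabs (cexp ('i * wsum w z)) <= expR (\sum_(j < m) `|w j| * s).
Proof.
move=> zs; rewrite cabs_cexp Re_iM Im_wsum ler_expR -sumrN.
apply: ler_sum => j _; apply: le_trans (ler_norm _) _.
by rewrite normrN normrM ler_wpM2l.
Qed.

Variables (I : choiceType) (L : seq I) (a : I -> R[i]) (w : I -> 'I_m -> R).

Definition expsum z : R[i] := \sum_(l <- L) a l * cexp ('i * wsum (w l) z).

(** Every finite family of multi-indices lies in a box, over which the sum is a
    product of truncated exponential series. *)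
Lemma esum_exp_monomials (A : R) (y : 'I_m -> R) : 0 <= A -> (forall j, 0 <= y j) ->
  (\esum_(b in [set: mindex m]) (A * \prod_(j < m) (y j ^+ b j / (b j)`!%:R))%:E
   <= (A * \prod_(j < m) expR (y j))%:E)%E.
Proof.
move=> A0 y0; pose F (b : mindex m) : R := A * \prod_(j < m) (y j ^+ b j / (b j)`!%:R).
have F0 b : 0 <= F b.
  by rewrite mulr_ge0// prodr_ge0// => j _; rewrite divr_ge0// exprn_ge0.
apply: ge_ereal_sup => _ [X [fX _] <-].
rewrite fsbig_finite//= sumEFin lee_fin.
set s := finmap.enum_fset (fset_set X).
have us : uniq s by exact: finmap.fset_uniq.
pose N := (\sum_(b <- s) \sum_(j < m) (b j).+1)%N.
have bN b j : b \in s -> (b j < N)%N.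
  move=> bs; rewrite /N (big_rem b)//= (bigD1 j)//= -addnA.
  exact: leq_addr.
pose lift (b : {ffun 'I_m -> 'I_N}) : mindex m := [ffun j => b j : nat].
have lift_inj : injective lift.
  move=> b b' /ffunP bb; apply/ffunP => j; apply/val_inj.
  by have := bb j; rewrite !ffunE.
pose t := map lift (enum {ffun 'I_m -> 'I_N}).
have ut : uniq t by rewrite map_inj_uniq// enum_uniq.
have st b : b \in s -> b \in t.
  move=> bs; apply/mapP; exists [ffun j => Ordinal (bN b j bs)]; first by rewrite mem_enum.
  by apply/ffunP => j; rewrite !ffunE.
have -> : \sum_(b <- s) F b = \sum_(b <- t | b \in s) F b.
  have p : perm_eq s [seq b <- t | b \in s].
    apply: uniq_perm => //; first exact: filter_uniq.
    by move=> b; rewrite mem_filter; case: (boolP (b \in s)) => // /st ->.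
  by rewrite -[RHS]big_filter (perm_big _ p).
apply: (@le_trans _ _ (\sum_(b <- t) F b)).
  by rewrite [leRHS](bigID (fun b => b \in s))/= lerDl sumr_ge0.
rewrite big_map big_enum /= -mulr_sumr ler_wpM2l//.
apply: (@le_trans _ _ (\prod_(j < m) exp_partial (y j) N)).
  rewrite /exp_partial bigA_distr_bigA /=.
  by apply: ler_sum => b _; apply: ler_prod => j _; rewrite ffunE lexx divr_ge0// exprn_ge0.
apply: ler_prod => j _; rewrite exp_partial_le// andbT.
by rewrite sumr_ge0// => k _; rewrite divr_ge0// exprn_ge0.
Qed.

(** Around [z] each exponential is [cexp ('i * w . z)] times the product over the
    coordinates of the exponential series in [h], whose box sums are products of
    truncated exponentials. The radius 1 is arbitrary, as the sum is entire. *)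
Lemma analytic_expsum (U : set 'rV[R[i]]_m) : analytic_on U expsum.
Proof.
move=> z _; pose A l := a l * cexp ('i * wsum (w l) z).
pose c (b : mindex m) : R[i] :=
  \sum_(l <- L) A l * \prod_(j < m) (('i * (w l j)%:C) ^+ b j / (b j)`!%:R).
exists 1, c; split => // h _; pose y l j := 'i * (w l j)%:C * h 0 j.
have cE b : c b * monom b h = \sum_(l <- L) A l * \prod_(j < m) (y l j ^+ b j / (b j)`!%:R).
  rewrite /c /monom mulr_suml; apply: eq_bigr => l _.
  rewrite -mulrA -big_split; congr (_ * _); apply: eq_bigr => j _ /=.
  by rewrite /y [in RHS]exprMn; ring.
split.
  apply: (@le_lt_trans _ _ (\esum_(b in [set: mindex m]) \sum_(l <- L)
      (cabs (A l) * \prod_(j < m) (cabs (y l j) ^+ b j / (b j)`!%:R))%:E)%E).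
    apply: le_esum => b _; rewrite sumEFin lee_fin cE.
    apply: le_trans (cabs_sum _ _) _; apply: ler_sum => l _.
    rewrite cabsM ler_wpM2l ?cabs_ge0// cabs_prod; apply: ler_prod => j _.
    rewrite cabs_ge0 cabsM cabsX ler_wpM2l ?exprn_ge0 ?cabs_ge0//.
    by rewrite -(rmorph_nat (real_complex R)) -fmorphV cabs_real ger0_norm// invr_ge0.
  rewrite esum_sum => [|b l _ _]; last first.
    rewrite lee_fin mulr_ge0 ?cabs_ge0// prodr_ge0// => j _.
    by rewrite divr_ge0// exprn_ge0// cabs_ge0.
  apply: (@le_lt_trans _ _ (\sum_(l <- L) (cabs (A l) * \prod_(j < m) expR (cabs (y l j)))%:E)%E).
    apply: lee_sum => l _; apply: esum_exp_monomials; first exact: cabs_ge0.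
    by move=> j; exact: cabs_ge0.
  by rewrite sumEFin ltry.
have box N : box_sum c h N = \sum_(l <- L) A l * \prod_(j < m) exp_partial (y l j) N.
  rewrite /box_sum.
  transitivity (\sum_(b : {ffun 'I_m -> 'I_N}) \sum_(l <- L)
      A l * \prod_(j < m) (y l j ^+ b j / (b j)`!%:R)).
    apply: eq_bigr => b _; rewrite cE; apply: eq_bigr => l _; congr (_ * _).
    by apply: eq_bigr => j _; rewrite ffunE.
  rewrite exchange_big; apply: eq_bigr => l _ /=; rewrite -mulr_sumr; congr (_ * _).
  by rewrite /exp_partial bigA_distr_bigA.
have gE : expsum (z + h) = \sum_(l <- L) A l * \prod_(j < m) cexp (y l j).
  apply: eq_bigr => l _; rewrite wsumD mulrDr cexpD mulrA; congr (_ * _).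
  by rewrite /wsum mulr_sumr cexp_sum; apply: eq_bigr => j _; rewrite /y mulrA.
rewrite gE; under eq_fun do rewrite box.
apply: (@ccvg_sum R I L (fun l N => A l * \prod_(j < m) exp_partial (y l j) N)) => l.
apply: ccvgM; first exact: ccvg_cst.
by apply: ccvg_prod => j; exact: exp_partial_ccvg.
Qed.

End ExpSums.

(** * Fourier coefficients of sums of exponentials *)

Lemma row_mx_lift (T : Type) (n : nat) (x : 'rV[T]_1) (v : 'rV[T]_n) (j : 'I_n) :
  (row_mx x v : 'rV[T]_(1 + n)) 0 (lift ord0 j) = v 0 j.
Proof.
have -> : lift ord0 j = rshift 1 j :> 'I_(1 + n) by exact: val_inj.
exact: row_mxEr.
Qed.

Section TorusIntegral.
Variable R : realType.

Lemma cint_period_cmean (F : R -> R[i]) : ccont F -> (forall t, F (t + 2 * pi) = F t) ->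
  cint_period F = (2 * pi)%:C * cmean F.
Proof.
move=> [c1 c2] pF; have twopi0 : 2 * pi != 0 :> R by rewrite gt_eqF// mulr_gt0// pi_gt0.
rewrite /cint_period.
rewrite (Rintegral_period (F := @complex.Re R \o F) c1); last by move=> t /=; rewrite pF.
rewrite (Rintegral_period (F := @complex.Im R \o F) c2); last by move=> t /=; rewrite pF.
by apply: eq_complexP; rewrite ?cReM ?cImM /=; ring.
Qed.

Lemma cint_period_exps (I : eqType) (L : seq I) (b : I -> R[i]) (k : I -> int) :
  cint_period (fun t => \sum_(l <- L) b l * expi ((k l)%:~R * t))
  = \sum_(l <- L) b l * ((k l == 0)%:R * (2 * pi)%:C).
Proof.
have ce l : ccont (fun t => b l * expi ((k l)%:~R * t : R)) by exact/ccontZ/ccont_expi.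
rewrite cint_period_cmean; first last.
- move=> t; apply: eq_bigr => l _.
  by rewrite mulrDr expiD expi_int2pi mulr1.
- by apply: ccont_sum => l _.
rewrite cmean_sum => [|l _]; last exact: ce.
rewrite mulr_sumr; apply: eq_bigr => l _.
by rewrite cmeanZ ?cmean_expi; [ring|exact: ccont_expi].
Qed.

(** Orthogonality of exponentials, one angle at a time along the iterated
    integral. *)
Lemma torus_int_exps (n : nat) (I : eqType) (L : seq I) (b : I -> R[i])
    (kap : I -> 'rV[int]_n) :
  torus_int (fun th : 'rV[R]_n =>
    \sum_(l <- L) b l * expi (\sum_(j < n) (kap l 0 j)%:~R * th 0 j))
  = \sum_(l <- L) b l * ((kap l == 0)%:R * ((2 * pi) ^+ n)%:C).
Proof.
elim: n b kap => [|n IH] b kap.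
  rewrite /=; apply: eq_bigr => l _; rewrite big_ord0 expi0 mulr1.
  have -> : kap l == 0 by apply/eqP/rowP => -[].
  by rewrite expr0 mul1r rmorph1 mulr1.
pose kap' l : 'rV[int]_n := \row_j kap l 0 (lift ord0 j).
rewrite /=.
transitivity (cint_period (fun t => \sum_(l <- L)
    b l * ((kap' l == 0)%:R * ((2 * pi) ^+ n)%:C) * expi ((kap l 0 0)%:~R * t))).
  congr cint_period; apply/funext => t.
  transitivity (torus_int (fun th : 'rV[R]_n => \sum_(l <- L)
      (b l * expi ((kap l 0 0)%:~R * t)) * expi (\sum_(j < n) (kap' l 0 j)%:~R * th 0 j))).
    congr torus_int; apply/funext => th; apply: eq_bigr => l _.
    rewrite big_ord_recl expiD mulrA; congr (_ * expi (_ * _) * expi _).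
      by rewrite mxE; case: splitP => [p _|p] //; rewrite mxE ord1 eqxx mulr1n.
    apply: eq_bigr => j _; rewrite [kap' l 0 j]mxE; congr (_ * _).
    exact: row_mx_lift.
  by rewrite IH; apply: eq_bigr => l _; rewrite mulrAC.
rewrite cint_period_exps; apply: eq_bigr => l _.
have -> : (kap l == 0) = (kap' l == 0) && (kap l 0 0 == 0).
  apply/eqP/andP => [k0|[/eqP k' /eqP k0]].
    split; apply/eqP; last by rewrite k0 mxE.
    by apply/rowP => j; rewrite !mxE k0 mxE.
  apply/rowP => j; rewrite mxE; case: (unliftP ord0 j) => [j'|] ->; last exact: k0.
  by have /rowP/(_ j') := k'; rewrite !mxE.
rewrite exprS rmorphM /=; case: (kap' l == 0); case: (kap l 0 0 == 0) => /=; ring.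
Qed.

End TorusIntegral.

Section FourierExpSums.
Variables (R : realType) (n : nat) (I : choiceType) (L : seq I) (a : I -> R[i]).
Variables (w : I -> 'I_(n + n) -> R) (kap : I -> 'rV[int]_n).
Hypothesis w_kap : forall l j, w l (rshift n j) = (kap l 0 j)%:~R.
Implicit Types (z : 'rV[R[i]]_(n + n)) (J : 'rV[R[i]]_n).

Local Notation g := (expsum L a w).

Lemma cexp_iM (x : R) : cexp ('i * x%:C) = expi x.
Proof.
have -> : 'i * x%:C = 0 +i* x by apply: eq_complexP; rewrite ?cReM ?cImM /=; ring.
by rewrite /cexp /= expR0 mul1r.
Qed.

Lemma wsum_row (v : 'I_(n + n) -> R) J (J' : 'rV[R[i]]_n) : wsum v (row_mx J J') =
  wsum (fun j => v (lshift n j)) J + wsum (fun j => v (rshift n j)) J'.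
Proof.
rewrite /wsum big_split_ord /=; congr (_ + _); apply: eq_bigr => j _.
  by rewrite row_mxEl.
by rewrite row_mxEr.
Qed.

Lemma wsum_cvec m (v : 'I_m -> R) (x : 'rV[R]_m) :
  wsum v (cvec x) = (\sum_(j < m) v j * x 0 j)%:C.
Proof. by rewrite /wsum rmorph_sum; apply: eq_bigr => j _; rewrite mxE rmorphM. Qed.

Lemma cperiodic_expsum (D : set 'rV[R[i]]_(n + n)) : cperiodic_on D g.
Proof.
move=> z k _; apply: eq_bigr => l _; rewrite wsumD mulrDr cexpD.
rewrite wsum_cvec cexp_iM (_ : expi _ = 1) ?mulr1//.
rewrite big_split_ord /= big1 => [|j _]; last by rewrite row_mxEl mxE mulr0.
rewrite add0r (eq_bigr (fun j => ((kap l 0 j * k 0 j)%:~R * (2 * pi)))) => [|j _].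
  by rewrite -mulr_suml -rmorph_sum expi_int2pi.
by rewrite row_mxEr w_kap !mxE intrM; ring.
Qed.

(** The exponential of index [l] with its dependence on the angles removed. *)
Definition amplitude l J : R[i] := a l * cexp ('i * wsum (fun j => w l (lshift n j)) J).

Lemma fourier_coef_expsum k J :
  fourier_coef g k J = \sum_(l <- L) amplitude l J * (kap l == k)%:R.
Proof.
rewrite /fourier_coef.
transitivity (((2 * pi) ^- n)%:C * torus_int (fun th : 'rV[R]_n =>
   \sum_(l <- L) amplitude l J * expi (\sum_(j < n) ((kap l - k) 0 j)%:~R * th 0 j))).
  congr (_ * torus_int _); apply/funext => th; rewrite /expsum mulr_suml.
  apply: eq_bigr => l _; rewrite wsum_row mulrDr cexpD mulrA -/(amplitude l J).
  rewrite wsum_cvec cexp_iM -mulrA -expiD; congr (_ * expi _).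
  rewrite -sumrN -big_split; apply: eq_bigr => j _ /=.
  by rewrite w_kap !mxE intrB; ring.
rewrite torus_int_exps mulr_sumr; apply: eq_bigr => l _.
have p0 : (2 * pi : R) ^+ n != 0 by rewrite expf_neq0// gt_eqF// mulr_gt0// pi_gt0.
rewrite subr_eq0 mulrCA [X in _ * X]mulrCA -rmorphM mulVf//.
by rewrite rmorph1 mulr1.
Qed.

Lemma trig_polynomial_expsum (s : R) : trig_polynomial s g.
Proof.
apply: (@sub_finite_set _ _ [set` [seq kap l | l <- L]]); last exact: finite_seq.
move=> k [J _]; rewrite fourier_coef_expsum => H; apply: contrapT => /= kL; apply: H.
rewrite big1_seq// => l /andP[_ lL]; case: eqP => [lk|]; last by rewrite mulr0.
by exfalso; apply: kL; rewrite -lk map_f.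
Qed.

(** The Fourier coefficient of index [k] collects the terms whose angular frequency
    is [k], so every term of the exponential sum is counted once. In the action
    variables it grows at most like [exp (`|w| * s)] on the strip, as the sup norm
    of the imaginary part is below its Euclidean norm; in the angles the weight
    of the norm is this same factor. *)
Lemma fourier_norm_expsum_le (s : R) : 0 < s ->
  (fourier_norm s g <=
   (\sum_(l <- L) cabs (a l) * expR (\sum_(j < n + n) `|w l j| * s))%:E)%E.
Proof.
move=> s0; apply: ge_ereal_sup => _ [J Js ->].
pose B l : R := cabs (a l) * expR (\sum_(j < n + n) `|w l j| * s).
have Jj j : `|complex.Im (J 0 j)| <= s.
  apply: ltW; apply: le_lt_trans Js; rewrite /enorm -sqrtr_sqr ler_wsqrtr//.
  by rewrite (bigD1 j)//= mxE lerDl sumr_ge0// => i _; exact: sqr_ge0.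
have B0 l : 0 <= B l by rewrite mulr_ge0 ?cabs_ge0 ?expR_ge0.
apply: (@le_trans _ _ (\esum_(k in [set: 'rV[int]_n]) \sum_(l <- L)
    (if kap l == k then B l else 0)%:E)%E).
  apply: le_esum => k _; rewrite sumEFin lee_fin fourier_coef_expsum.
  apply: le_trans (ler_wpM2r (expR_ge0 _) (cabs_sum _ _)) _.
  rewrite mulr_suml; apply: ler_sum => l _.
  case: eqP => [<-|_]; last by rewrite mulr0 cabs0 mul0r.
  rewrite mulr1 /amplitude cabsM -mulrA ler_wpM2l ?cabs_ge0//.
  apply: le_trans (ler_wpM2r (expR_ge0 _) (cabs_cexp_wsum_le _ Jj)) _.
  rewrite -expRD ler_expR big_split_ord /= lerD2l.
  rewrite le_eqVlt; apply/orP; left; apply/eqP.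
  rewrite /norm1 natr_sum mulr_suml; apply: eq_bigr => j _.
  by rewrite w_kap natr_absz intr_norm.
rewrite esum_sum => [|k l _ _]; last by rewrite lee_fin; case: ifP.
rewrite -sumEFin; apply: lee_sum => l _.
rewrite (_ : (\esum_(k in [set: 'rV[int]_n]) (if kap l == k then B l else 0)%:E)%E
   = (\esum_(k in [set kap l]) (B l)%:E)%E); last first.
  rewrite [RHS]esum_mkcond; apply: eq_esum => k _.
  case: eqP => [<-|kn]; first by rewrite mem_set.
  by rewrite memNset//= => kl; apply: kn.
by rewrite esum_set1 ?lee_fin.
Qed.

End FourierExpSums.

(** * Analytic approximation *)

Section Assembly.
Variables (R : realType).

Lemma dwordB m mu K K' w (g h : 'rV[R]_m -> R) :
  good mu (size w) setT K g -> good mu (size w) setT K' h ->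
  dword w (fun x => g x - h x) = fun x => dword w g x - dword w h x.
Proof.
elim: w => //= j w IH G H.
rewrite (IH (goodW (leqnSn _) G) (goodW (leqnSn _) H)).
have [_ _ _ /(_ j)[dg _]] : good mu 1 setT K (dword w g) by apply: good_dword; rewrite addn1.
have [_ _ _ /(_ j)[dh _]] : good mu 1 setT K' (dword w h) by apply: good_dword; rewrite addn1.
by apply/funext => x; apply: deriveB; [exact: dg|exact: dh].
Qed.

Lemma dword0 m (w : seq 'I_m) : dword w (fun _ : 'rV[R]_m => 0) = fun=> 0.
Proof.
by elim: w => //= j w ->; apply/funext => x; exact: derive_cst.
Qed.

Lemma covariant_exp m (h : 'rV[R]_m -> R[i]) (om : 'I_m -> R) :
  (forall j x (u : R), h (x + u *: delta_mx 0 j) = expi (om j * u) * h x) ->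
  forall x, h x = expi (\sum_(j < m) om j * x 0 j) * h 0.
Proof.
move=> hc x; rewrite {1}(row_sum_delta x).
elim: (index_enum _) => [|j s IH]; first by rewrite !big_nil expi0 mul1r.
by rewrite !big_cons addrC hc IH mulrA -expiD.
Qed.

(** The degree of the kernel that goes with the width [s] of the strip: large
    enough for the moment bound, small enough for the growth on the strip. *)
Lemma truncn_scale (s : R) : 0 < s <= 1 ->
  let N := Num.truncn (s ^- 2) in
  [/\ (0 < N)%N, N.+1%:R^-1 <= s ^+ 2 & s ^+ 2 * N.*2.+1%:R <= 3].
Proof.
move=> /andP[s0 s1] N; have s20 : 0 < s ^+ 2 by rewrite exprn_gt0.
have s21 : s ^+ 2 <= 1 by rewrite exprn_ile1// ltW.
have x1 : 1 <= s ^- 2 by rewrite invf_ge1.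
have /andP[Nx xN] : N%:R <= s ^- 2 < N.+1%:R by apply: truncn_itv; apply: le_trans x1.
split.
- rewrite lt0n; apply/eqP => N0; move: xN; rewrite N0; lra.
- by rewrite -[leRHS]invrK lef_pV2 ?posrE ?invr_gt0// ltW.
- have h : s ^+ 2 * N%:R <= 1.
    by rewrite -[leRHS](mulfV (_ : s ^+ 2 != 0)) ?gt_eqF// ler_wpM2l// ltW.
  rewrite -[N.*2.+1%:R]natr1 -mul2n natrM; lra.
Qed.

Lemma rem_rate_le (mu l s Lam : R) (q r p : nat) : 0 <= mu <= 1 -> l = q%:R + mu ->
  0 < s <= 1 -> 1 <= Lam -> (r <= p)%N -> (p <= q)%N ->
  rem_rate mu s 9 Lam (q - r) <= (9 * Lam) ^+ q * (Lam `^ mu * 10) * s `^ (l - p%:R).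
Proof.
move=> /andP[mu0 mu1] lE /andP[s0 s1] L1 rp pq; rewrite /rem_rate.
have L0 : 0 <= Lam by apply: le_trans L1.
have rq : (r <= q)%N by exact: leq_trans pq.
have sE : s ^+ (q - r) * s `^ mu <= s `^ (l - p%:R).
  rewrite -powR_mulrn ?(ltW s0)// -powRD; last by rewrite (gt_eqF s0) implybT.
  apply: ger_powR; first by rewrite s0.
  by rewrite lE natrB//; have : r%:R <= p%:R :> R by [rewrite ler_nat|]; lra.
have LE : (9 * Lam) ^+ (q - r) <= (9 * Lam) ^+ q.
  by rewrite ler_weXn2l ?leq_subr//; lra.
have -> : (Lam * (9 * s)) ^+ (q - r) * ((Lam * s) `^ mu * (1 + 9))
  = (9 * Lam) ^+ (q - r) * (Lam `^ mu * 10) * (s ^+ (q - r) * s `^ mu).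
  rewrite powRM ?(ltW s0)// (_ : Lam * (9 * s) = (9 * Lam) * s); last by ring.
  by rewrite exprMn; ring.
apply: ler_pM => //.
- by rewrite mulr_ge0 ?exprn_ge0 ?mulr_ge0 ?powR_ge0.
- by rewrite mulr_ge0 ?exprn_ge0 ?powR_ge0// ltW.
- by rewrite ler_wpM2r// mulr_ge0 ?powR_ge0.
Qed.

End Assembly.

Theorem theorem4p1 (R : realType) (n : nat) (l rho : R) (n_ge1 : (1 <= n)%N)
    (l_gt0 : 0 < l) (floor_l : (n.+1 <= Num.truncn l)%N) (rho_gt0 : 0 < rho) :
  exists CA CB : R,
    forall (s : R) (f : 'rV[R]_(n + n) -> R),
      0 < s <= 1 ->
      periodic_on (ball_torus n (2 * rho)) f ->
      holder_class l (ball_torus n (2 * rho)) f ->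
      exists fs : 'rV[R[i]]_(n + n) -> R[i],
        [/\ analytic_on (cdomain n s) fs,
            cperiodic_on (cdomain n s) fs,
            (forall p : nat, (p <= Num.truncn l)%N ->
               (cnorm_C p (ball_torus n rho) (fun x => (f x)%:C - fs (cvec x))%R
                <= (CA * s `^ (l - p%:R))%R%:E
                   * holder_norm l (ball_torus n (2 * rho)) f)%E),
            (fourier_norm s fs
                <= CB%:E * holder_norm l (ball_torus n (2 * rho)) f)%E
          & trig_polynomial s fs].
Proof.
set q := Num.truncn l in floor_l *; pose mu := l - q%:R.
have /andP[mu0 mu_lt1] : 0 <= mu < 1 by apply: frac_part_itv; exact: ltW.
have mu01 : 0 <= mu <= 1 by rewrite mu0 ltW.
have m0 : (0 < n + n)%N by rewrite addn_gt0 n_ge1.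
(* [Lam] and [iLam] bound the scales of all the axes and their inverses, for the
   action coordinates and for the angles at once. *)
pose lam : 'I_(n + n) -> R := axis_scale rho.
pose Lam : R := 1 + 2 * rho / pi; pose iLam : R := 1 + pi / (2 * rho).
have p0 := pi_gt0 R.
have lam0 j : 0 < lam j by exact: axis_scale_gt0.
have lamL j : lam j <= Lam.
  rewrite /lam /axis_scale /Lam; case: fintype.split => _; first by rewrite lerDr.
  by rewrite lerDl divr_ge0 ?mulr_ge0// ltW.
have lamI j : (lam j)^-1 <= iLam.
  rewrite /lam /axis_scale /iLam; case: fintype.split => _.
    by rewrite invf_div lerDr.
  by rewrite invr1 lerDl divr_ge0 ?mulr_ge0// ltW.
have Lam1 : 1 <= Lam by rewrite lerDl divr_ge0 ?mulr_ge0// ltW.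
have [Ce Ce1 ext] := periodic_extension n q mu01 rho_gt0.
have [CS CS0 coefs] := sum_modes_le n_ge1 floor_l lam0 lamL.
pose A : R := 1 + 2 ^+ q.+1.
pose js := enum 'I_(n + n).
have sjs : size js = (n + n)%N by rewrite size_enum_ord.
pose CA : R := (n + n)%:R * A ^+ (n + n) * 2 ^+ q * (Ce * 2) * ((9 * Lam) ^+ q * (Lam `^ mu * 10)).
pose G : R := q.+1%:R * expR (3 * iLam ^+ 2 / 4).
exists CA, (G ^+ (n + n) * (CS * (Ce * 2))) => s f s01 pf hf.
have /andP[s0 s1] := s01.
have [H [H0 HE Gf]] := good_of_holder (Ordinal m0) (@open_ball_torus R n (2 * rho))
  (@line_convex_ball_torus R n (2 * rho))
  (@ball_torus0 R n _ (mulr_gt0 (ltr0Sn R 1) rho_gt0)) l_gt0 hf.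
rewrite HE.
have H20 : 0 <= 2 * H by rewrite mulr_ge0.
have [g [Gg gf pg0]] := ext f (2 * H) H20 pf Gf.
have pg j y : g (y + (2 * pi * lam j) *: delta_mx 0 j) = g y by exact: pg0.
pose K := Ce * (2 * H).
pose N := Num.truncn (s ^- 2).
have [N0 Ns sN] := truncn_scale s01; rewrite -/N in N0 Ns sN.
pose V := @dlvp R N.
have cV : continuous V by exact: dlvp_continuous.
have V0 : forall t, 0 <= V t by exact: dlvp_ge0.
have V4 : forall t, V t <= 4 ^+ N by exact: dlvp_le.
have V1 : mean V = 1 by exact: dlvp_mean.
have Vm : mean (fun t => `|t| * V t) <= 9 * s by exact: dlvp_moment.
pose T := smooth_axes V lam q js g.
pose toC (h : 'rV[R]_(n + n) -> R) x := (h x)%:C.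
(* [c], [a] and [w] are the coefficients of [g], those of the approximation and
   the frequencies; [kap] is the angular part of the frequency, an integer
   vector since the angles have scale 1. *)
pose c ks := modes lam js ks (toC g) 0.
pose a (ks : seq int) : R[i] := (\prod_(k <- ks) multiplier (@dlvp_coef R N) q.+1 k)%:C * c ks.
pose w (ks : seq int) (j : 'I_(n + n)) : R := (nth 0 ks j)%:~R / lam j.
pose kap (ks : seq int) : 'rV[int]_n := \row_j nth 0 ks (rshift n j).
pose L := freqs (sym_freqs N) (n + n).
have w_kap ks j : w ks (rshift n j) = (kap ks 0 j)%:~R.
  rewrite /w /kap mxE /lam /axis_scale; case: splitP => i /= E.
    by have := ltn_ord i; rewrite -E -[X in (_ < X)%N]addn0 ltn_add2l.
  by rewrite divr1.
have TE x : expsum L a w (cvec x) = (T x)%:C.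
  rewrite /T (smooth_axes_modes lam0 cV V0 V4 V1 (sym_freqs_uniq N)
    (@dlvp_fourier R N) q js x Gg pg).
  rewrite sjs; apply: eq_big_seq => ks ksL; rewrite /a -mulrA; congr (_ * _).
  have sk := size_freqs ksL.
  rewrite wsum_cvec cexp_iM mulrC.
  rewrite (@covariant_exp R _ (modes lam js ks (toC g)) (w ks))// => j y u.
  rewrite (modes_shift lam0 y u (cgood_good Gg)) ?enum_uniq ?sk ?sjs ?mem_enum//.
    by rewrite index_enum_ord /w; congr (expi _ * _); ring.
  by move=> i z; rewrite pg.
exists (expsum L a w); split.
- exact: analytic_expsum.
- exact: (cperiodic_expsum _ _ w_kap).
- move=> p pq; rewrite -EFinM; apply: ge_ereal_sup => _ [al [x [alp xD ->]]].
  rewrite lee_fin /cpderiv.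
  (* On real points the approximation is [T], real-valued, so the derivatives of
     the difference are those of [g - T] near [x]. *)
  have -> : (fun y => complex.Im ((f y)%:C - expsum L a w (cvec y))) = fun=> 0.
    by apply/funext => y; rewrite TE /= subrr.
  have -> : (fun y => complex.Re ((f y)%:C - expsum L a w (cvec y))) = fun y => f y - T y.
    by apply/funext => y; rewrite TE.
  rewrite !pderiv_dword dword0; set wd := word_of_mindex al.
  have swd : size wd = mdeg al by exact: size_word_of_mindex.
  have wdq : (size wd <= q)%N by rewrite swd (leq_trans alp).
  have fgT : dword wd (fun y => f y - T y) x = dword wd (fun y => g y - T y) x.
    by apply: (dword_eq_on wd (@open_ball_torus R n rho) _ xD) => y yD; rewrite gf.
  rewrite fgT complexr0 cabs_real.
  have Gw := goodW wdq Gg.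
  have Tw := good_smooth_axes lam cV V0 V4 V1 q js Gw.
  rewrite (dwordB Gw Tw) (dword_smooth_axes lam cV V0 V4 V1 q js Gw).
  have Gd : good mu (q - size wd) setT K (dword wd g).
    by apply: good_dword; rewrite subnKC.
  apply: le_trans (smooth_axes_err mu01 cV V0 V4 V1 s0 (ler0n R 9) Vm
     lam0 lamL js x m0 (leq_subr _ _) Gd) _.
  rewrite sjs -/A.
  have rr : rem_rate mu s 9 Lam (q - size wd)
      <= (9 * Lam) ^+ q * (Lam `^ mu * 10) * s `^ (l - p%:R).
    by apply: rem_rate_le => //; rewrite ?swd// /mu addrC subrK.
  apply: le_trans (ler_wpM2l _ rr) _.
    rewrite !mulr_ge0 ?exprn_ge0 ?addr_ge0 ?exprn_ge0//.
    by apply: le_trans Ce1.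
  by rewrite /K /CA le_eqVlt; apply/orP; left; apply/eqP; ring.
- apply: le_trans (fourier_norm_expsum_le L a w_kap s0) _.
  rewrite -EFinM lee_fin.
  apply: (@le_trans _ _ (\sum_(ks <- L) G ^+ (n + n) * cabs (c ks))); last first.
    rewrite -mulr_sumr -[leRHS]mulrA -[X in _ <= _ * X]mulrA -[Ce * 2 * H]mulrA; apply: ler_wpM2l.
    + by rewrite exprn_ge0// mulr_ge0 ?expR_ge0.
    + by have := coefs N mu K g Gg pg; rewrite /K.
  (* The factor of the coefficient [c ks] is a product over the coordinates, each
     bounded by [G] independently of [s]. *)
  rewrite big_seq [leRHS]big_seq; apply: ler_sum => ks ksL.
  rewrite /a cabsM cabs_real mulrAC ler_wpM2r ?cabs_ge0//.
  have sk := size_freqs ksL.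
  rewrite expR_sum normr_prod (big_nth 0) big_mkord sk -big_split /=.
  have -> : G ^+ (n + n) = \prod_(j < n + n) G by rewrite prodr_const card_ord.
  apply: ler_prod => j _; rewrite mulr_ge0 ?expR_ge0//=.
  have kN : nth 0 ks j \in sym_freqs N.
    by apply: mem_freqs ksL _; apply: mem_nth; rewrite sk.
  have -> : `|w ks j| * s = `|(nth 0 ks j)%:~R| * (s / lam j).
    by rewrite /w normrM [`|_^-1|]gtr0_norm ?invr_gt0//; ring.
  apply: le_trans (multiplier_exp_le q.+1 (s / lam j) kN) _.
  rewrite /G ler_wpM2l// ler_expR ler_wpM2r//.
  have i0 : 0 <= (lam j)^-1 by rewrite invr_ge0 ltW.
  have i2 : (lam j)^-1 ^+ 2 <= iLam ^+ 2.
    by apply: lerXn2r; rewrite ?nnegrE//; apply: le_trans (lamI j).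
  rewrite exprMn mulrAC; apply: ler_pM => //.
  + by rewrite mulr_ge0// sqr_ge0.
  + exact: sqr_ge0.
- exact: (trig_polynomial_expsum L a w_kap).
Qed.
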